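(* Let $p$ be a prime, $G=\mathrm{U}(1,1)(\mathbb{Q}_{p^2}/\mathbb{Q}_p)$ with diagonal torus $T$ and upper-triangular Borel subgroup $B$. Let $E/\mathbb{Q}_p$ be a finite extension with ring of integers $\mathcal{O}$ and residue field $k$, and let $\overline\chi:G\to k^\times$ be a smooth character. Then the natural transformation $$\mathrm{St}_B^G:\mathrm{Def}_{\overline\chi}\to\mathrm{Def}_{\mathrm{St}_G\otimes\overline\chi}$$ of functors on $\mathrm{Art}(\mathcal{O})$, sending (the class of) a lift $\sigma:G\to A^\times$ of $\overline\chi$ to (the class of) $\mathrm{St}_B^G(\sigma)=\mathrm{Ind}_B^G(\sigma|_T)/\sigma$, is an isomorphism of functors.
   Context: $G=\{g\in\mathrm{GL}_2(\mathbb{Q}_{p^2}) : c(g)^tJg=J\}$ where $c$ is the nontrivial automorphism of the unramified quadratic extension $\mathbb{Q}_{p^2}/\mathbb{Q}_p$ and $J=\begin{pmatrix}0&1\\1&0\end{pmatrix}$; $T$ is the diagonal subgroup and $B=TU$ the upper-triangular subgroup of $G$, $U$ its unipotent radical. For a smooth character $\sigma|_T$ of $T$ with values in $A^\times$ (inflated to $B$ trivially on $U$), $\mathrm{Ind}_B^G(\sigma|_T)$ is the smooth induction (locally constant-on-the-right functions $f:G\to A$ with $f(bg)=\sigma(b)f(g)$, $G$ acting by right translation); when $\sigma|_T$ extends to the character $\sigma$ of $G$, the line of functions $g\mapsto a\sigma(g)$ is a subrepresentation isomorphic to $\sigma$, and $\mathrm{St}_B^G(\sigma)$ is the quotient. Over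 $k$, $\mathrm{St}_G=\mathrm{Ind}_B^G(\mathbf{1})/\mathbf{1}$ is the Steinberg representation and $\mathrm{St}_B^G(\overline\chi)\cong\mathrm{St}_G\otimes\overline\chi$. $\mathrm{Art}(\mathcal{O})$ is the category of local Artinian $\mathcal{O}$-algebras with residue field identified with $k$ via the structure map, with local $\mathcal{O}$-algebra morphisms. For a smooth representation $\overline\pi$ of $G$ over $k$, a lift to $A\in\mathrm{Art}(\mathcal{O})$ is a pair $(\pi,\phi)$ with $\pi$ a smooth $A[G]$-module free over $A$ and $\phi:\pi\to\overline\pi$ an $A[G]$-linear surjection inducing $\pi\otimes_Ak\cong\overline\pi$; $\mathrm{Def}_{\overline\pi}(A)$ is the set of isomorphism classes of lifts (isomorphisms compatible with the $\phi$'s). *)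

(* Defs.v *)
From HB Require Import structures.
From mathcomp Require Import all_boot all_order all_algebra all_field.
From mathcomp Require Import all_classical topology_structure.

Set Implicit Arguments.
Unset Strict Implicit.
Unset Printing Implicit Defensive.

Import Order.TTheory GRing.Theory Num.Theory.

Local Open Scope classical_set_scope.
Local Open Scope ring_scope.
Local Open Scope quotient_scope.

Definition padic_val (p : nat) (q : rat) : int :=
  (logn p `|numq q|%N)%:Z - (logn p `|denq q|%N)%:Z.

Definition padic_abs (p : nat) (q : rat) : rat :=
  if q == 0 then 0 else p%:R ^ (- padic_val p q).

(* A completion of Q for the p-adic absolute value, unique up to a unique
   isomorphism.  The absolute value of Q_p takes its values in p^Z and 0, hence
   the codomain rat. *)
Record padicField (p : nat) := PadicField {
  padic_sort :> fieldType;
  padic_norm : padic_sort -> rat;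
  padic_norm_eq0 : forall x, (padic_norm x == 0) = (x == 0);
  padic_normM : forall x y, padic_norm (x * y) = padic_norm x * padic_norm y;
  padic_normD : forall x y,
    padic_norm (x + y) <= Num.max (padic_norm x) (padic_norm y);
  padic_norm_ratr : forall q : rat, padic_norm (ratr q) = padic_abs p q;
  padic_dense : forall (x : padic_sort) (e : rat), 0 < e ->
    exists q : rat, padic_norm (x - ratr q) < e;
  padic_complete : forall u : nat -> padic_sort,
    (forall e : rat, 0 < e -> exists N, forall m n, (N <= m)%N -> (N <= n)%N ->
       padic_norm (u m - u n) < e) ->
    exists l, forall e : rat, 0 < e -> exists N, forall n, (N <= n)%N ->
       padic_norm (u n - l) < e
}.

Section PadicIntegers.
Variables (p : nat) (Qp : padicField p).

Definition padic_int : {pred Qp} := [pred x | padic_norm x <= 1].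

Lemma padic_norm1 : padic_norm (1 : Qp) = 1.
Proof.
have n1 : padic_norm (1 : Qp) != 0 by rewrite padic_norm_eq0 oner_eq0.
by apply: (mulfI n1); rewrite -padic_normM !mulr1.
Qed.

Lemma padic_normN1 : padic_norm (-1 : Qp) = 1.
Proof.
have := padic_norm_ratr Qp (-1)%:~R; rewrite ratr_int mulrN1z => ->.
by rewrite /padic_abs /padic_val /= !logn1 subrr oppr0 expr0z.
Qed.

Lemma padic_norm_ge0 (x : Qp) : 0 <= padic_norm x.
Proof.
have /eqP n0 : padic_norm (0 : Qp) == 0 by rewrite padic_norm_eq0.
have := padic_normD x (- x).
by rewrite subrr n0 -mulN1r padic_normM padic_normN1 mul1r maxxx.
Qed.

Fact padic_int_subring : subring_closed padic_int.
Proof.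
split; rewrite ?inE ?padic_norm1 // => x y; rewrite !inE => hx hy.
  apply: le_trans (padic_normD _ _) _.
  by rewrite ge_max hx -mulN1r padic_normM padic_normN1 mul1r.
by rewrite padic_normM mulr_ile1 ?padic_norm_ge0.
Qed.
HB.instance Definition _ :=
  GRing.isSubringClosed.Build Qp padic_int padic_int_subring.

Record Zp := ZpElt { Zp_val :> Qp; _ : Zp_val \in padic_int }.
HB.instance Definition _ := [isSub for Zp_val].
HB.instance Definition _ := [Choice of Zp by <:].
HB.instance Definition _ := [SubChoice_isSubComNzRing of Zp by <:].

End PadicIntegers.

Arguments padic_int {p} Qp.

Section RingOfIntegers.
Variables (p : nat) (Qp : padicField p) (L : fieldExtType Qp).

Definition Zp_emb : Zp Qp -> L := in_alg L \o val.
HB.instance Definition _ := GRing.RMorphism.on Zp_emb.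

Definition integers : {pred L} := [pred x | `[< integralOver Zp_emb x >]].

Lemma integersP x : reflect (integralOver Zp_emb x) (x \in integers).
Proof. exact: asboolP. Qed.

Fact integers_subring : subring_closed integers.
Proof.
split=> [|x y /integersP hx /integersP hy|x y /integersP hx /integersP hy].
- by apply/integersP; exact: integral1.
- by apply/integersP; exact: integral_sub.
- by apply/integersP; exact: integral_mul.
Qed.
HB.instance Definition _ :=
  GRing.isSubringClosed.Build L integers integers_subring.

Record intRing := IntRing { intRing_val :> L; _ : intRing_val \in integers }.
HB.instance Definition _ := [isSub for intRing_val].
HB.instance Definition _ := [Choice of intRing by <:].
HB.instance Definition _ := [SubChoice_isSubComNzRing of intRing by <:].

(* p generates the maximal ideal of the ring of integers (ramification index 1) *)
Definition unramified : Prop :=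
  forall x : L, x \in integers -> x^-1 \notin integers ->
    exists2 y, y \in integers & x = p%:R * y.

Definition padic_close (n : nat) (x y : L) : Prop :=
  exists2 z, z \in integers & x - y = p%:R ^+ n * z.

Lemma padic_close_le n m x y : (m <= n)%N -> padic_close n x y ->
  padic_close m x y.
Proof.
move=> /subnKC <- [z hz e]; exists (p%:R ^+ (n - m) * z).
  by rewrite rpredM // rpredX // rpred_nat.
by rewrite e exprD mulrA.
Qed.

End RingOfIntegers.

Arguments integers {p Qp} L.

(* a group with a topology; no definition below uses their compatibility *)
#[short(type="groupTopType")]
HB.structure Definition GroupTop := {G of Group G & Topological G}.

Section Unitary.
Variables (p : nat) (Qp : padicField p) (L : fieldExtType Qp).
Variable c : {lrmorphism L -> L}.

Definition antidiag : 'M[L]_2 := \matrix_(i, j) (i != j)%:R.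

Definition unitary : {pred 'M[L]_2} :=
  [pred g | (g \in unitmx) && ((map_mx c g)^T *m antidiag *m g == antidiag)].

Record U11 := U11Elt { U11_val :> 'M[L]_2; U11P : U11_val \in unitary }.
HB.instance Definition _ := [isSub for U11_val].
HB.instance Definition _ := [Choice of U11 by <:].

Fact unitary1 : 1%:M \in unitary.
Proof. by rewrite inE unitmx1 map_mx1 trmx1 mul1mx mulmx1 eqxx. Qed.

Fact unitaryM (g h : U11) : val g *m val h \in unitary.
Proof.
case: g h => [g /= /andP[ug /eqP hg]] [h /= /andP[uh /eqP hh]].
rewrite inE unitmx_mul ug uh /= map_mxM trmx_mul.
by rewrite -[X in _ == X]hh -[X in _ == _ *m X *m _]hg !mulmxA.
Qed.

Fact unitaryV (g : U11) : invmx (val g) \in unitary.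
Proof.
case: g => [g /= /andP[ug /eqP hg]].
rewrite inE unitmx_inv ug /= -[X in _ *m X *m _]hg !mulmxA -trmx_mul -map_mxM.
by rewrite mulmxV // map_mx1 trmx1 mul1mx -mulmxA mulmxV // mulmx1.
Qed.

Definition U11_one : U11 := U11Elt unitary1.
Definition U11_mul (g h : U11) : U11 := U11Elt (unitaryM g h).
Definition U11_inv (g : U11) : U11 := U11Elt (unitaryV g).

Fact U11_mulA : associative U11_mul.
Proof. by move=> g h k; apply: val_inj; rewrite /= mulmxA. Qed.
Fact U11_mul1g : left_id U11_one U11_mul.
Proof. by move=> g; apply: val_inj; rewrite /= mul1mx. Qed.
Fact U11_mulg1 : right_id U11_one U11_mul.
Proof. by move=> g; apply: val_inj; rewrite /= mulmx1. Qed.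
Fact U11_mulVg : left_inverse U11_one U11_inv U11_mul.
Proof.
by move=> g; apply: val_inj; rewrite /= mulVmx //; case: g => g /= /andP[].
Qed.
Fact U11_mulgV : right_inverse U11_one U11_inv U11_mul.
Proof.
by move=> g; apply: val_inj; rewrite /= mulmxV //; case: g => g /= /andP[].
Qed.
HB.instance Definition _ := isGroup.Build U11
  U11_mulA U11_mul1g U11_mulg1 U11_mulVg U11_mulgV.

(* the topology induced by the p-adic topology of 'M[L]_2 *)
Definition U11_open : set_system U11 := [set X : set U11 |
  forall g : U11, X g -> exists n, forall h : U11,
    (forall i j, padic_close n (val h i j) (val g i j)) -> X h].

Fact U11_openT : U11_open setT.
Proof. by move=> g _; exists 0%N. Qed.

Fact U11_openI : setI_closed U11_open.
Proof.
move=> X Y oX oY g [/oX[n hn] /oY[m hm]]; exists (maxn n m) => h hh.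
by split; [apply: hn|apply: hm] => i j; apply: padic_close_le (hh i j);
  rewrite ?leq_maxl ?leq_maxr.
Qed.

Fact U11_open_bigU (I : Type) (f : I -> set U11) :
  (forall i, U11_open (f i)) -> U11_open (\bigcup_i f i).
Proof.
by move=> o g [i _ /(o i)[n hn]]; exists n => h /hn fh; exists i.
Qed.
HB.instance Definition _ := isOpenTopological.Build U11
  U11_openT U11_openI U11_open_bigU.

Definition torus : set U11 :=
  [set g : U11 | val g ord_max ord0 = 0 /\ val g ord0 ord_max = 0].
Definition unipotent : set U11 :=
  [set g : U11 | val g ord_max ord0 = 0 /\
           val g ord0 ord0 = 1 /\ val g ord_max ord_max = 1].

End Unitary.

(* An A-module up to the equivalence pm_eq; moduleQuot is its quotient. *)
Record premodule (A : comNzRingType) := Premodule {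
  pm_sort : choiceType;
  pm_eq : pm_sort -> pm_sort -> Prop;
  pm_zero : pm_sort;
  pm_opp : pm_sort -> pm_sort;
  pm_add : pm_sort -> pm_sort -> pm_sort;
  pm_scale : A -> pm_sort -> pm_sort;
  pm_refl : forall x, pm_eq x x;
  pm_sym : forall x y, pm_eq x y -> pm_eq y x;
  pm_trans : forall x y z, pm_eq x y -> pm_eq y z -> pm_eq x z;
  pm_oppE : forall x x', pm_eq x x' -> pm_eq (pm_opp x) (pm_opp x');
  pm_addE : forall x x' y y', pm_eq x x' -> pm_eq y y' ->
    pm_eq (pm_add x y) (pm_add x' y');
  pm_scaleE : forall a x x', pm_eq x x' -> pm_eq (pm_scale a x) (pm_scale a x');
  pm_addA : forall x y z, pm_eq (pm_add x (pm_add y z)) (pm_add (pm_add x y) z);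
  pm_addC : forall x y, pm_eq (pm_add x y) (pm_add y x);
  pm_add0 : forall x, pm_eq (pm_add pm_zero x) x;
  pm_addN : forall x, pm_eq (pm_add (pm_opp x) x) pm_zero;
  pm_scaleA : forall a b x,
    pm_eq (pm_scale a (pm_scale b x)) (pm_scale (a * b) x);
  pm_scale1 : forall x, pm_eq (pm_scale 1 x) x;
  pm_scaleDr : forall a x y,
    pm_eq (pm_scale a (pm_add x y)) (pm_add (pm_scale a x) (pm_scale a y));
  pm_scaleDl : forall x a b,
    pm_eq (pm_scale (a + b) x) (pm_add (pm_scale a x) (pm_scale b x))
}.

Section ModuleQuot.
Variables (A : comNzRingType) (M : premodule A).
Local Notation X := (pm_sort M).

Definition pm_rel : rel X := fun x y => `[< pm_eq x y >].
Fact pm_rel_refl : reflexive pm_rel.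
Proof. by move=> x; apply/asboolP; exact: pm_refl. Qed.
Fact pm_rel_sym : symmetric pm_rel.
Proof. by move=> x y; apply: asbool_equiv_eq; split; exact: pm_sym. Qed.
Fact pm_rel_trans : transitive pm_rel.
Proof. by move=> y x z /asboolP h /asboolP h'; apply/asboolP; apply: pm_trans h h'. Qed.
Definition pm_equiv : equiv_rel X := EquivRel pm_rel pm_rel_refl pm_rel_sym pm_rel_trans.

Definition moduleQuot := {eq_quot pm_equiv}.
HB.instance Definition _ := Choice.on moduleQuot.
HB.instance Definition _ := EqQuotient.on moduleQuot.
Local Notation Q := moduleQuot.

Definition mq (x : X) : Q := \pi_Q x.
Definition mrepr (x : Q) : X := repr x.

Lemma mqP x y : mq x = mq y <-> pm_eq x y.
Proof. by split=> [/eqmodP /asboolP|h] //; apply/eqmodP/asboolP. Qed.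
Lemma mreprK x : mq (mrepr x) = x. Proof. exact: reprK. Qed.
Lemma mreprP x : pm_eq (mrepr (mq x)) x.
Proof. by apply/mqP; rewrite mreprK. Qed.

Definition mq_zero : Q := mq (pm_zero M).
Definition mq_opp (x : Q) : Q := mq (pm_opp (mrepr x)).
Definition mq_add (x y : Q) : Q := mq (pm_add (mrepr x) (mrepr y)).
Definition mq_scale a (x : Q) : Q := mq (pm_scale a (mrepr x)).

Lemma mq_addE x y : mq_add (mq x) (mq y) = mq (pm_add x y).
Proof. by apply/mqP/pm_addE; exact: mreprP. Qed.
Lemma mq_oppE x : mq_opp (mq x) = mq (pm_opp x).
Proof. by apply/mqP/pm_oppE; exact: mreprP. Qed.
Lemma mq_scaleE a x : mq_scale a (mq x) = mq (pm_scale a x).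
Proof. by apply/mqP/pm_scaleE; exact: mreprP. Qed.
Lemma mqW (P : Q -> Prop) : (forall x, P (mq x)) -> forall x, P x.
Proof. by move=> h x; rewrite -[x]mreprK. Qed.

Fact mq_addA : associative mq_add.
Proof.
elim/mqW=> x; elim/mqW=> y; elim/mqW=> z.
by rewrite !mq_addE; apply/mqP/pm_addA.
Qed.
Fact mq_addC : commutative mq_add.
Proof.
elim/mqW=> x; elim/mqW=> y.
by rewrite !mq_addE; apply/mqP/pm_addC.
Qed.
Fact mq_add0 : left_id mq_zero mq_add.
Proof. by elim/mqW=> x; rewrite !mq_addE; apply/mqP/pm_add0. Qed.
Fact mq_addN : left_inverse mq_zero mq_opp mq_add.
Proof. by elim/mqW=> x; rewrite mq_oppE !mq_addE; apply/mqP/pm_addN. Qed.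
HB.instance Definition _ :=
  GRing.isZmodule.Build Q mq_addA mq_addC mq_add0 mq_addN.

Fact mq_scaleA a b x : mq_scale a (mq_scale b x) = mq_scale (a * b) x.
Proof. by elim/mqW: x => x; rewrite !mq_scaleE; apply/mqP/pm_scaleA. Qed.
Fact mq_scale1 : left_id 1 mq_scale.
Proof. by elim/mqW=> x; rewrite mq_scaleE; apply/mqP/pm_scale1. Qed.
Fact mq_scaleDr : right_distributive mq_scale +%R.
Proof.
move=> a; elim/mqW=> x; elim/mqW=> y; rewrite [X in mq_scale a X]mq_addE.
rewrite !mq_scaleE [RHS]mq_addE.
exact/mqP/pm_scaleDr.
Qed.
Fact mq_scaleDl x : {morph mq_scale^~ x : a b / a + b}.
Proof.
move=> a b; elim/mqW: x => x; rewrite !mq_scaleE [RHS]mq_addE.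
exact/mqP/pm_scaleDl.
Qed.
HB.instance Definition _ := GRing.Zmodule_isLmodule.Build A Q
  mq_scaleA mq_scale1 mq_scaleDr mq_scaleDl.

Lemma mqD x y : mq (pm_add x y) = mq x + mq y.
Proof. by rewrite [RHS]mq_addE. Qed.
Lemma mqN x : mq (pm_opp x) = - mq x.
Proof. by rewrite [RHS]mq_oppE. Qed.
Lemma mqZ a x : mq (pm_scale a x) = a *: mq x.
Proof. by rewrite [RHS]mq_scaleE. Qed.

End ModuleQuot.

Definition submodule (A : comNzRingType) (V : lmodType A) (N : set V) : Prop :=
  [/\ N 0, forall u v, N u -> N v -> N (u + v) & forall a v, N v -> N (a *: v)].

Section QuotientModule.
Variables (A : comNzRingType) (V : lmodType A) (N : set V) (sN : submodule N).

Let sN0 : N 0. Proof. by case: sN. Qed.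
Let sND u v : N u -> N v -> N (u + v). Proof. by case: sN => _ + _; apply. Qed.
Let sNZ a v : N v -> N (a *: v). Proof. by case: sN => _ _; apply. Qed.
Let sNN v : N v -> N (- v). Proof. by move=> ?; rewrite -scaleN1r; apply: sNZ. Qed.
Let eqN (x y : V) := N (x - y).
Let eqNxx x y : x = y -> eqN x y. Proof. by move->; rewrite /eqN subrr. Qed.

Definition quotient_pre : premodule A.
Proof.
exists V eqN 0 -%R +%R *:%R.
- by move=> x; exact: eqNxx.
- by move=> x y /sNN; rewrite /eqN opprB.
- by move=> x y z h /(sND h); rewrite /eqN addrA subrK.
- by move=> x y /sNN; rewrite /eqN opprD.
- by move=> x x' y y' h /(sND h); rewrite /eqN opprD addrACA.
- by move=> a x y /(sNZ a); rewrite /eqN scalerBr.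
- by move=> x y z; apply: eqNxx; rewrite addrA.
- by move=> x y; apply: eqNxx; rewrite addrC.
- by move=> x; apply: eqNxx; rewrite add0r.
- by move=> x; apply: eqNxx; rewrite addNr.
- by move=> a b x; apply: eqNxx; rewrite scalerA.
- by move=> x; apply: eqNxx; rewrite scale1r.
- by move=> a x y; apply: eqNxx; rewrite scalerDr.
- by move=> x a b; apply: eqNxx; rewrite scalerDl.
Defined.

End QuotientModule.

(* For f : A -> A', tensor f V is the A'-module A' (x)_A V: finite sums of
   symbols (a', v), two of them being identified when every balanced biadditive
   map to an abelian group takes the same value on both. *)
Section Tensor.
Variables (A A' : comNzRingType) (f : {rmorphism A -> A'}) (V : lmodType A).

Record balanced (W : zmodType) (b : A' -> V -> W) : Prop := Balanced {
  balancedDl : forall x y v, b (x + y) v = b x v + b y v;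
  balancedDr : forall x u v, b x (u + v) = b x u + b x v;
  balancedM : forall x a v, b (x * f a) v = b x (a *: v)
}.

Definition tens_sum (W : zmodType) (b : A' -> V -> W) (s : seq (A' * V)) : W :=
  \sum_(t <- s) b t.1 t.2.

Definition tens_eq (s s' : seq (A' * V)) : Prop :=
  forall (W : zmodType) (b : A' -> V -> W), balanced b ->
    tens_sum b s = tens_sum b s'.

Lemma balanced0l (W : zmodType) (b : A' -> V -> W) v : balanced b -> b 0 v = 0.
Proof.
by move=> bb; apply: (addrI (b 0 v)); rewrite -(balancedDl bb) !addr0.
Qed.
Lemma balanced0r (W : zmodType) (b : A' -> V -> W) x : balanced b -> b x 0 = 0.
Proof.
by move=> bb; apply: (addrI (b x 0)); rewrite -(balancedDr bb) !addr0.
Qed.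
Lemma balancedNl (W : zmodType) (b : A' -> V -> W) x v :
  balanced b -> b (- x) v = - b x v.
Proof.
move=> bb; apply: (addrI (b x v)).
by rewrite -(balancedDl bb) !subrr balanced0l.
Qed.
Lemma balanced_scale (W : zmodType) (b : A' -> V -> W) c :
  balanced b -> balanced (fun x => b (c * x)).
Proof.
move=> bb; split=> [x y v|x u v|x a v]; first by rewrite mulrDr (balancedDl bb).
  by rewrite (balancedDr bb).
by rewrite mulrA (balancedM bb).
Qed.

Definition tens_opp (s : seq (A' * V)) := [seq (- t.1, t.2) | t <- s].
Definition tens_scale a (s : seq (A' * V)) := [seq (a * t.1, t.2) | t <- s].

Lemma tens_sum_opp (W : zmodType) (b : A' -> V -> W) s : balanced b ->
  tens_sum b (tens_opp s) = - tens_sum b s.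
Proof.
move=> bb; rewrite /tens_sum big_map -sumrN; apply: eq_bigr => t _ /=.
exact: balancedNl.
Qed.
Lemma tens_sum_add (W : zmodType) (b : A' -> V -> W) s s' :
  tens_sum b (s ++ s') = tens_sum b s + tens_sum b s'.
Proof. exact: big_cat. Qed.
Lemma tens_sum_scale (W : zmodType) (b : A' -> V -> W) a s :
  tens_sum b (tens_scale a s) = tens_sum (fun x => b (a * x)) s.
Proof. by rewrite /tens_sum big_map. Qed.

Definition tensor_pre : premodule A'.
Proof.
exists (seq (A' * V)) tens_eq [::] tens_opp cat tens_scale.
- by move=> s W b.
- by move=> s s' e W b bb; rewrite e.
- by move=> s s' s'' e e' W b bb; rewrite e // e'.
- by move=> s s' e W b bb; rewrite !tens_sum_opp // e.
- by move=> s s' t t' e e' W b bb; rewrite !tens_sum_add e // e'.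
- by move=> a s s' e W b bb; rewrite !tens_sum_scale e //; exact: balanced_scale.
- by move=> s s' t W b bb; rewrite catA.
- by move=> s s' W b bb; rewrite !tens_sum_add addrC.
- by move=> s W b bb.
- move=> s W b bb; rewrite tens_sum_add tens_sum_opp // addNr.
  by rewrite /tens_sum big_nil.
- move=> a a' s W b bb; rewrite !tens_sum_scale.
  by apply: eq_bigr => t _; rewrite mulrA.
- by move=> s W b bb; rewrite tens_sum_scale; apply: eq_bigr => t _; rewrite mul1r.
- by move=> a s s' W b bb; rewrite /tens_scale map_cat.
- move=> s a a' W b bb; rewrite tens_sum_add !tens_sum_scale -big_split.
  by apply: eq_bigr => t _; rewrite mulrDl (balancedDl bb).
Defined.

Definition tensor : lmodType A' := moduleQuot tensor_pre.

Definition pure (x : A') (v : V) : tensor := mq (M := tensor_pre) [:: (x, v)].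

Definition tens_lift (W : zmodType) (b : A' -> V -> W) (x : tensor) : W :=
  tens_sum b (mrepr x).

Lemma tens_lift_mq (W : zmodType) (b : A' -> V -> W) s : balanced b ->
  tens_lift b (mq (M := tensor_pre) s) = tens_sum b s.
Proof.
move=> bb; have h : tens_eq (mrepr (mq (M := tensor_pre) s)) s.
  exact: (mreprP (M := tensor_pre) s).
exact: h.
Qed.

Lemma tens_lift_pure (W : zmodType) (b : A' -> V -> W) x v : balanced b ->
  tens_lift b (pure x v) = b x v.
Proof. by move=> bb; rewrite tens_lift_mq // /tens_sum big_seq1. Qed.

Lemma tens_liftD (W : zmodType) (b : A' -> V -> W) x y : balanced b ->
  tens_lift b (x + y) = tens_lift b x + tens_lift b y.
Proof.
move=> bb; elim/(mqW (M := tensor_pre)): x => x.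
elim/(mqW (M := tensor_pre)): y => y.
by rewrite -mqD !tens_lift_mq // tens_sum_add.
Qed.

Lemma pure_balanced : balanced pure.
Proof.
split=> [x y v|x u v|x a v]; rewrite /pure -?mqD; apply/mqP => W b bb;
  rewrite /= /tens_sum ?big_cons ?big_nil ?addr0 /=.
- exact: balancedDl.
- exact: balancedDr.
- exact: balancedM.
Qed.

Lemma scale_pure a x v : a *: pure x v = pure (a * x) v.
Proof. by rewrite /pure -mqZ. Qed.

Lemma tensorW (P : tensor -> Prop) : P 0 -> (forall x v, P (pure x v)) ->
  (forall y z, P y -> P z -> P (y + z)) -> forall y, P y.
Proof.
move=> P0 Pp PD; elim/(mqW (M := tensor_pre)); elim=> [|[x v] s IHs] //.
rewrite (_ : mq _ = pure x v + mq (M := tensor_pre) s); first exact: PD.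
by rewrite /pure -mqD.
Qed.

Lemma tensor_ext (W : zmodType) (h h' : tensor -> W) :
  {morph h : x y / x + y} -> {morph h' : x y / x + y} ->
  (forall x v, h (pure x v) = h' (pure x v)) -> h =1 h'.
Proof.
have z (k : tensor -> W) : {morph k : x y / x + y} -> k 0 = 0.
  by move=> kD; apply: (addrI (k 0)); rewrite -kD !addr0.
move=> hD h'D e; elim/tensorW => [|x v|y y' E E']; rewrite ?z //.
by rewrite hD h'D E E'.
Qed.

End Tensor.

Arguments pure {A A'} f {V}.
Arguments tens_lift {A A'} f {V W}.

Section TensorComp.
Variables (A A' A'' : comNzRingType).
Variables (f : {rmorphism A -> A'}) (g : {rmorphism A' -> A''}).
Variables (h : {rmorphism A -> A''}) (hE : h =1 g \o f) (V : lmodType A).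

Let b1 (x : A'') (y : A') (v : V) : tensor h V := pure h (x * g y) v.
Let b1P x : balanced f (b1 x).
Proof.
have pb := pure_balanced h V.
split=> [y z v|y u v|y a v]; rewrite /b1.
- by rewrite rmorphD mulrDr (balancedDl pb).
- by rewrite (balancedDr pb).
- by rewrite -(balancedM pb) rmorphM mulrA hE.
Qed.
Let b2 (x : A'') (t : tensor f V) : tensor h V := tens_lift f (b1 x) t.
Let b2P : balanced g b2.
Proof.
have pb := pure_balanced h V.
split=> [x y t|x t u|x a t]; rewrite /b2.
- move: t; apply: tensor_ext => [t t'|t t'|z v]; rewrite ?tens_liftD //.
    by rewrite addrACA.
  by rewrite !tens_lift_pure // /b1 mulrDl (balancedDl pb).
- by rewrite tens_liftD.
- move: t; apply: tensor_ext => [t t'|t t'|z v]; rewrite ?scalerDr ?tens_liftD //.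
  by rewrite scale_pure !tens_lift_pure // /b1 rmorphM mulrA.
Qed.
Definition tensor_comp : tensor g (tensor f V) -> tensor h V := tens_lift g b2.

Let b3 (x : A'') (v : V) : tensor g (tensor f V) := pure g x (pure f 1 v).
Let b3P : balanced h b3.
Proof.
have pf := pure_balanced f V; have pg := pure_balanced g (tensor f V).
split=> [x y v|x u v|x a v]; rewrite /b3.
- by rewrite (balancedDl pg).
- by rewrite (balancedDr pf) (balancedDr pg).
- by rewrite hE (balancedM pg) scale_pure -(balancedM pf) mulrC.
Qed.
Let tensor_uncomp : tensor h V -> tensor g (tensor f V) := tens_lift h b3.

Lemma tensor_compD : {morph tensor_comp : x y / x + y}.
Proof. by move=> x y; exact: tens_liftD. Qed.

Lemma tensor_comp_pure x y v :
  tensor_comp (pure g x (pure f y v)) = pure h (x * g y) v.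
Proof. by rewrite /tensor_comp tens_lift_pure // /b2 tens_lift_pure. Qed.

Lemma tensor_comp_ext (W : zmodType) (k k' : tensor g (tensor f V) -> W) :
  {morph k : x y / x + y} -> {morph k' : x y / x + y} ->
  (forall x y v, k (pure g x (pure f y v)) = k' (pure g x (pure f y v))) ->
  k =1 k'.
Proof.
have pg := pure_balanced g (tensor f V).
move=> kD k'D e; apply: tensor_ext => // x t; move: t.
apply: (@tensor_ext _ _ _ _ _ (fun t => k (pure g x t)) (fun t => k' (pure g x t))).
- by move=> t t'; rewrite (balancedDr pg) kD.
- by move=> t t'; rewrite (balancedDr pg) k'D.
- by move=> y v; exact: e.
Qed.

Lemma tensor_comp_linear : linear tensor_comp.
Proof.
have pg := pure_balanced g (tensor f V).
move=> a x y; rewrite tensor_compD; congr (_ + _); move: x.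
apply: (tensor_comp_ext (k := fun x => tensor_comp (a *: x))
  (k' := fun x => a *: tensor_comp x)) => [x z|x z|x z v].
- by rewrite scalerDr tensor_compD.
- by rewrite tensor_compD scalerDr.
- by rewrite scale_pure !tensor_comp_pure scale_pure mulrA.
Qed.

Lemma tensor_comp_bij : bijective tensor_comp.
Proof.
have pf := pure_balanced f V; have pg := pure_balanced g (tensor f V).
exists tensor_uncomp.
- apply: tensor_comp_ext => [x y|x y //|x y v].
    by rewrite tensor_compD /tensor_uncomp tens_liftD.
  rewrite tensor_comp_pure /tensor_uncomp tens_lift_pure // /b3 (balancedM pg).
  by rewrite scale_pure mulr1.
- apply: tensor_ext => [x y|x y //|x v].
    by rewrite /tensor_uncomp tens_liftD // tensor_compD.
  rewrite /tensor_uncomp tens_lift_pure // /b3 tensor_comp_pure.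
  by rewrite rmorph1 mulr1.
Qed.

End TensorComp.

Section TensorId.
Variables (A : comNzRingType) (f : {rmorphism A -> A}) (fE : f =1 id).
Variable V : lmodType A.

Let b (x : A) (v : V) : V := x *: v.
Let bP : balanced f b.
Proof.
split=> [x y v|x u v|x a v]; rewrite /b ?scalerDl ?scalerDr //.
by rewrite fE scalerA.
Qed.
Definition tensor_id : tensor f V -> V := tens_lift f b.

Lemma tensor_id_pure x v : tensor_id (pure f x v) = x *: v.
Proof. exact: tens_lift_pure. Qed.
Lemma tensor_idD : {morph tensor_id : x y / x + y}.
Proof. by move=> x y; exact: tens_liftD. Qed.
Lemma tensor_id_linear : linear tensor_id.
Proof.
move=> a x y; rewrite tensor_idD; congr (_ + _); move: x.
apply: (tensor_ext (h := fun x => tensor_id (a *: x))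
   (h' := fun x => a *: tensor_id x)) => [x z|x z|x v].
- by rewrite scalerDr tensor_idD.
- by rewrite tensor_idD scalerDr.
- by rewrite scale_pure !tensor_id_pure scalerA.
Qed.
Lemma tensor_id_bij : bijective tensor_id.
Proof.
have pf := pure_balanced f V.
exists (pure f 1) => [|v]; last by rewrite tensor_id_pure scale1r.
apply: (tensor_ext (h := fun x => pure f 1 (tensor_id x))
   (h' := id)) => [x y|x y //|x v].
  by rewrite tensor_idD (balancedDr pf).
by rewrite tensor_id_pure -(balancedM pf) mul1r fE.
Qed.
End TensorId.

Definition free_module (A : comNzRingType) (V : lmodType A) : Prop :=
  exists (I : choiceType) (e : I -> V),
    (forall v, exists s : seq (A * I), v = \sum_(t <- s) t.1 *: e t.2) /\
    (forall (s : seq I) (a : I -> A), uniq s -> \sum_(i <- s) a i *: e i = 0 ->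
       forall i, i \in s -> a i = 0).

Section FreeBaseChange.
Variables (A A' : comNzRingType) (f : {rmorphism A -> A'}) (V : lmodType A).
Variables (I : choiceType) (e : I -> V).
Hypothesis span : forall v, exists s : seq (A * I), v = \sum_(t <- s) t.1 *: e t.2.
Hypothesis indep : forall (s : seq I) (a : I -> A),
  uniq s -> \sum_(i <- s) a i *: e i = 0 -> forall i, i \in s -> a i = 0.

Let co (i : I) (s : seq (A * I)) : A := \sum_(t <- s | t.2 == i) t.1.

Let co0 s : \sum_(t <- s) t.1 *: e t.2 = 0 -> forall i, co i s = 0.
Proof.
move=> s0 i; set r := undup (map snd s).
have [ir|ir] := boolP (i \in r); last first.
  apply: big1_seq => t /andP[/eqP ti ts]; case/negP: ir.
  by rewrite mem_undup -ti map_f.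
apply: (@indep r (fun i => co i s)) ir; first exact: undup_uniq.
rewrite -[RHS]s0.
under eq_bigr do rewrite scaler_suml.
rewrite (exchange_big_dep xpredT) //= big_seq [RHS]big_seq; apply: eq_bigr => t ts.
rewrite (eq_bigl (fun j => j == t.2)); last by move=> j; rewrite eq_sym.
rewrite -big_filter (_ : [seq j <- r | j == t.2] = [:: t.2]) ?big_seq1 //.
have := filter_pred1_uniq (undup_uniq (map snd s)); apply.
by rewrite mem_undup map_f.
Qed.

Let co_eq s s' : \sum_(t <- s) t.1 *: e t.2 = \sum_(t <- s') t.1 *: e t.2 ->
  forall i, co i s = co i s'.
Proof.
move=> ss' i; apply/eqP; rewrite -subr_eq0; apply/eqP.
rewrite -(@co0 (s ++ [seq (- t.1, t.2) | t <- s']) _ i).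
  by rewrite /co big_cat big_map /= sumrN.
rewrite big_cat big_map /= ss'; under [X in _ + X]eq_bigr do rewrite scaleNr.
by rewrite sumrN subrr.
Qed.

Let rp v : seq (A * I) := projT1 (cid (span v)).
Let rpE v : v = \sum_(t <- rp v) t.1 *: e t.2.
Proof. exact: (projT2 (cid (span v))). Qed.

Let coord i v := co i (rp v).
Let coordD i u v : coord i (u + v) = coord i u + coord i v.
Proof.
rewrite /coord (@co_eq _ (rp u ++ rp v)) ?/co ?big_cat //=.
by rewrite -!rpE.
Qed.
Let coordZ i a v : coord i (a *: v) = a * coord i v.
Proof.
rewrite /coord (@co_eq _ [seq (a * t.1, t.2) | t <- rp v]).
  by rewrite /co big_map /= mulr_sumr.
rewrite -rpE big_map [in LHS](rpE v) scaler_sumr.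
by apply: eq_bigr => t _; rewrite scalerA.
Qed.
Let coord_e i j : coord i (e j) = (j == i)%:R.
Proof.
rewrite /coord (@co_eq _ [:: (1, j)]); last by rewrite -rpE big_seq1 scale1r.
by rewrite /co big_cons big_nil /=; case: eqP; rewrite ?addr0.
Qed.

Lemma tensor_free_basis : free_module (tensor f V).
Proof.
have pb := pure_balanced f V.
exists I, (fun i => pure f 1 (e i)); split.
  elim/tensorW => [|x v|y z [s ->] [s' ->]].
  - by exists [::]; rewrite big_nil.
  - exists [seq (x * f t.1, t.2) | t <- rp v]; rewrite big_map [in LHS](rpE v).
    rewrite (big_morph (pure f x) (balancedDr pb x) (balanced0r x pb)).
    by apply: eq_bigr => t _; rewrite scale_pure mulr1 (balancedM pb).
  - by exists (s ++ s'); rewrite big_cat.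
move=> s a us s0 i si.
pose b (x : A') (v : V) : A' := x * f (coord i v).
have bP : balanced f b.
  split=> [x y v|x u v|x c v]; rewrite /b ?mulrDl //.
    by rewrite coordD rmorphD mulrDr.
  by rewrite coordZ rmorphM mulrA.
have l0 : tens_lift f b 0 = 0.
  by apply: (addrI (tens_lift f b 0)); rewrite -tens_liftD // !addr0.
have := congr1 (tens_lift f b) s0.
rewrite (big_morph _ (fun x y => tens_liftD x y bP) l0) l0.
rewrite (bigD1_seq i) //= big1 => [|j ji].
  rewrite addr0 scale_pure tens_lift_pure // /b coord_e eqxx rmorph1 !mulr1.
  by [].
by rewrite scale_pure tens_lift_pure // /b coord_e (negbTE ji) rmorph0 mulr0.
Qed.

End FreeBaseChange.

Lemma tensor_free (A A' : comNzRingType) (f : {rmorphism A -> A'})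
  (V : lmodType A) : free_module V -> free_module (tensor f V).
Proof. by case=> I [e [sp ind]]; exact: tensor_free_basis sp ind. Qed.

Definition open_subgroup (G : groupTopType) (K : set G) : Prop :=
  [/\ open K, K 1%g, forall g h, K g -> K h -> K (g * h)%g &
      forall g, K g -> K (g^-1)%g].

Lemma open_subgroupT (G : groupTopType) : open_subgroup [set: G].
Proof. by split=> //; exact: openT. Qed.

Lemma open_subgroupI (G : groupTopType) (K K' : set G) :
  open_subgroup K -> open_subgroup K' -> open_subgroup (K `&` K').
Proof.
move=> [o K1 KM KV] [o' K1' KM' KV']; split=> //; first exact: openI.
  by move=> g h [? ?] [? ?]; split; [apply: KM|apply: KM'].
by move=> g [? ?]; split; [apply: KV|apply: KV'].
Qed.

Record srep (G : groupTopType) (A : comNzRingType) := SRep {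
  srep_mod :> lmodType A;
  srep_act : G -> srep_mod -> srep_mod;
  srep_linear : forall g, linear (srep_act g);
  srep_act1 : forall v, srep_act 1%g v = v;
  srep_actM : forall g h v, srep_act (g * h)%g v = srep_act g (srep_act h v);
  srep_smooth : forall v, exists2 K : set G, open_subgroup K &
    forall g, K g -> srep_act g v = v
}.

Section SRepTheory.
Variables (G : groupTopType) (A : comNzRingType) (V : srep G A).
Lemma srep_actD g (u v : V) : srep_act g (u + v) = srep_act g u + srep_act g v.
Proof. by have := srep_linear g 1 u v; rewrite !scale1r. Qed.
Lemma srep_act0 g : srep_act g (0 : V) = 0.
Proof. by apply: (addrI (srep_act g (0 : V))); rewrite -srep_actD !addr0. Qed.
Lemma srep_actZ g a (v : V) : srep_act g (a *: v) = a *: srep_act g v.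
Proof. by have := srep_linear g a v 0; rewrite srep_act0 !addr0. Qed.
End SRepTheory.

Section BaseChangeRep.
Variables (G : groupTopType) (A A' : comNzRingType) (f : {rmorphism A -> A'}).
Variable V : srep G A.

Let b (g : G) (x : A') (v : V) : tensor f V := pure f x (srep_act g v).
Let bP g : balanced f (b g).
Proof.
have pb := pure_balanced f V.
split=> [x y v|x u v|x a v]; rewrite /b.
- by rewrite (balancedDl pb).
- by rewrite srep_actD (balancedDr pb).
- by rewrite srep_actZ (balancedM pb).
Qed.
Definition bc_act (g : G) : tensor f V -> tensor f V := tens_lift f (b g).

Lemma bc_act_pure g x v : bc_act g (pure f x v) = pure f x (srep_act g v).
Proof. exact: tens_lift_pure. Qed.
Lemma bc_actD g x y : bc_act g (x + y) = bc_act g x + bc_act g y.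
Proof. exact: tens_liftD. Qed.

Fact bc_act_linear g : linear (bc_act g).
Proof.
move=> a x y; rewrite bc_actD; congr (_ + _); move: x.
apply: (tensor_ext (h := fun x => bc_act g (a *: x))
  (h' := fun x => a *: bc_act g x)) => [x z|x z|x v].
- by rewrite scalerDr bc_actD.
- by rewrite bc_actD scalerDr.
- by rewrite scale_pure !bc_act_pure scale_pure.
Qed.
Fact bc_act1 x : bc_act 1%g x = x.
Proof.
move: x; apply: (tensor_ext (h := bc_act 1%g) (h' := id)) => [x y|//|x v].
  exact: bc_actD.
by rewrite bc_act_pure srep_act1.
Qed.
Fact bc_actM g h x : bc_act (g * h)%g x = bc_act g (bc_act h x).
Proof.
move: x; apply: (tensor_ext (h := bc_act (g * h)%g)
  (h' := fun x => bc_act g (bc_act h x))) => [x y|x y|x v].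
- exact: bc_actD.
- by rewrite !bc_actD.
- by rewrite !bc_act_pure srep_actM.
Qed.
Fact bc_smooth x : exists2 K : set G, open_subgroup K &
  forall g, K g -> bc_act g x = x.
Proof.
elim/tensorW: x => [|x v|x y [K oK Kx] [K' oK' Ky]].
- exists setT; first exact: open_subgroupT.
  by move=> g _; apply: (addrI (bc_act g 0)); rewrite -bc_actD !addr0.
- have [K oK Kv] := srep_smooth v; exists K => // g /Kv e.
  by rewrite bc_act_pure e.
- exists (K `&` K'); first exact: open_subgroupI.
  by move=> g [/Kx ex /Ky ey]; rewrite bc_actD ex ey.
Qed.
Definition bc_rep : srep G A' :=
  SRep bc_act_linear bc_act1 bc_actM bc_smooth.

End BaseChangeRep.

Definition ideal (A : comNzRingType) (I : set A) : Prop :=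
  [/\ I 0, forall x y, I x -> I y -> I (x + y) & forall a x, I x -> I (a * x)].

Definition maximal_ideal (A : comNzRingType) (I : set A) : Prop :=
  [/\ ideal I, ~ I 1 &
      forall J : set A, ideal J -> ~ J 1 -> I `<=` J -> J = I].

Definition local_ring (A : comNzRingType) : Prop :=
  exists! I : set A, maximal_ideal I.

Definition artinian_ring (A : comNzRingType) : Prop :=
  forall I : nat -> set A, (forall n, ideal (I n)) ->
    (forall n, I n.+1 `<=` I n) -> exists N, forall n, (N <= n)%N -> I n = I N.

Section Art.
Variables (O : comNzRingType) (k : fieldType) (res : {rmorphism O -> k}).

(* Since art_res is onto the field k (it extends res, which is onto whenever k
   is the residue field of O), its kernel is the maximal ideal of A and it
   identifies the residue field of A with k. *)
Record artAlg := ArtAlg {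
  art_ring :> comNzRingType;
  art_str : {rmorphism O -> art_ring};
  art_res : {rmorphism art_ring -> k};
  art_local : local_ring art_ring;
  art_artinian : artinian_ring art_ring;
  art_resE : forall x, art_res (art_str x) = res x
}.

Record artHom (A A' : artAlg) := ArtHom {
  art_hom :> {rmorphism A -> A'};
  art_hom_str : forall x, art_hom (art_str A x) = art_str A' x;
  art_hom_local : forall a, art_res A a = 0 -> art_res A' (art_hom a) = 0
}.

Record artFunctor := ArtFunctor {
  af_obj :> artAlg -> Type;
  af_map : forall A A' : artAlg, artHom A A' -> af_obj A -> af_obj A';
  af_map_id : forall (A : artAlg) (h : artHom A A), h =1 id ->
    forall x, af_map h x = x;
  af_map_comp : forall (A A' A'' : artAlg) (h : artHom A A') (h' : artHom A' A'')
    (h'' : artHom A A''), h'' =1 h' \o h ->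
    forall x, af_map h'' x = af_map h' (af_map h x)
}.

Definition natural_iso (F F' : artFunctor) (eta : forall A, F A -> F' A) : Prop :=
  (forall (A A' : artAlg) (h : artHom A A') (x : F A),
     eta A' (af_map h x) = af_map h (eta A x)) /\
  (forall A, bijective (eta A)).

Hypothesis res_surj : forall y, exists x, res x = y.

Lemma art_hom_res (A A' : artAlg) (h : artHom A A') a :
  art_res A' (h a) = art_res A a.
Proof.
have [x xa] := res_surj (art_res A a).
have /art_hom_local : art_res A (a - art_str A x) = 0.
  by rewrite rmorphB art_resE xa subrr.
by move/(_ _ h); rewrite !rmorphB art_hom_str art_resE xa => /eqP; rewrite subr_eq0 => /eqP.
Qed.

Variables (G : groupTopType) (pi0 : srep G k).

(* lift_red: the induced map k (x)_A V -> pi0 is an isomorphism *)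
Record is_lift (A : artAlg) (V : srep G A) (phi : V -> pi0) : Prop := IsLift {
  lift_free : free_module V;
  lift_add : forall u v, phi (u + v) = phi u + phi v;
  lift_scale : forall a v, phi (a *: v) = art_res A a *: phi v;
  lift_equiv : forall g v, phi (srep_act g v) = srep_act g (phi v);
  lift_surj : forall w, exists v, phi v = w;
  lift_red : bijective (tens_lift (art_res A) (fun x v => x *: phi v))
}.

Record lift (A : artAlg) := Lift {
  lift_rep : srep G A;
  lift_map : lift_rep -> pi0;
  liftP : is_lift lift_map
}.

Definition lift_iso (A : artAlg) (l l' : lift A) : Prop :=
  exists psi : lift_rep l -> lift_rep l',
    [/\ linear psi, bijective psi,
        forall g v, psi (srep_act g v) = srep_act g (psi v) &
        forall v, lift_map (psi v) = lift_map v].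

Lemma lift_iso_refl A (l : lift A) : lift_iso l l.
Proof. by exists id; split=> //; exists id. Qed.

Lemma lift_iso_sym A (l l' : lift A) : lift_iso l l' -> lift_iso l' l.
Proof.
case=> psi [pl [psi' pK pK'] pg pm]; exists psi'; split.
- by move=> a x y; apply: (can_inj pK); rewrite pl !pK'.
- by exists psi.
- by move=> g v; apply: (can_inj pK); rewrite pg !pK'.
- by move=> v; rewrite -pm pK'.
Qed.

Lemma lift_iso_trans A (l l' l'' : lift A) :
  lift_iso l l' -> lift_iso l' l'' -> lift_iso l l''.
Proof.
case=> psi [pl pb pg pm] [psi' [pl' pb' pg' pm']]; exists (psi' \o psi); split.
- by move=> a x y; rewrite /= pl pl'.
- exact: bij_comp.
- by move=> g v; rewrite /= pg pg'.
- by move=> v; rewrite /= pm' pm.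
Qed.

Definition deformation (A : artAlg) : Type :=
  {X : lift A -> Prop | exists l, X = lift_iso l}.

Definition lift_class (A : artAlg) (l : lift A) : deformation A :=
  exist _ (lift_iso l) (ex_intro _ l erefl).

Lemma lift_classP A (l l' : lift A) :
  lift_class l = lift_class l' <-> lift_iso l l'.
Proof.
split=> [/(congr1 (@proj1_sig _ _)) /= e|ll'].
  by rewrite e; exact: lift_iso_refl.
apply: eq_exist; apply/funext => x; apply/propext; split=> h.
  exact: lift_iso_trans (lift_iso_sym ll') h.
exact: lift_iso_trans ll' h.
Qed.

Definition class_rep (A : artAlg) (X : deformation A) : lift A :=
  projT1 (cid (proj2_sig X)).

Lemma class_repK A (X : deformation A) : lift_class (class_rep X) = X.
Proof.
rewrite /class_rep; case: cid => l /=; case: X => X /= [l' e'] e.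
by apply: eq_exist; rewrite /= e.
Qed.

Section BaseChangeLift.
Variables (A A' : artAlg) (h : artHom A A') (l : lift A).

Let b (x : A') (v : lift_rep l) : pi0 := art_res A' x *: lift_map v.
Let bP : balanced h b.
Proof.
have L := liftP l; split=> [x y v|x u v|x a v]; rewrite /b.
- by rewrite rmorphD scalerDl.
- by rewrite (lift_add L) scalerDr.
- by rewrite (lift_scale L) rmorphM scalerA art_hom_res.
Qed.
Definition bc_map : bc_rep h (lift_rep l) -> pi0 := tens_lift h b.

Lemma bc_map_pure x v : bc_map (pure h x v) = art_res A' x *: lift_map v.
Proof. exact: tens_lift_pure. Qed.
Lemma bc_mapD x y : bc_map (x + y) = bc_map x + bc_map y.
Proof. exact: tens_liftD. Qed.
Lemma bc_mapZ a x : bc_map (a *: x) = art_res A' a *: bc_map x.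
Proof.
move: x; apply: (tensor_ext (h := fun x => bc_map (a *: x))
  (h' := fun x => art_res A' a *: bc_map x)) => [x y|x y|x v].
- by rewrite scalerDr bc_mapD.
- by rewrite bc_mapD scalerDr.
- by rewrite scale_pure !bc_map_pure rmorphM scalerA.
Qed.

Fact bc_is_lift : is_lift bc_map.
Proof.
have L := liftP l; split.
- exact: tensor_free (lift_free L).
- exact: bc_mapD.
- exact: bc_mapZ.
- move=> g x; move: x.
  apply: (tensor_ext (h := fun x => bc_map (bc_act g x))
    (h' := fun x => srep_act g (bc_map x))) => [x y|x y|x v].
  + by rewrite bc_actD bc_mapD.
  + by rewrite bc_mapD srep_actD.
  + by rewrite bc_act_pure !bc_map_pure (lift_equiv L) srep_actZ.
- move=> w; have [v <-] := lift_surj L w; exists (pure h 1 v).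
  by rewrite bc_map_pure rmorph1 scale1r.
- have hE : art_res A =1 art_res A' \o h by move=> a; rewrite /= art_hom_res.
  have B1 : balanced (art_res A') (fun x v => x *: bc_map v).
    split=> [x y v|x u v|x a v]; first by rewrite scalerDl.
      by rewrite bc_mapD scalerDr.
    by rewrite bc_mapZ scalerA.
  have B2 : balanced (art_res A) (fun x (v : lift_rep l) => x *: lift_map v).
    split=> [x y v|x u v|x a v]; first by rewrite scalerDl.
      by rewrite (lift_add L) scalerDr.
    by rewrite (lift_scale L) scalerA.
  pose K1 : tensor (art_res A') (tensor h (lift_rep l)) -> pi0 :=
    tens_lift (art_res A') (fun x v => x *: bc_map v).
  pose K2 : tensor (art_res A) (lift_rep l) -> pi0 :=
    tens_lift (art_res A) (fun x (v : lift_rep l) => x *: lift_map v).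
  have K1D : {morph K1 : x y / x + y} by move=> x y; exact: tens_liftD.
  have K2D : {morph K2 : x y / x + y} by move=> x y; exact: tens_liftD.
  have K1p x v : K1 (pure _ x v) = x *: bc_map v by exact: tens_lift_pure.
  have K2p x v : K2 (pure _ x v) = x *: lift_map v by exact: tens_lift_pure.
  pose C := @tensor_comp _ _ _ h (art_res A') (art_res A) (lift_rep l).
  have cb : bijective C by exact: tensor_comp_bij.
  have CD : {morph C : x y / x + y} by exact: tensor_compD.
  have Cp x y v : C (pure _ x (pure _ y v)) = pure _ (x * art_res A' y) v.
    exact: tensor_comp_pure.
  have K2b : bijective K2 by exact: lift_red L.
  apply: (eq_bij (bij_comp K2b cb) (g := K1)).
  apply: (@tensor_comp_ext _ _ _ h (art_res A') (lift_rep l) pi0 (K2 \o C) K1).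
  + by move=> x y; exact: (etrans (congr1 K2 (CD x y)) (K2D _ _)).
  + exact: K1D.
  + move=> x y v; rewrite [LHS](congr1 K2 (Cp x y v)) K1p K2p.
    by rewrite bc_map_pure scalerA.
Qed.
Definition bc_lift : lift A' := Lift bc_is_lift.

End BaseChangeLift.

Lemma bc_lift_iso A A' (h : artHom A A') (l l' : lift A) :
  lift_iso l l' -> lift_iso (bc_lift h l) (bc_lift h l').
Proof.
case=> psi [pl [psi' pK pK'] pg pm].
have mor (V V' : srep G A) (q : V -> V') : linear q ->
    balanced h (fun x v => pure h x (q v)).
  have pb := pure_balanced h V'.
  move=> ql; have qD u v : q (u + v) = q u + q v.
    by have := ql 1 u v; rewrite !scale1r.
  have q0 : q 0 = 0 by apply: (addrI (q 0)); rewrite -qD !addr0.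
  split=> [x y v|x u v|x a v].
  - by rewrite (balancedDl pb).
  - by rewrite qD (balancedDr pb).
  - by rewrite (balancedM pb); have := ql a v 0; rewrite !addr0 q0 addr0 => ->.
have pl' : linear psi' by move=> a x y; apply: (can_inj pK); rewrite pl !pK'.
have B := mor _ _ _ pl; have B' := mor _ _ _ pl'.
pose F := tens_lift h (fun x v => pure h x (psi v)).
pose F' := tens_lift h (fun x v => pure h x (psi' v)).
have FD : {morph F : x y / x + y} by move=> x y; exact: tens_liftD.
have F'D : {morph F' : x y / x + y} by move=> x y; exact: tens_liftD.
have Fp x v : F (pure h x v) = pure h x (psi v) by exact: tens_lift_pure.
have F'p x v : F' (pure h x v) = pure h x (psi' v) by exact: tens_lift_pure.
exists F; split.
- move=> a x y; rewrite FD; congr (_ + _); move: x.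
  apply: (tensor_ext (h := fun x => F (a *: x)) (h' := fun x => a *: F x)).
  + by move=> x z; rewrite scalerDr FD.
  + by move=> x z; rewrite FD scalerDr.
  + by move=> x v; rewrite scale_pure !Fp scale_pure.
- exists F'.
  + apply: tensor_ext => [x z|//|x v]; first by rewrite FD F'D.
    by rewrite Fp F'p pK.
  + apply: tensor_ext => [x z|//|x v]; first by rewrite F'D FD.
    by rewrite F'p Fp pK'.
- move=> g x; move: x.
  apply: (tensor_ext (h := fun x => F (bc_act g x)) (h' := fun x => bc_act g (F x))).
  + by move=> x z; rewrite bc_actD FD.
  + by move=> x z; rewrite FD bc_actD.
  + by move=> x v; rewrite bc_act_pure !Fp bc_act_pure pg.
- apply: (tensor_ext (h := fun x => bc_map (F x)) (h' := @bc_map _ _ _ _)).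
  + by move=> x z; rewrite FD bc_mapD.
  + by move=> x z; rewrite bc_mapD.
  + by move=> x v; rewrite Fp !bc_map_pure pm.
Qed.

Definition def_map A A' (h : artHom A A') (X : deformation A) : deformation A' :=
  lift_class (bc_lift h (class_rep X)).

Lemma def_map_class A A' (h : artHom A A') (l : lift A) :
  def_map h (lift_class l) = lift_class (bc_lift h l).
Proof.
apply/lift_classP; apply: bc_lift_iso; apply/lift_classP; exact: class_repK.
Qed.

Fact def_map_id A (h : artHom A A) : h =1 id -> forall X, def_map h X = X.
Proof.
move=> hE X; rewrite -(class_repK X); move: (class_rep X) => l.
rewrite def_map_class; apply/lift_classP; have L := liftP l.
exists (@tensor_id _ h (lift_rep l)); split.
- exact: tensor_id_linear.
- exact: tensor_id_bij.
- move=> g x; move: x.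
  apply: (tensor_ext (h := fun x => tensor_id (bc_act g x))
     (h' := fun x => srep_act g (tensor_id x))).
  + by move=> x y; rewrite bc_actD tensor_idD.
  + by move=> x y; rewrite tensor_idD // srep_actD.
  + by move=> x v; rewrite bc_act_pure !tensor_id_pure // srep_actZ.
- apply: (tensor_ext (h := fun x => lift_map (tensor_id x)) (h' := @bc_map _ _ _ _)).
  + by move=> x y; rewrite tensor_idD // (lift_add L).
  + by move=> x y; rewrite bc_mapD.
  + by move=> x v; rewrite tensor_id_pure // bc_map_pure (lift_scale L).
Qed.

Fact def_map_comp A A' A'' (h : artHom A A') (h' : artHom A' A'')
  (h'' : artHom A A'') : h'' =1 h' \o h ->
  forall X, def_map h'' X = def_map h' (def_map h X).
Proof.
move=> hE X; rewrite -(class_repK X); move: (class_rep X) => l.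
rewrite !def_map_class; apply/lift_classP; apply: lift_iso_sym.
pose C := @tensor_comp _ _ _ h h' h'' (lift_rep l).
have CD : {morph C : x y / x + y} by exact: tensor_compD.
have Cp x y v : C (pure _ x (pure _ y v)) = pure _ (x * h' y) v.
  exact: tensor_comp_pure.
exists C; split.
- exact: tensor_comp_linear.
- exact: tensor_comp_bij.
- move=> g x; move: x.
  apply: (@tensor_comp_ext _ _ _ h h' (lift_rep l) (tensor h'' (lift_rep l))
    (fun x => C (@bc_act _ _ _ h' (bc_rep h (lift_rep l)) g x))
    (fun x => @bc_act _ _ _ h'' (lift_rep l) g (C x))).
  + by move=> x y; rewrite bc_actD CD.
  + by move=> x y; rewrite CD bc_actD.
  + move=> x y v; rewrite Cp [RHS]bc_act_pure bc_act_pure.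
    by rewrite -Cp; congr (C (pure _ x _)); exact: bc_act_pure.
- apply: (@tensor_comp_ext _ _ _ h h' (lift_rep l) pi0
    (fun x => @bc_map _ _ h'' l (C x)) (@bc_map _ _ h' (bc_lift h l))).
  + by move=> x y; rewrite CD bc_mapD.
  + by move=> x y; rewrite bc_mapD.
  + move=> x y v; rewrite Cp !bc_map_pure rmorphM -scalerA art_hom_res.
    by congr (_ *: _); apply/esym; exact: bc_map_pure.
Qed.

Definition Def : artFunctor := ArtFunctor def_map_id def_map_comp.

End Art.

Section PadicBounds.
Variables (p : nat) (hp : prime p) (Qp : padicField p) (L : fieldExtType Qp).

Lemma padic_natr_neq0 n : (0 < n)%N -> (n%:R : L) != 0.
Proof.
move=> n0; rewrite -(rmorph_nat (in_alg L)) fmorph_eq0 -padic_norm_eq0.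
have -> : (n%:R : Qp) = ratr n%:R by rewrite ratr_nat.
have nz : (n%:R : rat) != 0 by rewrite pnatr_eq0 -lt0n.
rewrite padic_norm_ratr /padic_abs (negbTE nz) expfz_neq0 //.
by rewrite pnatr_eq0 -lt0n prime_gt0.
Qed.

Lemma padic_normp : padic_norm (p%:R : Qp) = p%:R^-1.
Proof.
have -> : (p%:R : Qp) = ratr p%:R by rewrite ratr_nat.
have nz : (p%:R : rat) != 0 by rewrite pnatr_eq0 -lt0n prime_gt0.
rewrite padic_norm_ratr /padic_abs (negbTE nz) /padic_val.
rewrite -[(p%:R : rat)]/(p%:~R) numq_int denq_int /= logn_prime // eqxx logn1 subr0.
by [].
Qed.

Lemma padic_scale_int (x : Qp) : exists m, forall n, (m <= n)%N ->
  p%:R ^+ n * x \in padic_int Qp.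
Proof.
exists (Num.bound (padic_norm x)) => n mn.
have nX j : padic_norm ((p%:R : Qp) ^+ j) = p%:R^-1 ^+ j.
  by elim: j => [|j IHj]; rewrite ?expr0 ?padic_norm1 // !exprS padic_normM IHj padic_normp.
rewrite inE padic_normM nX exprVn mulrC ler_pdivrMr ?mul1r; last first.
  by rewrite exprn_gt0 // ltr0n prime_gt0.
apply/ltW/(lt_le_trans (archi_boundP (padic_norm_ge0 x))).
rewrite -natrX ler_nat (leq_trans mn) //; apply/ltnW/ltn_expl/prime_gt1/hp.
Qed.

Lemma padic_int_integral (x : Qp) : x \in padic_int Qp -> x%:A \in integers L.
Proof.
move=> hx; apply/integersP.
rewrite (_ : x%:A = Zp_emb L (ZpElt hx)) //; exact: integral_id.
Qed.

Lemma padic_bounded (x : L) : exists m, p%:R ^+ m * x \in integers L.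
Proof.
have /polyOver1P[P PE] : minPoly 1 x \is a polyOver 1%VS by exact: minPolyOver.
have Pm : map_poly (in_alg L) P \is monic by rewrite -PE monic_minPoly.
have Pr : root (map_poly (in_alg L) P) x by rewrite -PE root_minPoly.
have szP : size P = (size P).-1.+1.
  by move: Pm; rewrite map_monic => /monic_neq0; rewrite -size_poly_gt0; case: size.
set d := (size P).-1 in szP.
have [m hm] : exists m, forall i, (i < d)%N -> p%:R ^+ m * P`_i \in padic_int Qp.
  elim: d {szP} => [|e [m IHm]]; first by exists 0%N.
  have [m' hm'] := padic_scale_int P`_e.
  exists (m + m')%N => i; rewrite ltnS leq_eqVlt => /orP[/eqP->|/IHm h].
    by apply: hm'; exact: leq_addl.
  rewrite addnC exprD -mulrA rpredM // rpredX // rpred_nat.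
  by [].
exists m; apply/integersP.
pose c i : Qp := p%:R ^+ (m * (d - i)) * P`_i.
have ci i : (i <= d)%N -> c i \in padic_int Qp.
  rewrite leq_eqVlt => /orP[/eqP->|id].
    rewrite /c subnn muln0 mul1r; move: Pm; rewrite map_monic monicE lead_coefE.
    by move=> /eqP->; rewrite rpred1.
  rewrite /c -(subnSK id) mulnS addnC exprD -mulrA rpredM ?hm //.
  by rewrite rpredX // rpred_nat.
pose R : {poly L} := \poly_(i < d.+1) (c i)%:A.
have Rd : R`_d = 1.
  rewrite coef_poly ltnSn /c subnn muln0 mul1r.
  by move: Pm; rewrite map_monic monicE lead_coefE => /eqP->; rewrite scale1r.
apply: (@integral_root_monic _ _ (Zp_emb L) _ R).
- rewrite monicE lead_coefE.
  have -> : size R = d.+1 by rewrite size_poly_eq //= -/R; move: Rd; rewrite coef_poly ltnSn => ->; rewrite oner_neq0.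
  by rewrite Rd.
- apply/rootP; rewrite horner_poly.
  transitivity (p%:R ^+ (m * d) * (map_poly (in_alg L) P).[x]); last first.
    by rewrite (rootP Pr) mulr0.
  rewrite (@horner_coef_wide _ d.+1) ?size_map_poly ?szP // mulr_sumr.
  apply: eq_bigr => i _; have id : (i <= d)%N by rewrite -ltnS.
  rewrite coef_map /c /= -!/(in_alg L _) rmorphM rmorphXn rmorph_nat exprMn -exprM.
  have -> : (m * d = m * (d - i) + m * i)%N by rewrite -mulnDr subnK.
  by rewrite exprD -!mulrA; congr (_ * _); rewrite mulrCA.
- move=> y /(nthP 0)[i /leq_trans/(_ (size_poly _ _)) id <-].
  by rewrite coef_poly id; apply/integersP/padic_int_integral/ci.
Qed.

Lemma padic_bounded_mx n1 n2 (h : 'M[L]_(n1, n2)) :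
  exists m, forall i j, p%:R ^+ m * h i j \in integers L.
Proof.
pose M i j := projT1 (cid (padic_bounded (h i j))).
exists (\sum_i \sum_j M i j)%N => i j.
rewrite (bigD1 i) //= (bigD1 j) //= -addnA addnC exprD -mulrA rpredM //.
  by rewrite rpredX // rpred_nat.
exact: (projT2 (cid (padic_bounded (h i j)))).
Qed.
End PadicBounds.

Lemma open_subgroup_conj (p : nat) (hp : prime p) (Qp : padicField p)
  (L : fieldExtType Qp) (c : {lrmorphism L -> L}) (h : U11 c) (K : set (U11 c)) :
  open_subgroup K -> open_subgroup [set g | K (h^-1 * g * h)%g].
Proof.
case=> oK K1 KM KV; split=> /=.
- suff : U11_open [set g | K (h^-1 * g * h)%g] by [].
  have oK' : U11_open K by [].
  move=> g /= /oK'[n hn].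
  have [m1 hm1] := padic_bounded_mx hp (val (h^-1)%g).
  have [m2 hm2] := padic_bounded_mx hp (val h).
  exists (n + (m1 + m2))%N => g' gg'; apply: hn => i j.
  have gg i' j' := cid2 (gg' i' j').
  pose Z : 'M[L]_2 := \matrix_(i', j') s2val (gg i' j').
  have ZI i' j' : Z i' j' \in integers L.
    by rewrite mxE; exact: s2valP (gg i' j').
  have ZE : val g' - val g = p%:R ^+ (n + (m1 + m2)) *: Z.
    by apply/matrixP => i' j'; rewrite !mxE -(s2valP' (gg i' j')).
  pose H1 : 'M[L]_2 := p%:R ^+ m1 *: val (h^-1)%g.
  pose H2 : 'M[L]_2 := p%:R ^+ m2 *: val h.
  exists ((H1 *m Z *m H2) i j).
    rewrite mxE; apply: rpred_sum => k _; rewrite rpredM //; last by rewrite mxE.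
    by rewrite mxE; apply: rpred_sum => k' _; rewrite rpredM // mxE.
  have -> : forall A B : 'M[L]_2, A i j - B i j = (A - B) i j by move=> A B; rewrite !mxE.
  have -> : val (h^-1 * g' * h)%g - val (h^-1 * g * h)%g =
     val (h^-1)%g *m (val g' - val g) *m val h.
    by rewrite mulmxBr mulmxBl.
  rewrite ZE /H1 /H2 -!(scalemxAl, scalemxAr) !scalerA.
  by rewrite mxE [in RHS]mxE mulrA !exprD.
- by rewrite mulg1 mulVg.
- move=> g g' Kg Kg'; have := KM _ _ Kg Kg'.
  by rewrite !mulgA mulgK.
- by move=> g /KV; rewrite !invgM invgK mulgA.
Qed.

(* The values of a character are units, since G is a group. *)
Record schar (G : groupTopType) (A : comNzRingType) := SChar {
  schar_fun :> G -> A;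
  schar1 : schar_fun 1%g = 1;
  scharM : forall g h, schar_fun (g * h)%g = schar_fun g * schar_fun h;
  schar_smooth : exists2 K : set G, open_subgroup K &
    forall g, K g -> schar_fun g = 1
}.

Section Characters.
Variables (G : groupTopType) (A : comNzRingType).

Definition triv_char : schar G A.
Proof.
exists (fun _ => 1) => //; first by move=> g h; rewrite mulr1.
by exists setT => //; exact: open_subgroupT.
Defined.

Variable sigma : schar G A.

Lemma scharV g : sigma g * sigma (g^-1)%g = 1.
Proof. by rewrite -scharM mulgV schar1. Qed.

Definition char_rep : srep G A.
Proof.
exists A^o (fun g (v : A^o) => sigma g * v).
- by move=> g a u v; rewrite mulrDr; congr (_ + _); exact: mulrCA.
- by move=> v; rewrite schar1 mul1r.
- by move=> g h v; rewrite scharM mulrA.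
- move=> v; have [K oK K1] := schar_smooth sigma; exists K => // g /K1->.
  by rewrite mul1r.
Defined.

Definition twist_rep (V : srep G A) : srep G A.
Proof.
exists V (fun g (v : V) => sigma g *: srep_act g v).
- move=> g a u v; rewrite srep_actD srep_actZ scalerDr !scalerA.
  by rewrite (mulrC a).
- by move=> v; rewrite schar1 scale1r srep_act1.
- by move=> g h v; rewrite scharM srep_actM srep_actZ scalerA.
- move=> v; have [K oK K1] := schar_smooth sigma.
  have [K' oK' Kv] := srep_smooth v.
  exists (K `&` K'); first exact: open_subgroupI.
  by move=> g [/K1-> /Kv->]; rewrite scale1r.
Defined.
End Characters.

Section CharLift.
Variables (O : comNzRingType) (k : fieldType) (res : {rmorphism O -> k}).
Hypothesis res_surj : forall y, exists x, res x = y.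
Variables (G : groupTopType) (chi : schar G k).

Record char_lift (A : artAlg res) := CharLift {
  char_lift_char :> schar G A;
  char_lift_res : forall g, art_res A (char_lift_char g) = chi g
}.

Variables (A : artAlg res) (sigma : char_lift A).

Definition char_map : char_rep sigma -> char_rep chi := art_res A.

Fact char_is_lift : is_lift char_map.
Proof.
have D (u v : char_rep sigma) : char_map (u + v) = char_map u + char_map v.
  exact: rmorphD.
have Z a (v : char_rep sigma) : char_map (a *: v) = art_res A a *: char_map v.
  exact: rmorphM.
split=> //.
- exists unit, (fun _ => (1 : A^o)); split=> [v|s a].
    by exists [:: (v : A, tt)]; rewrite big_seq1 /= -[RHS]/(_ * _) mulr1.
  case: s => [|[] [|[] s]] //= _; rewrite big_seq1 => a0 [] _.
  by move: a0; rewrite -[LHS]/(_ * _) mulr1.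
- move=> g v; rewrite /char_map /= rmorphM char_lift_res.
  by [].
- move=> w; have [x xw] := res_surj w; exists (art_str A x : A^o).
  by rewrite -xw /char_map art_resE.
- have bP : balanced (art_res A) (fun x (v : char_rep sigma) => x *: char_map v).
    split=> [x y v|x u v|x a v]; first by rewrite scalerDl.
      by rewrite D scalerDr.
    by rewrite Z scalerA.
  have pb := pure_balanced (art_res A) (char_rep sigma).
  exists (fun x : k => pure (art_res A) x (1 : A^o)).
    apply: (tensor_ext (h := fun t => pure _ (tens_lift _ _ t) (1 : A^o)) (h' := id)) => //.
      by move=> x y; rewrite tens_liftD // (balancedDl pb).
    move=> x v; rewrite tens_lift_pure // -[x *: _]/(x * art_res A v).
    by rewrite (balancedM pb) -[v *: _]/(_ * _) mulr1.
  move=> x; rewrite tens_lift_pure // /char_map rmorph1.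
  by rewrite -[LHS]/(_ * _) mulr1.
Qed.
Definition lift_of_char : lift (char_rep chi) A := Lift char_is_lift.
End CharLift.

Section QuotientRep.
Variables (G : groupTopType) (A : comNzRingType) (V : srep G A) (N : set V).
Hypotheses (sN : submodule N) (aN : forall g v, N v -> N (srep_act g v)).

Local Notation Q := (moduleQuot (quotient_pre sN)).
Local Notation cl := (mq (M := quotient_pre sN)).

Lemma quotient_classP (u v : V) : cl u = cl v <-> N (u - v).
Proof. exact: mqP. Qed.
Lemma quotient_repr (v : V) : N (mrepr (cl v) - v).
Proof. by apply/quotient_classP; rewrite mreprK. Qed.

Definition quot_act (g : G) (x : Q) : Q := cl (srep_act g (mrepr x : V)).

Lemma quot_act_class g (v : V) : quot_act g (cl v) = cl (srep_act g v).
Proof.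
apply/quotient_classP; have := aN g (quotient_repr v).
by rewrite srep_actD -scaleN1r srep_actZ scaleN1r.
Qed.

Definition quotient_rep : srep G A.
Proof.
exists Q quot_act.
- move=> g a; elim/mqW=> u; elim/mqW=> v.
  by rewrite -mqZ -mqD !quot_act_class -mqZ -mqD /= srep_linear.
- by elim/mqW=> v; rewrite quot_act_class srep_act1.
- by move=> g h; elim/mqW=> v; rewrite !quot_act_class srep_actM.
- elim/mqW=> v; have [K oK Kv] := srep_smooth (v : V); exists K => // g /Kv e.
  by rewrite quot_act_class e.
Defined.

End QuotientRep.

Section Steinberg.
Variables (p : nat) (hp : prime p) (Qp : padicField p) (L : fieldExtType Qp).
Variable c : {lrmorphism L -> L}.
Local Notation G := (U11 c).

Section Unipotent.
Variables (A : comNzRingType) (sigma : schar G A).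

Let mx2 (x y z t : L) : 'M[L]_2 := \matrix_(i, j)
  (if i == ord0 then (if j == ord0 then x else y)
   else (if j == ord0 then z else t)).
Let mx2M x y z t x' y' z' t' : mx2 x y z t *m mx2 x' y' z' t' =
  mx2 (x * x' + y * z') (x * y' + y * t') (z * x' + t * z') (z * y' + t * t').
Proof.
apply/matrixP => i j; rewrite !mxE !big_ord_recl big_ord0 !mxE /= addr0.
by case: ifP => _; case: ifP.
Qed.
Let mx2T x y z t : (mx2 x y z t)^T = mx2 x z y t.
Proof. by apply/matrixP => i j; rewrite !mxE; do 2!case: ifP. Qed.
Let mx2c x y z t : map_mx c (mx2 x y z t) = mx2 (c x) (c y) (c z) (c t).
Proof. by apply/matrixP => i j; rewrite !mxE; do 2!case: ifP. Qed.
Let ord2P (i : 'I_2) : i = if i == ord0 then ord0 else ord_max.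
Proof. by case: i => [[|[|//]] hi]; apply: val_inj. Qed.
Let mx2E (M : 'M[L]_2) :
  M = mx2 (M ord0 ord0) (M ord0 ord_max) (M ord_max ord0) (M ord_max ord_max).
Proof.
apply/matrixP => i j; rewrite !mxE [in LHS](ord2P i) [in LHS](ord2P j).
by do 2!case: ifP.
Qed.
Let antidiagE : antidiag L = mx2 0 1 1 0.
Proof.
apply/matrixP => i j; rewrite !mxE [in LHS](ord2P i) [in LHS](ord2P j).
by do 2!case: ifP.
Qed.
Let unitaryE (M : 'M[L]_2) : (map_mx c M)^T *m antidiag L *m M = antidiag L ->
  M \in unitary c.
Proof.
move=> e; rewrite inE e eqxx andbT unitmxE unitfE; apply/eqP => d0.
have /eqP := congr1 determinant e; rewrite !det_mulmx d0 mulr0 eq_sym.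
have : antidiag L *m antidiag L = 1%:M.
  by rewrite antidiagE mx2M [RHS]mx2E !mxE /= !(mulr0, mul0r, mulr1, add0r, addr0).
move=> /(congr1 determinant); rewrite det_mulmx det1 => h /eqP d.
by move: h; rewrite d mulr0 => /esym/eqP; rewrite oner_eq0.
Qed.

Lemma schar_unipotent (u : G) : unipotent u -> sigma u = 1.
Proof.
case=> u10 [u00 u11].
set x : L := val u ord0 ord_max.
have uE : val u = mx2 1 x 0 1 by rewrite [LHS]mx2E u10 u00 u11.
have cx : c x + x = 0.
  have /andP[_ /eqP] := U11P u; rewrite -[U11_val u]/(val u) uE antidiagE mx2c mx2T !mx2M.
  move=> /matrixP/(_ ord_max ord_max); rewrite !mxE /=.
  by rewrite !(rmorph1, rmorph0, mulr0, mul0r, mulr1, mul1r, add0r, addr0) addrC.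
pose q : L := (p ^ 2 - 1)%:R.
have q0 : q != 0.
  by rewrite padic_natr_neq0 // subn_gt0 (ltn_trans (prime_gt1 hp)) // expnS ltn_Pmulr ?prime_gt1 ?prime_gt0.
have P0 : (p%:R : L) != 0 by rewrite padic_natr_neq0 ?prime_gt0.
have qE : p%:R * p%:R = q + 1 :> L.
  by rewrite /q natr1 subn1 prednK ?expn_gt0 ?prime_gt0 // -natrM mulnn.
pose y : L := x / q.
have cy : c y + y = 0.
  by rewrite /y fmorph_div rmorph_nat -mulrDl cx mul0r.
have vU : mx2 1 y 0 1 \in unitary c.
  apply: unitaryE; rewrite antidiagE mx2c mx2T !mx2M.
  rewrite !(rmorph1, rmorph0, mulr0, mul0r, mulr1, mul1r, add0r, addr0).
  by rewrite addrC cy.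
have tU : mx2 p%:R 0 0 p%:R^-1 \in unitary c.
  apply: unitaryE; rewrite antidiagE mx2c mx2T !mx2M fmorphV rmorph_nat.
  rewrite !(rmorph1, rmorph0, mulr0, mul0r, mulr1, mul1r, add0r, addr0).
  by rewrite mulfV // rmorph_nat mulVf.
pose v : G := U11Elt vU; pose t : G := U11Elt tU.
have E : (u * (v * t) = t * v)%g.
  apply: val_inj; rewrite [LHS]/= [RHS]/= -[U11_val u]/(val u) uE !mx2M.
  rewrite !(mulr0, mul0r, mulr1, mul1r, add0r, addr0); congr (mx2 _ _ _ _).
  apply: (mulfI P0); rewrite mulrA qE mulrDl mul1r addrC mulrDr !(mulrC p%:R).
  by rewrite -!mulrA mulVf // !mulr1 (mulrC q) divfK // addrC.
have w : sigma v * sigma t * (sigma (v^-1)%g * sigma (t^-1)%g) = 1.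
  by rewrite mulrACA !scharV mulr1.
have := congr1 sigma E; rewrite !scharM => e.
by rewrite -[LHS]mulr1 -[X in _ * X]w mulrA e (mulrC (sigma t)) w.
Qed.
End Unipotent.

Section Induction.
Variables (A : comNzRingType) (tau : schar G A).

(* As B = TU and the character tau|_T of T is inflated to B, the relation reads
   f(tug) = tau(t)f(g); only the restriction of tau to T matters here. *)
Definition ind_pred : {pred G -> A^o} := fun f => `[<
  (forall t u g : G, torus t -> unipotent u -> f (t * u * g)%g = tau t * f g) /\
  (exists2 K : set G, open_subgroup K & forall g h, K h -> f (g * h)%g = f g) >].

Lemma ind_predP f : reflect
  ((forall t u g : G, torus t -> unipotent u -> f (t * u * g)%g = tau t * f g) /\
   (exists2 K : set G, open_subgroup K & forall g h, K h -> f (g * h)%g = f g))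
  (f \in ind_pred).
Proof. exact: asboolP. Qed.

Fact ind_submod : submod_closed ind_pred.
Proof.
split=> [|a f f' /ind_predP[fB [K oK fK]] /ind_predP[fB' [K' oK' fK']]].
  apply/ind_predP; split=> [t u g _ _|]; first by rewrite /= mulr0.
  by exists setT => //; exact: open_subgroupT.
apply/ind_predP; split=> [t u g tt uu|].
  rewrite -[LHS]/(a * f _ + f' _) -[in RHS]/(a * f _ + f' _) fB // fB' //.
  by rewrite mulrDr mulrCA.
exists (K `&` K'); first exact: open_subgroupI.
move=> g h [Kh Kh']; rewrite -[LHS]/(a * f _ + f' _) -[RHS]/(a * f _ + f' _).
by rewrite fK // fK'.
Qed.
HB.instance Definition _ :=
  GRing.isSubmodClosed.Build A (G -> A^o) ind_pred ind_submod.

Record ind := Ind { ind_fun :> G -> A^o; indP : ind_fun \in ind_pred }.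
HB.instance Definition _ := [isSub for ind_fun].
HB.instance Definition _ := [Choice of ind by <:].
HB.instance Definition _ := [SubChoice_isSubLmodule of ind by <:].

Fact ind_trans (h : G) (f : ind) : (fun g => f (g * h)%g) \in ind_pred.
Proof.
case: f => f /= /ind_predP[fB [K oK fK]]; apply/ind_predP; split.
  by move=> t u g tt uu; rewrite -mulgA fB.
exists [set g | K (h^-1 * g * h)%g]; first exact: open_subgroup_conj.
by move=> g g' /(fK (g * h)%g); rewrite !mulgA mulgK.
Qed.
Definition ind_act (h : G) (f : ind) : ind := Ind (ind_trans h f).

Definition ind_rep : srep G A.
Proof.
exists ind ind_act.
- by move=> g a f f'; apply: val_inj; apply/funext.
- by move=> f; apply: val_inj; apply/funext => g; rewrite /= mulg1.
- by move=> h h' f; apply: val_inj; apply/funext => g; rewrite /= mulgA.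
- move=> f; have /ind_predP[_ [K oK fK]] := indP f; exists K => // h Kh.
  by apply: val_inj; apply/funext => g; rewrite /= fK.
Defined.

(* All the functions g |-> a tau(g) lie in ind (char_fun_ind). *)
Definition char_line : set ind_rep :=
  [set f : ind | exists a : A, forall g, f g = a * tau g].

Lemma char_fun_ind (a : A) : (fun g => a * tau g) \in ind_pred.
Proof.
apply/ind_predP; split=> [t u g _ uu|].
  by rewrite !scharM (schar_unipotent tau uu) mulr1 mulrCA.
have [K oK K1] := schar_smooth tau; exists K => // g h /K1 e.
by rewrite scharM e mulr1.
Qed.

Fact char_line_sub : submodule char_line.
Proof.
split=> [|f f' [a fa] [a' fa']|b f [a fa]].
- by exists 0 => g; rewrite mul0r.
- by exists (a + a') => g; rewrite mulrDl -fa -fa'.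
- by exists (b * a) => g; rewrite -mulrA -fa.
Qed.

Fact char_line_act g f : char_line f -> char_line (srep_act g f).
Proof.
by case=> a fa; exists (a * tau g) => h; rewrite /= fa scharM mulrAC mulrA.
Qed.

Definition St_rep : srep G A := quotient_rep char_line_sub char_line_act.
Definition St_class (f : ind) : St_rep := mq (M := quotient_pre char_line_sub) f.

End Induction.

Definition steinberg (A : comNzRingType) : srep G A := St_rep (triv_char G A).

(* The map from St(sigma) to St_G (x) chi induced by f |-> res o f, composed with
   the identification of St(chi) with St_G (x) chi given by f |-> chi^-1 f. *)
Section SteinbergMap.
Variables (O : comNzRingType) (k : fieldType) (res : {rmorphism O -> k}).
Variables (chi : schar G k) (A : artAlg res) (sigma : char_lift chi A).

Fact ind_red_subproof (f : ind sigma) :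
  (fun g => chi (g^-1)%g * art_res A (f g)) \in ind_pred (triv_char G k).
Proof.
case: f => f /= /ind_predP[fB [K oK fK]]; apply/ind_predP; split.
  move=> t u g tt uu.
  have chiu : chi (u^-1)%g = 1.
    by have := scharV chi u; rewrite (schar_unipotent chi uu) mul1r.
  rewrite [RHS]mul1r fB // rmorphM char_lift_res !invgM !scharM chiu mul1r mulrA.
  by congr (_ * _); rewrite -mulrA [chi (t^-1)%g * _]mulrC scharV mulr1.
have [K' oK' chi1] := schar_smooth chi.
exists (K `&` K'); first exact: open_subgroupI.
move=> g h [Kh Kh']; rewrite fK // invgM scharM chi1 ?mul1r //.
by case: oK' => _ _ _; apply.
Qed.
Definition ind_red (f : ind sigma) : ind (triv_char G k) :=
  Ind (ind_red_subproof f).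

Definition St_map (x : St_rep sigma) : twist_rep chi (steinberg k) :=
  St_class (ind_red (mrepr x)).

Lemma ind_redB (f f' : ind sigma) : ind_red f - ind_red f' = ind_red (f - f').
Proof.
apply: val_inj; apply/funext => g.
by rewrite -[LHS]/(chi _ * _ - chi _ * _) -mulrBr -rmorphB.
Qed.

Lemma St_map_class (f : ind sigma) : St_map (St_class f) = St_class (ind_red f).
Proof.
apply/quotient_classP; rewrite ind_redB.
have [a ha] := quotient_repr (char_line_sub sigma) f.
exists (art_res A a) => g; rewrite -[LHS]/(chi _ * art_res A _) ha.
by rewrite rmorphM char_lift_res mulrCA [chi _ * _]mulrC scharV.
Qed.

Lemma St_map_act h (x : St_rep sigma) :
  St_map (srep_act h x) = srep_act h (St_map x).
Proof.
elim/mqW: x => f; rewrite /= quot_act_class; last exact: char_line_act.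
rewrite -[mq f]/(St_class f) -[mq _]/(St_class (ind_act h f)) !St_map_class.
rewrite quot_act_class; last exact: char_line_act.
rewrite -[RHS]mqZ; congr St_class; apply: val_inj; apply/funext => g.
rewrite -[LHS]/(chi _ * art_res A (f (g * h)%g)).
rewrite -[RHS]/(chi h * (chi (g * h)^-1%g * art_res A (f (g * h)%g))).
by rewrite mulrA invgM scharM mulrA scharV mul1r.
Qed.

End SteinbergMap.

End Steinberg.

Arguments St_map {p} hp {Qp L c O k res chi A} sigma x.

(* Main.v *)
Require Import Defs.
From HB Require Import structures.
From mathcomp Require Import all_boot all_order all_algebra all_field.
From mathcomp Require Import all_classical topology_structure.
From mathcomp Require Import ring zify.

Import Order.TTheory GRing.Theory Num.Theory.

Local Open Scope classical_set_scope.
Local Open Scope ring_scope.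

(** Write q = p^2, t = diag(p, p^-1), let w be the antidiagonal element of G, and
    U_n the group of the unipotent matrices with upper right entry in q^n Z_p e,
    where e spans the trace zero line of Q_{p^2}.

    Bruhat decomposition identifies St(sigma) with the locally constant functions
    of compact support on Q_p, which have a basis independent of A; this shows that
    St(sigma) is a lift.

    Let V be a lift of St (x) chi. As smooth functions on Q_p have no U_0-cohomology,
    the class of the characteristic function of Z_p lifts to a U_0-fixed vector v,
    and by successive approximation along ideals of A it can be chosen to be an
    eigenvector of the operator sum_{i < q} u_i t, with a unit as eigenvalue. Such
    an ordinary vector is unique up to a scalar, hence diag(y, 1/c(y)) acts on v by
    a scalar if y is a unit, and V is free on suitable translates of v by the Borel
    subgroup. This determines a character tau of the torus. Let Gamma be the
    A[G]-module generated by (1_tau, v) in Fun(G, A) x V, where 1_tau is the function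
    of the induced representation of tau supported on BwU_0. The relations between
    the ordinary vector and its translates give Gamma = A w(1_tau, v) +
    A[B](1_tau, v), which implies that Gamma is the graph of a map from functions to
    V, whose kernel is a free A-module of rank one. So G acts on the kernel by a
    character s lifting chi and extending tau, and Gamma induces an isomorphism from
    St(s) to V. Uniqueness of s follows from the uniqueness of ordinary vectors, as
    a character of G is determined by its restriction to the torus. *)

Set Implicit Arguments.
Unset Strict Implicit.
Unset Printing Implicit Defensive.

(** The obstacle is that A is an arbitrary local Artinian algebra and V comes without any model.
    Both are handled by [art_ind]: a starting ideal is joined to 0 by steps from I to J with I/J a
    line over k spanned by a, and multiplication by a identifies pi0 with IV/JV, so every error term
    lives in the explicit function space pi0. The eigenvector equation can be repaired at each step
    because the operator contracts U: it turns translation by r into translation by q r, so an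
    iterate sends any U_0-fixed error into the line of the base function. The constant q is the norm
    of p, the factor by which t scales the coordinate of U. A graph is used because tau is not known
    in advance to extend to G, so there is no representation St(s) yet to map to V. Both projections
    are injective on A[B](1_tau, v): its elements are combinations of translates at one common
    level, which are independent on either side. Evaluation at 1 kills A[B](1_tau, v) and is 1 at
    w(1_tau, v), so it detects the one remaining coefficient; hence the kernel has rank one. *)

(** * Balls of Q_p and their integral representatives *)

Section PadicBalls.
Variables (p : nat) (hp : prime p) (Qp : padicField p).
Local Notation q := (p ^ 2)%N.
Local Notation N := (@padic_norm p Qp).

Lemma padic_norm0 : N 0 = 0.
Proof. by apply/eqP; rewrite padic_norm_eq0. Qed.

Lemma padic_normN a : N (- a) = N a.
Proof. by rewrite -mulN1r padic_normM padic_normN1 mul1r. Qed.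

Lemma padic_normV a : N a^-1 = (N a)^-1.
Proof.
have [->|a0] := eqVneq a 0; first by rewrite invr0 padic_norm0 invr0.
have n0 : N a != 0 by rewrite padic_norm_eq0.
by apply: (mulfI n0); rewrite -padic_normM !mulfV // padic_norm1.
Qed.

Lemma padic_normX a n : N (a ^+ n) = N a ^+ n.
Proof.
by elim: n => [|n IHn]; rewrite ?expr0 ?padic_norm1 // !exprS padic_normM IHn.
Qed.

Lemma padic_norm_gt0 a : (0 < N a) = (a != 0).
Proof. by rewrite lt0r padic_norm_eq0 padic_norm_ge0 andbT. Qed.

Lemma padic_normD_eq a b : N b < N a -> N (a + b) = N a.
Proof.
move=> ba; apply/eqP; rewrite eq_le; apply/andP; split.
  by apply: le_trans (padic_normD _ _) _; rewrite ge_max lexx ltW.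
have := padic_normD (a + b) (- b); rewrite addrK padic_normN le_max.
by rewrite [N a <= N b]leNgt ba orbF.
Qed.

Lemma padic_normB_eq a b : N (a - b) < N a -> N b = N a.
Proof.
by move=> ab; rewrite -{1}(subKr a b) padic_normD_eq // padic_normN.
Qed.

Lemma qQ_gt1 : 1 < (q%:R : rat).
Proof. by rewrite ltr1n (ltn_exp2l 0) ?prime_gt1. Qed.
Lemma qQ_gt0 : 0 < (q%:R : rat). Proof. exact: lt_trans qQ_gt1. Qed.
Lemma qQ_neq0 : (q%:R : rat) != 0. Proof. by rewrite lt0r_neq0 ?qQ_gt0. Qed.

Lemma padic_val_nat n : padic_val p n%:R = logn p n.
Proof.
by rewrite /padic_val -[(n%:R : rat)]/(n%:~R) numq_int denq_int /= logn1 subr0.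
Qed.

Lemma padic_natr_norm (n : nat) : N n%:R = padic_abs p n%:R.
Proof. by rewrite -(padic_norm_ratr Qp) ratr_nat. Qed.

Lemma padic_normq : N q%:R = q%:R^-1.
Proof. by rewrite !natrX padic_normX padic_normp // exprVn. Qed.

Lemma padic_natr0 (n : nat) : (0 < n)%N -> (n%:R : Qp) != 0.
Proof.
move=> n0; have := padic_natr_neq0 hp (Qp^o : fieldExtType Qp) n0.
by [].
Qed.

Lemma qQp_neq0 : (q%:R : Qp) != 0.
Proof. by rewrite padic_natr0 ?expn_gt0 ?prime_gt0. Qed.

Lemma padic_normqz (i : int) : N (q%:R ^ i) = q%:R ^ (- i).
Proof.
by case: i => n; rewrite ?NegzE ?opprK -?exprnN ?padic_normV padic_normX
  padic_normq exprVn ?invrK -?exprnN.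
Qed.

(** This is q^n Z_p. Radii are powers of q rather than p because conjugation by diag(p, 1/p) scales
    the coordinate of U by the norm of p. *)
Definition ball (n : int) (a : Qp) : bool := N a <= q%:R ^ (- n).

Lemma ball0 n : ball n 0.
Proof. by rewrite /ball padic_norm0 exprz_ge0 // ltW ?qQ_gt0. Qed.
Hint Resolve ball0 : core.

Lemma ballN n a : ball n (- a) = ball n a.
Proof. by rewrite /ball padic_normN. Qed.

Lemma ballD n a b : ball n a -> ball n b -> ball n (a + b).
Proof.
by move=> ha hb; apply: le_trans (padic_normD _ _) _; rewrite ge_max; apply/andP.
Qed.

Lemma ballB n a b : ball n a -> ball n b -> ball n (a - b).
Proof. by move=> ha hb; rewrite ballD ?ballN. Qed.

Lemma ballBC n a b : ball n (a - b) = ball n (b - a).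
Proof. by rewrite -ballN opprB. Qed.

Lemma ballDr n a b : ball n b -> ball n (a + b) = ball n a.
Proof.
move=> hb; apply/idP/idP => [h|h]; last exact: ballD.
by rewrite -(addrK b a) ballB.
Qed.

Lemma ballM n m a b : ball n a -> ball m b -> ball (n + m) (a * b).
Proof.
move=> ha hb; rewrite /ball padic_normM opprD expfzDr ?qQ_neq0 //.
by rewrite ler_pM ?padic_norm_ge0.
Qed.

Lemma ballMq n (i : int) a : ball n (q%:R ^ i * a) = ball (n - i) a.
Proof.
rewrite /ball padic_normM padic_normqz opprB expfzDr ?qQ_neq0 //.
by rewrite -ler_pdivlMl ?exprz_gt0 ?qQ_gt0 // invr_expz opprK.
Qed.

Lemma ballMnorm1 n a b : N b = 1 -> ball n (b * a) = ball n a.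
Proof. by move=> b1; rewrite /ball padic_normM b1 mul1r. Qed.

Lemma ball_le m n a : m <= n -> ball n a -> ball m a.
Proof.
move=> mn ha; apply: le_trans ha _; rewrite ler_weXz2l ?lerN2 //.
by rewrite ltW ?qQ_gt1.
Qed.

Lemma ball_ex a : exists n : nat, ball (- n%:Z) a.
Proof.
exists (Num.bound (N a)); rewrite /ball opprK.
apply/ltW/(lt_le_trans (archi_boundP (padic_norm_ge0 a))).
rewrite -exprnP -natrX ler_nat ltnW // ltn_expl //.
by rewrite -(ltr_nat rat) qQ_gt1.
Qed.

Lemma ball_natr n : ball 0 n%:R.
Proof.
rewrite /ball oppr0 expr0z padic_natr_norm /padic_abs.
case: eqP => // _; rewrite padic_val_nat -exprnN invf_le1 ?exprn_gt0 ?ltr0n ?prime_gt0 //.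
by rewrite exprn_ege1 // ler1n prime_gt0.
Qed.

Lemma ball_natr_dvd (n m : nat) : ball n%:Z (m%:R) = (q ^ n %| m)%N.
Proof.
rewrite /ball padic_natr_norm /padic_abs.
have [->|m0] := posnP m; first by rewrite eqxx dvdn0 exprz_ge0 // ltW ?qQ_gt0.
rewrite pnatr_eq0 eqn0Ngt m0 padic_val_nat -!exprnN natrX -exprM.
rewrite lef_pV2 ?qualifE /= ?exprn_gt0 ?ltr0n ?prime_gt0 //.
rewrite ler_eXn2l ?ltr1n ?prime_gt1 // -expnM.
by rewrite pfactor_dvdn.
Qed.

Lemma rep_uniq n (i j : nat) : (i < q ^ n)%N -> (j < q ^ n)%N ->
  ball n%:Z (i%:R - j%:R) -> i = j.
Proof.
wlog ij : i j / (i <= j)%N.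
  move=> H hi hj h; case/orP: (leq_total i j) => ij; first exact: H.
  by apply/esym/H => //; rewrite ballBC.
move=> hi hj; rewrite ballBC -natrB // ball_natr_dvd => /dvdnP[[|m] e].
  by apply/eqP; rewrite eqn_leq ij -subn_eq0 e.
have := leq_subr i j; rewrite e mulSn => h.
by move: (leq_ltn_trans (leq_trans (leq_addr _ _) h) hj); rewrite ltnn.
Qed.

(* Approximate by a rational, then invert its denominator modulo q ^ n. *)
Lemma rep_ex n a : ball 0 a -> exists2 i : 'I_(q ^ n), true & ball n%:Z (a - i%:R).
Proof.
move=> a1; have q0 : (0 < q ^ n)%N by rewrite !expn_gt0 prime_gt0.
have qe : 0 < (q%:R : rat) ^ (- n%:Z) by rewrite exprz_gt0 ?qQ_gt0.
have [x xa] := padic_dense a qe.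
have xb : ball n%:Z (a - ratr x) by exact: ltW.
have x1 : ball 0 (ratr x).
  by rewrite -(subKr a (ratr x)) ballB //; apply: ball_le xb.
have [x0|x0] := eqVneq x 0.
  by exists (Ordinal q0) => //=; move: xb; rewrite x0 (ratr_nat Qp 0).
have dp : coprime p `|denq x|%N.
  rewrite prime_coprime //; apply/negP => pd.
  have pn : ~~ (p %| `|numq x|)%N.
    apply/negP => pn; have /eqP e := coprime_num_den x.
    have := dvdn_gcd p `|numq x| `|denq x|; rewrite pn pd e dvdn1.
    by rewrite eqn_leq leqNgt prime_gt1.
  move: x1; rewrite /ball padic_norm_ratr /padic_abs (negbTE x0) /padic_val.
  rewrite lognE (negbTE pn) !andbF sub0r opprK oppr0 expr0z.
  have l1 : (0 < logn p `|denq x|)%N.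
    by rewrite logn_gt0 mem_primes hp absz_gt0 denq_neq0.
  rewrite -exprnP leNgt => /negP; apply.
  by rewrite exprn_egt1 ?ltr1n ?prime_gt1 // -lt0n.
have dq : coprime `|denq x|%N (q ^ n)%N by rewrite coprime_sym -expnM coprimeXl.
have [u hu] : exists u : nat, (`|denq x|%N * u = 1 %[mod q ^ n])%N.
  have d0 : (0 < `|denq x|)%N by rewrite absz_gt0 denq_neq0.
  have [u v e _] := egcdnP (q ^ n)%N d0.
  exists u; rewrite mulnC e (eqP dq) modnMDl //.
pose m : int := (numq x * u%:Z %% (q ^ n)%N%:Z)%Z.
have qz : (q ^ n)%N%:Z != 0 by rewrite eqz_nat -lt0n.
have m0 : 0 <= m by rewrite modz_ge0.
have mlt : (`|m|%N < q ^ n)%N.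
  by rewrite -ltz_nat gez0_abs //; exact: ltz_pmod.
exists (Ordinal mlt) => //=.
suff h : ball n%:Z (ratr x - `|m|%N%:R).
  by rewrite -(subrK (ratr x) a) -addrA ballD.
have mE : (`|m|%N%:R : Qp) = m%:~R by rewrite -[in RHS](gez0_abs m0).
have dE : (denq x)%:~R = `|denq x|%N%:R :> Qp.
  by rewrite -[in LHS](gez0_abs (denq_ge0 x)).
have dN : N (denq x)%:~R = 1.
  rewrite dE padic_natr_norm /padic_abs pnatr_eq0 absz_eq0 (negbTE (denq_neq0 x)).
  rewrite padic_val_nat lognE (_ : (p %| _)%N = false) ?andbF ?oppr0 ?expr0z //.
  by apply/negbTE; rewrite -prime_coprime.
have d0 : (denq x)%:~R != 0 :> Qp.
  by rewrite -padic_norm_eq0 dN oner_eq0.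
rewrite -(ballMnorm1 _ _ dN) mulrBr mE.
rewrite (_ : _ * ratr x = (numq x)%:~R); last by rewrite /ratr mulrC divfK.
rewrite -intrM -intrB.
have : ((q ^ n)%N%:Z %| numq x - denq x * m)%Z.
  rewrite -eqz_mod_dvd; apply/eqP/esym; rewrite /m modzMmr mulrCA.
  rewrite -modzMmr (_ : (denq x * u %% _ = 1 %% (q ^ n)%N)%Z) ?modzMmr ?mulr1 //.
  by rewrite -[denq x]gez0_abs ?denq_ge0 // -PoszM !modz_nat hu.
case/dvdzP=> z ->; rewrite intrM mulrC.
have zb : ball 0 z%:~R.
  by case: z => z; rewrite ?NegzE ?mulrNz ?ballN ball_natr.
rewrite -[n%:Z]addr0 ballM //.
by rewrite -[_%:~R]/((q ^ n)%:R) ball_natr_dvd.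
Qed.

Section SumReps.
Variables (W : zmodType) (n : nat) (h : Qp -> W).
Hypothesis hper : forall a b, ball 0 a -> ball n%:Z b -> h (a + b) = h a.

(** Sending i to the residue of psi i is injective, hence bijective by cardinality. This reindexes
    the Hecke sums after a translation or a scaling of the representatives. *)
Lemma sum_reps (I : finType) (psi : I -> Qp) : #|I| = (q ^ n)%N ->
  (forall i, ball 0 (psi i)) ->
  (forall i j, ball n%:Z (psi i - psi j) -> i = j) ->
  \sum_i h (psi i) = \sum_(i < q ^ n) h i%:R.
Proof.
move=> cI b0 inj.
pose r i : 'I_(q ^ n) := s2val (cid2 (rep_ex n (b0 i))).
have rP i : ball n%:Z (psi i - (r i)%:R) by rewrite /r; case: cid2.
have rinj : injective r.
  move=> i j e; apply: inj; rewrite -(subrKA (r i)%:R) ballD //.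
  by rewrite e ballBC.
have rbij : bijective r.
  apply: inj_card_bij => //.
  by rewrite cI card_ord.
rewrite [RHS](reindex r) /=; last exact: onW_bij.
apply: eq_bigr => i _; rewrite -[psi i](subrKC (r i)%:R) hper //.
exact: ball_natr.
Qed.

End SumReps.

(** For i < q ^ (n + n) these points represent q^-n Z_p / q^n Z_p: the same n bounds the size and
    the precision, hence the exponent n + n throughout. *)
Definition grid (n : nat) (i : nat) : Qp := q%:R ^ (- n%:Z) * i%:R.

Lemma ball_grid n i : ball (- n%:Z) (grid n i).
Proof. by rewrite ballMq addrC addNr ball_natr. Qed.

Lemma grid_ex n a : ball (- n%:Z) a ->
  exists2 i : 'I_(q ^ (n + n)), true & ball n%:Z (a - grid n i).
Proof.
move=> ha; have : ball 0 (q%:R ^ n%:Z * a) by rewrite ballMq sub0r.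
case/(rep_ex (n + n))=> i _ hi; exists i => //.
rewrite -(_ : q%:R ^ (- n%:Z) * (q%:R ^ n%:Z * a - i%:R) = a - grid n i).
  by rewrite ballMq opprK -PoszD.
by rewrite mulrBr mulrA -expfzDr ?qQp_neq0 // addNr expr0z mul1r.
Qed.

Lemma grid_uniq n (i j : nat) : (i < q ^ (n + n))%N -> (j < q ^ (n + n))%N ->
  ball n%:Z (grid n i - grid n j) -> i = j.
Proof.
move=> hi hj; rewrite -mulrBr ballMq opprK -PoszD; exact: rep_uniq.
Qed.

Lemma gridS n i : grid n i = grid n.+1 (q * i).
Proof.
rewrite /grid natrM mulrA; congr (_ * _).
rewrite -[in LHS](_ : - n.+1%:Z + 1 = - n%:Z); last by lia.
by rewrite expfzDr ?qQp_neq0 // expr1z.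
Qed.

End PadicBalls.

#[global] Hint Resolve ball0 : core.

(** * Conjugation, integers and norm of the quadratic extension *)

Section QuadraticConj.
Variables (p : nat) (hp : prime p) (Qp : padicField p) (L : fieldExtType Qp).
Variable c : {lrmorphism L -> L}.

Lemma padic2_neq0 : (2%:R : L) != 0.
Proof. exact: padic_natr_neq0. Qed.

Lemma conj_alg (a : Qp) : c a%:A = a%:A.
Proof. by rewrite [LHS]linearZ rmorph1. Qed.

Lemma conjZ (a : Qp) x : c (a *: x) = a *: c x.
Proof. exact: linearZ. Qed.

Lemma conjD x y : c (x + y) = c x + c y. Proof. exact: rmorphD. Qed.
Lemma conjN x : c (- x) = - c x. Proof. exact: rmorphN. Qed.
Lemma conjM x y : c (x * y) = c x * c y. Proof. exact: rmorphM. Qed.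
Lemma conj1 : c 1 = 1. Proof. exact: rmorph1. Qed.
Lemma conj0 : c 0 = 0. Proof. exact: rmorph0. Qed.
Lemma conjV x : c x^-1 = (c x)^-1. Proof. exact: fmorphV. Qed.
Lemma conj_eq0 x : (c x == 0) = (x == 0). Proof. exact: fmorph_eq0. Qed.
Lemma conj_nat n : c n%:R = n%:R. Proof. exact: rmorph_nat. Qed.

(* The two roots of the quadratic polynomial of a generator are exchanged by c;
   e is their difference. *)
Lemma quadratic_basis : \dim {: L} = 2%N -> (exists x, c x <> x) ->
  exists e : L, [/\ e != 0, c e = - e &
    forall y : L, exists a b : Qp, y = a%:A + b *: e].
Proof.
move=> dimL [x cx].
have x1 : x \notin <[1 : L]>%VS.
  by apply/negP => /vlineP[a e]; apply: cx; rewrite e conj_alg.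
have fr : free [:: (1 : L); x].
  by rewrite (perm_free (_ : perm_eq _ [:: x; 1])) ?(perm_catC [:: 1] [:: x]) //
    free_cons span_seq1 x1 seq1_free oner_neq0.
have full : span [:: (1 : L); x] = fullv.
  by apply/eqP; rewrite eqEdim subvf dimL (eqP fr).
have dec y : exists a b : Qp, y = a%:A + b *: x.
  have : y \in span [:: 1; x] by rewrite full memvf.
  rewrite span_cons span_seq1 => /memv_addP[_ /vlineP[a ->] [_ /vlineP[b ->] ->]].
  by exists a, b.
have [u [v xx]] := dec (x * x).
have cxE : c x = v%:A - x.
  have e1 : c x * c x = u%:A + v *: c x.
    by rewrite -conjM xx conjD conj_alg conjZ.
  have : (c x - x) * (c x - (v%:A - x)) = 0.
    rewrite -(mulr_algl v) in xx; rewrite -(mulr_algl v) in e1.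
    transitivity ((c x * c x) - v%:A * c x - (x * x - v%:A * x)); first by ring.
    by rewrite xx e1; ring.
  move/eqP; rewrite mulf_eq0 !subr_eq0 => /orP[/eqP//|/eqP//].
exists (x - c x); split.
- by rewrite subr_eq0 eq_sym; apply/eqP.
- by rewrite cxE !conjD !conjN !conjD !conjN conj_alg cxE; ring.
- move=> y; have [a [b ->]] := dec y.
  have h2 : (2%:R : Qp) != 0 by apply: padic_natr0.
  exists (a + b * v / 2%:R), (b / 2%:R).
  rewrite cxE scalerDl -!(mulr_algl _ (_ - _)) -(mulr_algl b x) -addrA; congr (_ + _).
  have e2 : (2%:R : Qp)%:A = 2%:R :> L by rewrite -[LHS]/(in_alg L _) rmorph_nat.
  apply: (mulfI padic2_neq0); rewrite -!e2 -!/(in_alg L _) !rmorphM fmorphV /= e2.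
  field.
  exact: padic2_neq0.
Qed.

Section Integers.

Lemma integers_conj x : x \in integers L -> c x \in integers L.
Proof.
move=> /integersP[P Pm /rootP Pr]; apply/integersP; exists P => //; apply/rootP.
have cP : map_poly c (map_poly (Zp_emb L) P) = map_poly (Zp_emb L) P.
  by apply/polyP => i; rewrite !coef_map /= conj_alg.
by rewrite -cP horner_map Pr rmorph0.
Qed.

Lemma padic_norm_sum (I : Type) (r : seq I) (F : I -> Qp) (B : rat) : 0 <= B ->
  (forall i, padic_norm (F i) <= B) -> padic_norm (\sum_(i <- r) F i) <= B.
Proof.
move=> B0 FB; elim/big_rec: _ => [|i x _ h]; first by rewrite padic_norm0.
by apply: le_trans (padic_normD _ _) _; rewrite ge_max FB.
Qed.

(** Z_p is integrally closed: if a had absolute value > 1, the leading term of a monic equation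
    would exceed all the others. *)
Lemma integers_alg (a : Qp) : a%:A \in integers L -> padic_norm a <= 1.
Proof.
move=> /integersP[P Pm /rootP Pr].
have {}Pr : (map_poly val P).[a] = 0.
  apply: (fmorph_inj (in_alg L)); rewrite rmorph0 -horner_map -map_poly_comp.
  exact: Pr.
rewrite leNgt; apply/negP => a1.
have a0 : 0 <= padic_norm a by exact: padic_norm_ge0.
have Pm' : map_poly val P \is monic by apply: monic_map.
have Q1 i : padic_norm (map_poly val P)`_i <= 1.
  by rewrite coef_map; exact: (valP P`_i).
move: (map_poly val P) Pr Pm' Q1 => Q Pr Pm' Q1.
have [d sP] : exists d, size Q = d.+1.
  by exists (size Q).-1; rewrite prednK // size_poly_gt0 monic_neq0.
move: Pr; rewrite horner_coef sP big_ord_recr /=.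
have -> : Q`_d = 1.
  by move: Pm'; rewrite monicE lead_coefE sP => /eqP.
rewrite mul1r => /eqP; rewrite addrC addr_eq0 => /eqP ad.
case: d => [|d] in sP ad.
  by move/eqP: ad; rewrite big_ord0 oppr0 expr0 oner_eq0.
have : padic_norm (a ^+ d.+1) <= padic_norm a ^+ d.
  rewrite ad padic_normN; apply: padic_norm_sum; first exact: exprn_ge0.
  move=> i; rewrite padic_normM padic_normX.
  rewrite -[leRHS]mul1r ler_pM ?padic_norm_ge0 ?exprn_ge0 //.
  by rewrite ler_weXn2l ?ltW // -ltnS.
by rewrite padic_normX ler_eXn2l // ltnn.
Qed.

Lemma integers_algE (a : Qp) : (a%:A \in integers L) = (padic_norm a <= 1).
Proof. by apply/idP/idP => [/integers_alg //|/padic_int_integral]. Qed.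

End Integers.

Section Norm.
Variables (e : L) (e0 : e != 0) (ce : c e = - e).
Hypothesis dec : forall y : L, exists a b : Qp, y = a%:A + b *: e.

Lemma conjK : involutive c.
Proof.
move=> y; have [a [b ->]] := dec y.
by rewrite conjD conj_alg conjZ ce scalerN conjD conj_alg conjN conjZ ce scalerN opprK.
Qed.

Lemma conj_fixE x : c x = x -> exists a : Qp, x = a%:A.
Proof.
have [a [b ->]] := dec x; rewrite conjD conj_alg conjZ ce => /addrI /eqP.
rewrite scalerN eq_sym -addr_eq0 -mulr2n -mulr_natl mulf_eq0 (negbTE padic2_neq0) /=.
by move=> /eqP->; exists a; rewrite addr0.
Qed.

Lemma conj_antiE y : c y = - y -> exists b : Qp, y = b *: e.
Proof.
have [a [b ->]] := dec y; rewrite conjD conj_alg conjZ ce scalerN opprD.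
move=> /addIr /eqP; rewrite -addr_eq0 -mulr2n -mulr_natl mulf_eq0.
by rewrite (negbTE padic2_neq0) /= => /eqP->; exists b; rewrite add0r.
Qed.

Lemma nrm_ex x : exists a : Qp, x * c x = a%:A.
Proof. by apply: conj_fixE; rewrite conjM conjK mulrC. Qed.

Definition nrm x : Qp := projT1 (cid (nrm_ex x)).
Lemma nrmE x : x * c x = (nrm x)%:A.
Proof. exact: (projT2 (cid (nrm_ex x))). Qed.

Lemma alg_inj : injective (fun a : Qp => a%:A : L).
Proof. exact: (fmorph_inj (in_alg L)). Qed.

Lemma algM (a b : Qp) : (a * b)%:A = a%:A * b%:A :> L.
Proof. by rewrite -!/(in_alg L _) rmorphM. Qed.

Lemma alg_nat n : n%:R%:A = n%:R :> L.
Proof. by rewrite -[LHS]/(in_alg L _) rmorph_nat. Qed.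

Lemma nrmM x y : nrm (x * y) = nrm x * nrm y.
Proof. by apply: alg_inj; rewrite -!nrmE algM -!nrmE conjM mulrACA. Qed.
Lemma nrm1 : nrm 1 = 1.
Proof. by apply: alg_inj; rewrite -nrmE conj1 mulr1 scale1r. Qed.
Lemma nrm_neq0 x : x != 0 -> nrm x != 0.
Proof.
move=> x0; apply/eqP => n0; have /eqP := nrmE x.
by rewrite n0 scale0r mulf_eq0 conj_eq0 orbb (negbTE x0).
Qed.
Lemma nrmV x : nrm x^-1 = (nrm x)^-1.
Proof.
have [->|x0] := eqVneq x 0.
  have -> : nrm 0 = 0 by apply: alg_inj; rewrite -nrmE mul0r scale0r.
  by rewrite !invr0; apply: alg_inj; rewrite -nrmE mul0r scale0r.
by apply: (mulfI (nrm_neq0 x0)); rewrite -nrmM !mulfV ?nrm1 // nrm_neq0.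
Qed.
Lemma nrm_conj x : nrm (c x) = nrm x.
Proof. by apply: alg_inj; rewrite -!nrmE conjK mulrC. Qed.
Lemma nrm_alg (a : Qp) : nrm a%:A = a * a.
Proof. by apply: alg_inj; rewrite -nrmE conj_alg algM. Qed.
Lemma nrm_p : nrm p%:R = (p ^ 2)%:R.
Proof. by rewrite -alg_nat nrm_alg -natrM mulnn. Qed.

Lemma nrm_integers x : x \in integers L -> padic_norm (nrm x) <= 1.
Proof.
by move=> xi; rewrite -integers_algE -nrmE rpredM // integers_conj.
Qed.

Lemma nrm_unit x : x != 0 -> x \in integers L -> x^-1 \in integers L ->
  padic_norm (nrm x) = 1.
Proof.
move=> x0 /nrm_integers h /nrm_integers; rewrite nrmV padic_normV => h'.
apply/eqP; rewrite eq_le h /=.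
by move: h'; rewrite invf_le1 // padic_norm_gt0 nrm_neq0.
Qed.

Hypothesis unr : unramified L.
Local Notation q := (p ^ 2)%N.

(** The place where [unramified] enters: an integer that is not a unit is divisible by p, and
    dividing by p multiplies the absolute value of the norm by q, so repeated division ends at a
    unit, whose norm has absolute value 1. *)
Lemma val_ex x : x != 0 -> exists i : int, padic_norm (nrm x) = q%:R ^ (- i).
Proof.
move=> x0.
(* The lower bound on the norm limits the number of divisions by p; a general x is first multiplied
   by a power of p to become integral. *)
suff H n y : y != 0 -> y \in integers L -> q%:R ^ (- n%:Z) <= padic_norm (nrm y) ->
    exists i : int, padic_norm (nrm y) = q%:R ^ (- i).
  have [m xm] := padic_bounded hp x.
  have P0 : (p%:R : L) != 0 by rewrite padic_natr_neq0 ?prime_gt0.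
  have y0 : p%:R ^+ m * x != 0 by rewrite mulf_neq0 // expf_neq0.
  have n0 := nrm_neq0 y0.
  have [n hn] := ball_ex hp (nrm (p%:R ^+ m * x))^-1.
  have [|i hi] := H n _ y0 xm.
    move: hn; rewrite /ball opprK padic_normV -exprnN.
    by rewrite -exprnP -lef_pV2 ?qualifE /= ?invr_gt0 ?padic_norm_gt0 ?exprn_gt0 ?qQ_gt0 // invrK.
  exists (i - m%:Z).
  have -> : x = p%:R ^- m * (p%:R ^+ m * x) by rewrite mulKf // expf_neq0.
  rewrite nrmM padic_normM hi nrmV.
  have -> : nrm (p%:R ^+ m) = q%:R ^+ m.
    by elim: (m) => [|k IHk]; rewrite ?nrm1 // !exprS nrmM IHk nrm_p.
  rewrite padic_normV padic_normX padic_normq // exprVn invrK exprnP.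
  by rewrite -expfzDr ?qQ_neq0 // opprB addrC.
elim: n y => [|n IHn] y y0 yi.
  rewrite oppr0 expr0z => h; exists 0; rewrite oppr0 expr0z.
  by apply/eqP; rewrite eq_le h nrm_integers.
move=> h; have [yv|yv] := boolP (y^-1 \in integers L).
  by exists 0; rewrite oppr0 expr0z nrm_unit.
have [z zi yz] := unr yi yv.
have z0 : z != 0 by apply: contra_neq y0 => z0; rewrite yz z0 mulr0.
have ny : padic_norm (nrm y) = q%:R^-1 * padic_norm (nrm z).
  by rewrite yz nrmM padic_normM nrm_p padic_normq.
have [|i hi] := IHn z z0 zi.
  move: h; rewrite ny -(ler_pM2l (qQ_gt0 hp)) mulVKf ?qQ_neq0 //.
  rewrite -{1}[q%:R]expr1z -expfzDr ?qQ_neq0 //; congr (q%:R ^ _ <= _); lia.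
exists (i + 1); rewrite ny hi -[X in X^-1]expr1z invr_expz -expfzDr ?qQ_neq0 //.
by congr (_ ^ _); lia.
Qed.

End Norm.

End QuadraticConj.

(** * Coordinates on G, the Borel subgroup and the big cell *)

Section Group.
Variables (p : nat) (hp : prime p) (Qp : padicField p) (L : fieldExtType Qp).
Variable c : {lrmorphism L -> L}.
Variables (e : L) (e0 : e != 0) (ce : c e = - e).
Hypothesis dec : forall y : L, exists a b : Qp, y = a%:A + b *: e.
Local Notation G := (U11 c).
Local Notation nrm := (nrm hp ce dec).
Local Notation cK := (conjK ce dec).

Lemma algV (a : Qp) : a^-1%:A = a%:A^-1 :> L.
Proof. exact: (fmorphV (in_alg L)). Qed.

Definition mx2 (x y z t : L) : 'M[L]_2 := \matrix_(i, j)
  (if i == ord0 then (if j == ord0 then x else y)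
   else (if j == ord0 then z else t)).

Lemma mx2M x y z t x' y' z' t' : mx2 x y z t *m mx2 x' y' z' t' =
  mx2 (x * x' + y * z') (x * y' + y * t') (z * x' + t * z') (z * y' + t * t').
Proof.
apply/matrixP => i j; rewrite !mxE !big_ord_recl big_ord0 !mxE /= addr0.
by case: ifP => _; case: ifP.
Qed.

Lemma mx2T x y z t : (mx2 x y z t)^T = mx2 x z y t.
Proof. by apply/matrixP => i j; rewrite !mxE; do 2!case: ifP. Qed.

Lemma mx2c x y z t : map_mx c (mx2 x y z t) = mx2 (c x) (c y) (c z) (c t).
Proof. by apply/matrixP => i j; rewrite !mxE; do 2!case: ifP. Qed.

Lemma ord2E (i : 'I_2) : i = if i == ord0 then ord0 else ord_max.
Proof. by case: i => [[|[|//]] hi]; apply: val_inj. Qed.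

Lemma mx2E (M : 'M[L]_2) :
  M = mx2 (M ord0 ord0) (M ord0 ord_max) (M ord_max ord0) (M ord_max ord_max).
Proof.
apply/matrixP => i j; rewrite !mxE [in LHS](ord2E i) [in LHS](ord2E j).
by do 2!case: ifP.
Qed.

Lemma mx2_inj x y z t x' y' z' t' : mx2 x y z t = mx2 x' y' z' t' ->
  [/\ x = x', y = y', z = z' & t = t'].
Proof.
by move=> /matrixP E; split; [have := E ord0 ord0|have := E ord0 ord_max|
  have := E ord_max ord0|have := E ord_max ord_max]; rewrite !mxE.
Qed.

Lemma mx2_1 : 1%:M = mx2 1 0 0 1.
Proof.
apply/matrixP => i j; rewrite !mxE [in LHS](ord2E i) [in LHS](ord2E j).
by do 2!case: ifP.
Qed.

Lemma mx2_antidiag : antidiag L = mx2 0 1 1 0.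
Proof.
apply/matrixP => i j; rewrite !mxE [in LHS](ord2E i) [in LHS](ord2E j).
by do 2!case: ifP.
Qed.

Lemma mx2_unitary x y z t :
  [/\ c z * x + c x * z = 0, c z * y + c x * t = 1,
      c t * x + c y * z = 1 & c t * y + c y * t = 0] ->
  mx2 x y z t \in unitary c.
Proof.
case=> h1 h2 h3 h4.
have E : (map_mx c (mx2 x y z t))^T *m antidiag L *m mx2 x y z t = antidiag L.
  rewrite mx2_antidiag mx2c mx2T !mx2M; congr mx2.
  - by rewrite -[RHS]h1; ring.
  - by rewrite -[RHS]h2; ring.
  - by rewrite -[RHS]h3; ring.
  - by rewrite -[RHS]h4; ring.
rewrite inE E eqxx andbT unitmxE unitfE; apply/eqP => d0.
have /eqP := congr1 determinant E; rewrite !det_mulmx d0 mulr0 eq_sym.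
have : antidiag L *m antidiag L = 1%:M.
  by rewrite mx2_antidiag mx2M mx2_1; congr mx2; ring.
move=> /(congr1 determinant); rewrite det_mulmx det1 => h /eqP d.
by move: h; rewrite d mulr0 => /esym/eqP; rewrite oner_eq0.
Qed.

Lemma U11_val_inj (g h : G) : val g = val h -> g = h.
Proof. exact: val_inj. Qed.

Lemma valM (g h : G) : val (g * h)%g = val g *m val h. Proof. by []. Qed.
Lemma val1 : val (1%g : G) = mx2 1 0 0 1. Proof. exact: mx2_1. Qed.

Definition g10 (g : G) : L := val g ord_max ord0.
Definition g11 (g : G) : L := val g ord_max ord_max.

Lemma U11_eqs (g : G) x y z t : val g = mx2 x y z t ->
  [/\ c z * x + c x * z = 0, c z * y + c x * t = 1,
      c t * x + c y * z = 1 & c t * y + c y * t = 0].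
Proof.
move=> gE; have /andP[_ /eqP] := U11P g; rewrite -[U11_val g]/(val g) gE.
rewrite mx2_antidiag mx2c mx2T !mx2M => /mx2_inj[h1 h2 h3 h4].
by split; [rewrite -[RHS]h1|rewrite -[RHS]h2|rewrite -[RHS]h3|rewrite -[RHS]h4]; ring.
Qed.

Lemma valV (g : G) x y z t : val g = mx2 x y z t ->
  val (g^-1)%g = mx2 (c t) (c y) (c z) (c x).
Proof.
move=> gE; have [h1 h2 h3 h4] := U11_eqs gE.
have /(congr1 (mulmx^~ (val (g^-1)%g))) : mx2 (c t) (c y) (c z) (c x) *m val g = 1%:M.
  rewrite gE mx2M mx2_1; congr mx2.
  - by rewrite -[RHS]h3; ring.
  - by rewrite -[RHS]h4; ring.
  - by rewrite -[RHS]h1; ring.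
  - by rewrite -[RHS]h2; ring.
by rewrite -mulmxA -valM mulgV mulmx1 mul1mx.
Qed.

(** [insubd] falls back on 1 outside G; these matrices are all unitary except that of [tor 0], hence
    the hypotheses x != 0 below. *)
Definition w : G := insubd (1%g : G) (mx2 0 1 1 0).
Definition up (a : Qp) : G := insubd (1%g : G) (mx2 1 (a *: e) 0 1).
Definition tor (x : L) : G := insubd (1%g : G) (mx2 x 0 0 (c x)^-1).

Lemma val_w : val w = mx2 0 1 1 0.
Proof. by apply/insubdK/mx2_unitary; rewrite !(conj0, conj1); split; ring. Qed.

Lemma val_up a : val (up a) = mx2 1 (a *: e) 0 1.
Proof.
apply/insubdK/mx2_unitary; rewrite !(conj0, conj1) conjZ ce scalerN.
by split; ring.
Qed.

Lemma val_tor x : x != 0 -> val (tor x) = mx2 x 0 0 (c x)^-1.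
Proof.
move=> x0; apply/insubdK/mx2_unitary; rewrite !conj0 conjV cK.
by rewrite mulVf // mulfV ?conj_eq0 //; split; ring.
Qed.

Lemma up0 : up 0 = 1%g.
Proof. by apply: U11_val_inj; rewrite val_up val1 scale0r. Qed.

Lemma upD a b : up (a + b) = (up a * up b)%g.
Proof.
by apply: U11_val_inj; rewrite valM !val_up mx2M scalerDl; congr mx2; ring.
Qed.

Lemma upV a : ((up a)^-1)%g = up (- a).
Proof. by apply: (mulgI (up a)); rewrite mulgV -upD subrr up0. Qed.

Lemma w2 : (w * w)%g = 1%g.
Proof.
by apply: U11_val_inj; rewrite valM !val_w mx2M val1; congr mx2; ring.
Qed.

Lemma wV : (w^-1)%g = w.
Proof. by apply: (mulgI w); rewrite mulgV w2. Qed.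

Lemma tor1 : tor 1 = 1%g.
Proof.
by apply: U11_val_inj; rewrite val_tor ?oner_neq0 // val1 conj1 invr1.
Qed.

Lemma torM x y : x != 0 -> y != 0 -> tor (x * y) = (tor x * tor y)%g.
Proof.
move=> x0 y0; apply: U11_val_inj; rewrite valM !val_tor ?mulf_neq0 // mx2M.
by congr mx2; rewrite ?conjM ?invfM; ring.
Qed.

Lemma tor_up x a : x != 0 -> (tor x * up a = up (nrm x * a) * tor x)%g.
Proof.
move=> x0; apply: U11_val_inj; rewrite !valM !val_up !val_tor // !mx2M.
congr mx2; rewrite ?(mulr1, mulr0, mul0r, mul1r, addr0, add0r) //.
rewrite -scalerA -[nrm x *: _]mulr_algl -nrmE -!mulrA; congr (_ * _).
by rewrite mulrC divfK // conj_eq0.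
Qed.

Lemma w_tor x : x != 0 -> (w * tor x = tor (c x)^-1 * w)%g.
Proof.
move=> x0; apply: U11_val_inj; rewrite !valM !val_w !val_tor ?invr_neq0 ?conj_eq0 //.
by rewrite !mx2M conjV cK invrK; congr mx2; ring.
Qed.

Definition lo (a : Qp) : G := (w * up a * w)%g.

Lemma val_lo a : val (lo a) = mx2 1 0 (a *: e) 1.
Proof. by rewrite !valM val_w val_up !mx2M; congr mx2; ring. Qed.

(** The inverse of a e is again a multiple of e because e^2 = -N(e) lies in Q_p; this is its
    coordinate. *)
Definition inv_up (a : Qp) : Qp := - (a * nrm e)^-1.

Lemma nrm_e : e * e = (- nrm e)%:A.
Proof. by rewrite scaleNr -nrmE ce mulrN opprK. Qed.

Lemma inv_upE a : a != 0 -> inv_up a *: e = (a *: e)^-1.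
Proof.
move=> a0; have ae0 : a *: e != 0 by rewrite scaler_eq0 negb_or a0.
have n0 : nrm e != 0 by exact: nrm_neq0.
apply: (mulIf ae0); rewrite mulVf // -scalerAl -scalerAr nrm_e.
rewrite !scalerA /inv_up -[RHS]scale1r; congr (_ *: _).
by field; rewrite a0 n0.
Qed.

(** The relation that governs the behaviour at infinity: when a is far from 0, the lower unipotent
    factor is close to 1 and acts trivially on a given smooth vector. *)
Lemma w_up a : a != 0 ->
  (w * up a = up (inv_up a) * tor (- (a *: e)^-1) * lo (inv_up a))%g.
Proof.
move=> a0; have ae0 : a *: e != 0 by rewrite scaler_eq0 negb_or a0.
apply: U11_val_inj; rewrite valM val_w val_up valM val_lo valM val_up.
rewrite val_tor ?oppr_eq0 ?invr_eq0 //.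
rewrite inv_upE // conjN conjV conjZ ce scalerN !invrN opprK invrK !mx2M.
by congr mx2; field.
Qed.

Lemma torus_tor (g : G) : torus g -> exists2 x, x != 0 & g = tor x.
Proof.
case=> h1 h2; have gE := mx2E (val g); rewrite h1 h2 in gE.
have [_ e1 e2 _] := U11_eqs gE.
set x := val g ord0 ord0 in gE e1 e2; set t := val g ord_max ord_max in gE e1 e2.
have x0 : x != 0.
  apply/eqP => x0; move/eqP: e1; rewrite x0 conj0 mulr0 mul0r add0r.
  by rewrite eq_sym oner_eq0.
exists x => //; apply: U11_val_inj; rewrite val_tor // gE; congr mx2.
have cx0 : c x != 0 by rewrite conj_eq0.
by apply: (mulfI cx0); rewrite mulfV // -e1 mulr0 add0r.
Qed.

Lemma unipotent_up (g : G) : unipotent g -> exists a, g = up a.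
Proof.
case=> h1 [h2 h3]; have gE := mx2E (val g); rewrite h1 h2 h3 in gE.
have [_ _ _] := U11_eqs gE.
rewrite conj1 mul1r mulr1 addrC => /eqP; rewrite addr_eq0 => /eqP.
move=> /(conj_antiE hp ce dec)[a ya]; exists a.
by apply: U11_val_inj; rewrite val_up gE ya.
Qed.

Lemma up_unipotent a : unipotent (up a).
Proof. by rewrite /unipotent /= -!/(val (up a)) val_up !mxE. Qed.

Lemma tor_torus x : x != 0 -> torus (tor x).
Proof. by move=> x0; rewrite /torus /= -!/(val (tor x)) val_tor // !mxE. Qed.

Lemma borel_dec (g : G) : g10 g = 0 ->
  exists x a, x != 0 /\ g = (tor x * up a)%g.
Proof.
rewrite /g10 => h1; have gE := mx2E (val g); rewrite h1 in gE.
have [_ e1 e2 e3] := U11_eqs gE.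
set x := val g ord0 ord0 in gE e1 e2; set t := val g ord_max ord_max in gE e1 e2 e3.
set y := val g ord0 ord_max in gE e1 e2 e3.
rewrite conj0 mul0r add0r in e1.
have x0 : x != 0.
  by apply/eqP => x0; move/eqP: e1; rewrite x0 conj0 mul0r eq_sym oner_eq0.
have cx0 : c x != 0 by rewrite conj_eq0.
have tE : t = (c x)^-1 by apply: (mulfI cx0); rewrite e1 mulfV.
have [a ya] : exists a : Qp, x^-1 * y = a *: e.
  apply: (conj_antiE hp ce dec); rewrite conjM conjV.
  move: e3; rewrite tE conjV cK => /eqP; rewrite addrC addr_eq0 => /eqP e3.
  by rewrite mulrC e3.
exists x, a; split=> //; apply: U11_val_inj; rewrite valM val_tor // val_up gE mx2M.
by rewrite -ya mulVKf // tE; congr mx2; ring.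
Qed.

(* The bottom row of g is proportional to (1, pos g e); junk value 0 on the Borel
   subgroup. *)
Definition pos (g : G) : Qp :=
  match pselect (exists a : Qp, g11 g = a *: e * g10 g) with
  | left h => projT1 (cid h) | right _ => 0 end.

Lemma posE (g : G) : g10 g != 0 -> g11 g = pos g *: e * g10 g.
Proof.
rewrite /g10 /g11 => z0; rewrite /pos; case: pselect => [h|[]].
  exact: (projT2 (cid h)).
have gE := mx2E (val g).
have := congr1 val (mulgV g); rewrite valM (valV gE) {1}gE val1 mx2M.
move=> /mx2_inj[_ _ + _].
set z := val g ord_max ord0 in z0 *; set t := val g ord_max ord_max => e1.
have [a ya] : exists a : Qp, t * z^-1 = a *: e.
  apply: (conj_antiE hp ce dec); rewrite conjM conjV; apply: (mulIf z0); rewrite mulNr divfK //.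
  have cz0 : c z != 0 by rewrite conj_eq0.
  apply: (mulIf cz0); rewrite mulrAC divfK // mulNr; apply/eqP.
  by rewrite -addr_eq0 mulrC e1.
by exists a; rewrite /g10 /g11 -/z -/t -ya divfK.
Qed.

Lemma pos_uniq (g : G) a : g10 g != 0 -> g11 g = a *: e * g10 g -> pos g = a.
Proof.
move=> z0; rewrite posE // => /(mulIf z0)/eqP; rewrite -subr_eq0 -scalerBl.
by rewrite scaler_eq0 (negbTE e0) orbF subr_eq0 => /eqP.
Qed.

(** Right multiplication by [up (- pos g)] makes the bottom right entry vanish, and w then moves the
    result into the Borel subgroup. *)
Lemma bigcell_dec (g : G) : g10 g != 0 ->
  exists b, g = (tor (c (g10 g))^-1 * up b * w * up (pos g))%g.
Proof.
move=> z0; have cz0 : c (g10 g) != 0 by rewrite conj_eq0.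
pose h := (g * up (- pos g) * w)%g.
have hE : val h = mx2 (val g ord0 ord_max - val g ord0 ord0 * (pos g *: e))
    (val g ord0 ord0) 0 (g10 g).
  rewrite !valM val_up val_w {1}(mx2E (val g)) !mx2M -/(g11 g) -/(g10 g) posE //.
  by rewrite scaleNr; congr mx2; ring.
have h10 : g10 h = 0 by rewrite /g10 hE !mxE.
have [x [b [x0 hb]]] := borel_dec h10.
exists b; have -> : (c (g10 g))^-1 = x.
  have : val h ord_max ord_max = (c x)^-1.
    by rewrite hb valM val_tor // val_up mx2M !mxE /= mul0r add0r mulr1.
  by rewrite hE !mxE /= => ->; rewrite conjV cK invrK.
by rewrite -hb /h -[X in (X * up _)%g]mulgA w2 mulg1 -mulgA -upD addNr up0 mulg1.
Qed.

Lemma g10M (g h : G) : g10 (g * h)%g =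
  g10 g * val h ord0 ord0 + g11 g * val h ord_max ord0.
Proof.
by rewrite /g10 valM {1}(mx2E (val g)) {1}(mx2E (val h)) mx2M !mxE.
Qed.

Lemma g11M (g h : G) : g11 (g * h)%g =
  g10 g * val h ord0 ord_max + g11 g * val h ord_max ord_max.
Proof.
by rewrite /g11 valM {1}(mx2E (val g)) {1}(mx2E (val h)) mx2M !mxE.
Qed.

Lemma g10_up g a : g10 (g * up a)%g = g10 g.
Proof. by rewrite g10M val_up !mxE /= mulr1 mulr0 addr0. Qed.

Lemma pos_up g a : g10 g != 0 -> pos (g * up a)%g = pos g + a.
Proof.
move=> z0; apply: pos_uniq; rewrite g10_up //.
by rewrite g11M val_up !mxE /= posE // scalerDl; ring.
Qed.

Lemma g10_tor g x : x != 0 -> g10 (g * tor x)%g = g10 g * x.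
Proof. by move=> x0; rewrite g10M val_tor // !mxE /= mulr0 addr0. Qed.

Lemma pos_tor g x : x != 0 -> g10 g != 0 ->
  pos (g * tor x)%g = (nrm x)^-1 * pos g.
Proof.
move=> x0 z0; apply: pos_uniq; rewrite g10_tor ?mulf_neq0 //.
rewrite g11M val_tor // !mxE /= posE // mulr0 add0r.
have nx0 := nrm_neq0 hp ce dec x0.
have cx0 : c x != 0 by rewrite conj_eq0.
have -> : ((nrm x)^-1 * pos g) *: e = (x * c x)^-1 * (pos g *: e).
  by rewrite -[LHS]mulr_algl algM algV -mulrA (nrmE hp ce dec) mulr_algl.
by field; rewrite x0 cx0.
Qed.

Lemma g10_lmul g x b : x != 0 -> g10 (tor x * up b * g)%g = (c x)^-1 * g10 g.
Proof.
move=> x0; rewrite !g10M /g10 /g11 !valM val_tor // val_up mx2M !mxE /=.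
by ring.
Qed.

Lemma pos_lmul g x b : x != 0 -> g10 g != 0 -> pos (tor x * up b * g)%g = pos g.
Proof.
move=> x0 z0; apply: pos_uniq; rewrite g10_lmul ?mulf_neq0 ?invr_neq0 ?conj_eq0 //.
rewrite g11M /g10 /g11 !valM val_tor // val_up mx2M !mxE /= -/(g11 g) -/(g10 g).
by rewrite posE //; ring.
Qed.

Lemma g10_w : g10 w = 1. Proof. by rewrite /g10 val_w !mxE. Qed.
Lemma g10_1 : g10 1%g = 0. Proof. by rewrite /g10 val1 !mxE. Qed.
Lemma pos_w : pos w = 0.
Proof.
by apply: pos_uniq; rewrite g10_w ?oner_neq0 // /g11 val_w !mxE /= scale0r mul0r.
Qed.

End Group.

(** * Congruence subgroups and the function supported on B w U_0 *)

Section Topology.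
Variables (p : nat) (hp : prime p) (Qp : padicField p) (L : fieldExtType Qp).
Variable c : {lrmorphism L -> L}.
Variables (e : L) (e0 : e != 0) (ce : c e = - e).
Hypothesis dec : forall y : L, exists a b : Qp, y = a%:A + b *: e.
Local Notation G := (U11 c).
Local Notation nrm := (nrm hp ce dec).
Local Notation up := (up c e).
Local Notation tor := (tor c).
Local Notation w := (w c).
Local Notation lo := (lo c e).
Local Notation pos := (pos e).
Local Notation q := (p ^ 2)%N.

Definition pint (m : nat) (x : L) : Prop :=
  exists2 z, z \in integers L & x = p%:R ^+ m * z.

Lemma pint0 m : pint m 0.
Proof. by exists 0; rewrite ?rpred0 ?mulr0. Qed.

Lemma pintD m x y : pint m x -> pint m y -> pint m (x + y).
Proof. by move=> [z zi ->] [t ti ->]; exists (z + t); rewrite ?rpredD ?mulrDr. Qed.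

Lemma pintMl m x y : x \in integers L -> pint m y -> pint m (x * y).
Proof. by move=> xi [t ti ->]; exists (x * t); rewrite ?rpredM // mulrCA. Qed.

Lemma pintMr m x y : pint m x -> y \in integers L -> pint m (x * y).
Proof. by move=> xi yi; rewrite mulrC; apply: pintMl. Qed.

Lemma pintN m x : pint m x -> pint m (- x).
Proof. by rewrite -mulN1r; apply: pintMl; rewrite rpredN1. Qed.

Lemma pint_conj m x : pint m x -> pint m (c x).
Proof.
move=> [z zi ->]; exists (c z); first exact: integers_conj.
by rewrite conjM -natrX conj_nat.
Qed.

Lemma pint_le m n x : (m <= n)%N -> pint n x -> pint m x.
Proof.
move=> /subnKC <- [z zi ->]; exists (p%:R ^+ (n - m) * z).
  by rewrite rpredM // rpredX // rpred_nat.
by rewrite mulrA exprD.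
Qed.

Lemma pint_integers m x : pint m x -> x \in integers L.
Proof. by move=> [z zi ->]; rewrite rpredM // rpredX // rpred_nat. Qed.

Lemma pint1_integers m x : pint m (x - 1) -> x \in integers L.
Proof. by move=> /pint_integers h; rewrite -(subrK 1 x) rpredD ?rpred1. Qed.

Lemma pint_bound y : exists m0, forall m x, pint (m + m0) x -> pint m (x * y).
Proof.
have [m0 yi] := padic_bounded hp y; exists m0 => m x [z zi ->].
exists (z * (p%:R ^+ m0 * y)); first by rewrite rpredM.
by rewrite exprD; ring.
Qed.

Lemma pint_ball (n : nat) (a : Qp) : ball n%:Z a -> pint n a%:A.
Proof.
move=> an; exists (q%:R ^- n * p%:R ^+ n * a)%:A.
  rewrite integers_algE // !padic_normM padic_normX padic_normp // padic_normV padic_normX.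
  rewrite padic_normq // exprVn invrK mulrAC mulrC exprVn.
  rewrite ler_pdivrMl ?exprn_gt0 ?ltr0n ?prime_gt0 // mulr1.
  apply: (@le_trans _ _ 1); last first.
    by rewrite exprn_ege1 // ler1n prime_gt0.
  by rewrite -ler_pdivlMl ?exprn_gt0 ?qQ_gt0 // mulr1 exprnN.
have P0 : (p%:R : L) != 0 by rewrite padic_natr_neq0 ?prime_gt0.
rewrite !algM algV -!/(in_alg L _) !rmorphXn !rmorph_nat natrX /= -!/(in_alg L _).
rewrite -exprM mul2n -addnn exprD; move: (_ ^+ n) (expf_neq0 n P0) => u u0.
by field.
Qed.

(** The norm of x lies in 1 + p Z_p, so it has absolute value 1 and c x / N(x) is an integral
    inverse. The exponent m.+1 ensures a congruence modulo p at least. *)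
Lemma pint1_unit m x : pint m.+1 (x - 1) ->
  [/\ x != 0, x^-1 \in integers L & padic_norm (nrm x) = 1].
Proof.
move=> h; have /(pint_le (ltn0Sn m)) h1 : pint m.+1 (x * c x - 1).
  rewrite (_ : _ - 1 = (x - 1) * c x + c (x - 1)); last first.
    by rewrite conjD conjN conj1; ring.
  apply: pintD; last exact: pint_conj.
  by apply: pintMr => //; exact/integers_conj/(pint1_integers h).
have n1 : padic_norm (nrm x) = 1.
  have [z zi zE] := h1; rewrite (nrmE hp ce dec) in zE.
  have zA : z = (p%:R^-1 * (nrm x - 1))%:A.
    have P0 : (p%:R : L) != 0 by rewrite padic_natr_neq0 ?prime_gt0.
    apply: (mulfI P0); rewrite -zE algM algV alg_nat mulVKf //.
    by rewrite scalerBl scale1r.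
  move: zi; rewrite zA integers_algE // padic_normM padic_normV padic_normp // invrK.
  move=> le1; rewrite -(padic_norm1 Qp); apply: padic_normB_eq.
  rewrite -padic_normN opprB padic_norm1.
  have p1 : 1 < (p%:R : rat) by rewrite ltr1n prime_gt1.
  apply: le_lt_trans (_ : p%:R^-1 < 1); last by rewrite invf_lt1 // ltr0n prime_gt0.
  by rewrite -[leRHS]mulr1 ler_pdivlMl // ltr0n prime_gt0.
have x0 : x != 0.
  apply/eqP => x0; move/eqP: n1; rewrite (_ : nrm x = 0) ?padic_norm0 //.
  by apply: (@alg_inj _ _ L); rewrite -nrmE x0 mul0r scale0r.
split=> //; rewrite (_ : x^-1 = c x * (nrm x)^-1%:A).
  rewrite rpredM ?integers_conj ?(pint1_integers h) //.
  by rewrite integers_algE // padic_normV n1 invr1.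
have cx0 : c x != 0 by rewrite conj_eq0.
by rewrite algV -nrmE; field; rewrite x0 cx0.
Qed.

Definition cong (m : nat) : set G :=
  [set g : G | forall i j, pint m (val g i j - (1%:M : 'M[L]_2) i j)].

Lemma congE m (g : G) x y z t : val g = mx2 x y z t ->
  cong m g <-> [/\ pint m (x - 1), pint m y, pint m z & pint m (t - 1)].
Proof.
move=> gE; rewrite /cong /= -[U11_val g]/(val g) gE mx2_1; split=> [h|[h1 h2 h3 h4] i j].
  have := (h ord0 ord0, h ord0 ord_max, h ord_max ord0, h ord_max ord_max).
  by rewrite !mxE /= !subr0 => -[[[]]].
by rewrite (ord2E i) (ord2E j) !mxE; do 2!case: ifP => _; rewrite //= subr0.
Qed.

Lemma cong_open_subgroup m : open_subgroup (cong m).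
Proof.
split.
- suff : U11_open (cong m) by [].
  move=> g gm; exists m => h hg i j; have := pintD (hg i j) (gm i j).
  by rewrite addrA subrK.
- by move=> i j; rewrite subrr; exact: pint0.
- move=> g h /(congE m (mx2E (val g)))[] + + + +.
  move=> + + + + /(congE m (mx2E (val h)))[].
  move: (val g ord0 ord0) (val g ord0 ord_max) (val g ord_max ord0)
    (val g ord_max ord_max) (mx2E (val g)) (val h ord0 ord0) (val h ord0 ord_max)
    (val h ord_max ord0) (val h ord_max ord_max) (mx2E (val h)).
  move=> x y z t gE x' y' z' t' hE gx gy gz gt hx hy hz ht.
  have ghE : val (g * h)%g = mx2 (x * x' + y * z') (x * y' + y * t')
      (z * x' + t * z') (z * y' + t * t') by rewrite -[val (g * h)%g]/(val g *m val h) gE hE mx2M.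
  apply/(congE m ghE); split.
  + rewrite (_ : _ - 1 = (x - 1) * x' + (x' - 1) + y * z'); last by ring.
    apply: pintD; first apply: pintD => //.
      by apply: pintMr => //; exact: pint1_integers hx.
    by apply: pintMr => //; exact: pint_integers hz.
  + apply: pintD; first by apply: pintMl => //; exact: pint1_integers gx.
    by apply: pintMr => //; exact: pint1_integers ht.
  + apply: pintD; first by apply: pintMr => //; exact: pint1_integers hx.
    by apply: pintMl => //; exact: pint1_integers gt.
  + rewrite (_ : _ - 1 = (t - 1) * t' + (t' - 1) + z * y'); last by ring.
    apply: pintD; first apply: pintD => //.
      by apply: pintMr => //; exact: pint1_integers ht.
    by apply: pintMr => //; exact: pint_integers hy.
- move=> g /(congE m (mx2E (val g)))[h1 h2 h3 h4].
  apply/(congE m (valV (mx2E (val g)))).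
  have cB x : c x - 1 = c (x - 1) by rewrite conjD conjN conj1.
  by rewrite !cB; split; exact: pint_conj.
Qed.

Lemma open_subgroup_cong (K : set G) : open_subgroup K -> exists m, cong m `<=` K.
Proof.
case=> oK K1 _ _; have oK' : U11_open K by [].
by have [m hm] := oK' _ K1; exists m => g gm; apply: hm.
Qed.

Lemma pint_scale_e m : exists n : nat, forall a : Qp, ball n%:Z a -> pint m (a *: e).
Proof.
have [m0 h] := pint_bound e; exists (m + m0)%N => a /pint_ball/h.
by rewrite mulr_algl.
Qed.

Lemma up_cong m : exists n : nat, forall a : Qp, ball n%:Z a -> cong m (up a).
Proof.
have [n hn] := pint_scale_e m; exists n => a /hn h.
by apply/(congE m (val_up ce a)); rewrite subrr; split=> //; exact: pint0.
Qed.

Lemma lo_cong m : exists n : nat, forall a : Qp, ball n%:Z a -> cong m (lo a).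
Proof.
have [n hn] := pint_scale_e m; exists n => a /hn h.
by apply/(congE m (val_lo ce a)); rewrite subrr; split=> //; exact: pint0.
Qed.

Lemma tor_cong m x : pint m.+1 (x - 1) -> cong m.+1 (tor x).
Proof.
move=> h; have [x0 xi _] := pint1_unit h.
apply/(congE _ (val_tor ce dec x0)); split=> //; try exact: pint0.
rewrite -conjV (_ : _ - 1 = - (c (x - 1) * c x^-1)).
  by apply/pintN/pintMr; [exact: pint_conj|exact: integers_conj].
have cx0 : c x != 0 by rewrite conj_eq0.
by rewrite conjV conjD conjN conj1; field.
Qed.

Section Cell.
Variables (A : comNzRingType) (tau : L -> A).
Hypothesis tauM : forall x y, x != 0 -> y != 0 -> tau (x * y) = tau x * tau y.
Hypothesis tau1 : tau 1 = 1.

(** The function 1_tau, read off from the bottom row of g. Left multiplication by [tor x] acts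
    through tau (c x)^-1 ([cell_left]); this equals tau x once tau extends to G, since w conjugates
    one torus element into the other. *)
Definition cell (g : G) : A :=
  if (g10 g != 0) && ball 0 (pos g) then tau (g10 g) else 0.

Lemma cell_left x b g : x != 0 ->
  cell (tor x * up b * g)%g = tau (c x)^-1 * cell g.
Proof.
move=> x0; have cx0 : (c x)^-1 != 0 by rewrite invr_eq0 conj_eq0.
rewrite /cell g10_lmul // mulf_eq0 (negbTE cx0) /=.
have [z0|z0] := boolP (g10 g == 0); first by rewrite mulr0.
by rewrite pos_lmul //=; case: ifP => _; rewrite ?mulr0 ?tauM.
Qed.

Lemma cell_up g a : ball 0 a -> cell (g * up a)%g = cell g.
Proof.
move=> a0; rewrite /cell g10_up //; have [//|z0] := boolP (g10 g == 0).
by rewrite pos_up // ballDr.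
Qed.

Lemma cell_torE x g : x != 0 -> cell (g * tor x)%g =
  tau x * (if (g10 g != 0) && ball 0 ((nrm x)^-1 * pos g) then tau (g10 g) else 0).
Proof.
move=> x0; rewrite /cell (g10_tor ce dec) // mulf_eq0 (negbTE x0) orbF.
have [z0|z0] := boolP (g10 g == 0); first by rewrite mulr0.
by rewrite (pos_tor hp e0 ce dec) //=; case: ifP => _; rewrite ?mulr0 // tauM // mulrC.
Qed.

Lemma cell_tor x g : x != 0 -> padic_norm (nrm x) = 1 ->
  cell (g * tor x)%g = tau x * cell g.
Proof.
by move=> x0 nx; rewrite cell_torE // ballMnorm1 // padic_normV nx invr1.
Qed.

Lemma cell_torp g : cell (g * tor p%:R)%g =
  tau p%:R * (if (g10 g != 0) && ball 1 (pos g) then tau (g10 g) else 0).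
Proof.
rewrite cell_torE ?padic_natr_neq0 ?prime_gt0 // nrm_p.
by rewrite -[X in X^-1]expr1z invr_expz ballMq // opprK.
Qed.

(** Translation by [tor p%:R] shrinks the condition on [pos g] from Z_p to q Z_p, and exactly one of
    the q translates of an integral [pos g] falls into q Z_p. *)
Lemma cell_hecke g :
  \sum_(i < q ^ 1) cell (g * up i%:R * tor p%:R)%g = tau p%:R * cell g.
Proof.
under eq_bigr do rewrite cell_torp g10_up //.
rewrite -mulr_sumr; congr (_ * _); rewrite /cell.
have [z0|z0] := boolP (g10 g == 0); first by rewrite big1.
under eq_bigr do rewrite pos_up //.
rewrite /=; case: ifP => [b0|b0]; last first.
  rewrite big1 // => i _; case: ifP => // /(ball_le hp (ler01)).
  by rewrite ballDr ?b0 // ball_natr.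
have [i _ hi] := rep_ex hp 1 (etrans (ballN 0 (pos g)) b0).
have hi' : ball 1 (pos g + i%:R) by rewrite -ballN opprD.
rewrite (bigD1 i) //= hi' big1 ?addr0 // => j ji.
case: ifP => // hj; case/eqP: ji; apply: val_inj.
apply: (@rep_uniq _ hp Qp 1 _ _ (ltn_ord j) (ltn_ord i)).
by have := ballB hj hi'; rewrite opprD addrACA subrr add0r.
Qed.

Lemma cell_w a : cell (w * up a)%g = (ball 0 a)%:R.
Proof.
rewrite /cell g10_up // g10_w oner_neq0 /= pos_up ?g10_w ?oner_neq0 // pos_w //.
by rewrite add0r; case: ifP.
Qed.

Lemma cell1 : cell 1%g = 0.
Proof. by rewrite /cell g10_1 eqxx. Qed.

(* If the bottom row of g is (z, z y) with y bounded, the bottom row of gk is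
   (z u, z u y') where u is close to 1 and y' is bounded. *)
Lemma cell_smooth : (exists m, forall x, pint m (x - 1) -> tau x = 1) ->
  exists2 K : set G, open_subgroup K & forall g h, K h -> cell (g * h)%g = cell g.
Proof.
case=> m tm; have [m1 h1] := pint_bound e; have [m2 h2] := pint_bound e^-1.
pose M := (m.+1 + m1 + m2)%N; exists (cong M); first exact: cong_open_subgroup.
have main g k : cong M k -> (g10 g != 0) && ball 0 (pos g) ->
    cell (g * k)%g = cell g.
  move=> /(congE M (mx2E (val k)))[]; set x := val k ord0 ord0.
  set y := val k ord0 ord_max; set z := val k ord_max ord0.
  set t := val k ord_max ord_max => kx ky kz kt /andP[z0 b0].
  have ai : (pos g)%:A \in integers L.
    by rewrite integers_algE //; move: b0; rewrite /ball oppr0 expr0z.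
  pose u := x + (pos g)%:A * (z * e).
  have uE : g10 (g * k)%g = g10 g * u.
    by rewrite g10M (posE hp ce dec z0) -/x -/z /u -(mulr_algl (pos g) e); ring.
  have u1 : pint m.+1 (u - 1).
    rewrite (_ : u - 1 = (x - 1) + (pos g)%:A * (z * e)); last by rewrite /u; ring.
    apply: pintD; first by apply: pint_le kx; rewrite /M; lia.
    by apply: pintMl => //; apply/h1/(pint_le _ kz); rewrite /M; lia.
  have [u0 ui nu] := pint1_unit u1.
  have z0' : g10 (g * k)%g != 0 by rewrite uE mulf_neq0.
  have b0' : ball 0 (pos (g * k)%g).
    have := posE hp ce dec z0'; rewrite g11M (posE hp ce dec z0) -/y -/t uE => pE.
    have {pE} pE : (pos (g * k)%g)%:A = (y * e^-1 + (pos g)%:A * t) * u^-1.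
      have eu0 : e * g10 g * u != 0 by rewrite !mulf_neq0.
      apply: (mulIf eu0); rewrite -!(mulr_algl (pos _) e) in pE.
      transitivity (g10 g * y + (pos g)%:A * e * g10 g * t); first by rewrite pE; ring.
      by field; rewrite e0 u0.
    rewrite /ball oppr0 expr0z -(@integers_algE _ _ L) pE rpredM // rpredD //.
      by apply/(@pint_integers 0)/h2/(pint_le _ ky); rewrite /M; lia.
    by rewrite rpredM // (pint1_integers kt).
  rewrite /cell z0' b0' z0 b0 /= uE tauM // (tm u) ?mulr1 //.
  by apply: pint_le u1.
(* [main] settles g in the support. If only g k is, it applies to g k and the inverse of k;
   otherwise both values are 0. *)
move=> g k kM; have [gb|gb] := boolP ((g10 g != 0) && ball 0 (pos g)).
  exact: main.
have [gkb|gkb] := boolP ((g10 (g * k)%g != 0) && ball 0 (pos (g * k)%g)).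
  have [_ _ _ inv] := cong_open_subgroup M.
  by have := main _ _ (inv _ kM) gkb; rewrite mulgK => <-.
by rewrite /cell (negbTE gb) (negbTE gkb).
Qed.

End Cell.

End Topology.

(** * Ideals maximal among those avoiding an element *)

Section IdealAvoid.
Variable R : comNzRingType.

Lemma idealB (I : set R) x y : ideal I -> I x -> I y -> I (x - y).
Proof.
by case=> _ ID IM Ix Iy; apply: ID => //; rewrite -mulN1r; apply: IM.
Qed.

Lemma ideal_sum (I : set R) (T : eqType) (s : seq T) (F : T -> R) : ideal I ->
  (forall t, t \in s -> I (F t)) -> I (\sum_(t <- s) F t).
Proof.
case=> I0 ID IM h; rewrite big_seq; elim/big_rec: _ => [//|t x ts]; apply: ID.
exact: h.
Qed.

Lemma ideal_principal (a : R) : ideal [set b * a | b in [set: R]].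
Proof.
split.
- by exists 0; rewrite ?mul0r.
- by move=> _ _ [b _ <-] [b' _ <-]; exists (b + b'); rewrite ?mulrDl.
- by move=> b _ [b' _ <-]; exists (b * b'); rewrite ?mulrA.
Qed.

Lemma ideal_add (I : set R) (a : R) : ideal I ->
  ideal [set x | exists b, I (x - b * a)].
Proof.
case=> I0 ID IM; split.
- by exists 0; rewrite mul0r subr0.
- by move=> x y [b h] [b' h']; exists (b + b'); rewrite mulrDl opprD addrACA; exact: ID.
- by move=> r x [b h]; exists (r * b); rewrite -mulrA -mulrBr; exact: IM.
Qed.

(** For a = 1 this gives a maximal ideal above J0; for other a, an ideal modulo which a lies in
    every nonzero ideal. *)
Lemma ideal_avoid (J0 : set R) (a : R) : ideal J0 -> ~ J0 a ->
  exists J : set R, [/\ ideal J, J0 `<=` J, ~ J a &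
    forall J', ideal J' -> J `<=` J' -> ~ J' a -> J' = J].
Proof.
move=> iJ0 J0a.
(* the empty set is admitted since Zorn_bigcup also quantifies over the empty chain *)
pose P := [set X : set R | X = set0 \/ [/\ ideal X, J0 `<=` X & ~ X a]].
have [|J [PJ Jmax]] := @Zorn_bigcup R P.
  move=> F FP Ftot.
  have [[X FX [x Xx]]|h] := pselect (exists2 X, F X & exists x, X x); last first.
    left; rewrite -subset0 => x [X FX Xx]; exfalso; apply: h.
    by exists X => //; exists x.
  have good Y y : F Y -> Y y -> [/\ ideal Y, J0 `<=` Y & ~ Y a].
    by move=> FY Yy; case: (FP _ FY) => // Y0; rewrite Y0 in Yy.
  right; split.
  - have [iX J0X _] := good _ _ FX Xx; split.
    + by exists X => //; case: iX.
    + move=> y z [Y FY Yy] [Z FZ Zz].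
      have [[Y0 YD YM] _ _] := good _ _ FY Yy; have [[Z0 ZD ZM] _ _] := good _ _ FZ Zz.
      have [YZ|ZY] := Ftot _ _ FY FZ.
        by exists Z => //; apply: ZD => //; exact: YZ.
      by exists Y => //; apply: YD => //; exact: ZY.
    + move=> r y [Y FY Yy]; exists Y => //.
      by have [[_ _ YM] _ _] := good _ _ FY Yy; exact: YM.
  - by have [_ J0X _] := good _ _ FX Xx; move=> y /J0X; exists X.
  - by move=> [Y FY Ya]; have [_ _ []] := good _ _ FY Ya.
case: PJ => [J_0|[iJ J0J Ja]].
  exfalso; apply: (Jmax J0); last by right; split.
  split; first by rewrite J_0; exact: sub0set.
  by move=> /(_ 0); rewrite J_0; apply; case: iJ0.
exists J; split=> // J' iJ' JJ' J'a; apply: contrapT => ne.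
apply: (Jmax J'); last by right; split=> //; exact: subset_trans JJ'.
by split=> // J'J; apply: ne; apply/seteqP.
Qed.

End IdealAvoid.

(** * Units and induction along ideals in a local Artinian algebra *)

Section ArtTheory.
Variables (O : comNzRingType) (k : fieldType) (res : {rmorphism O -> k}).
Hypothesis res_surj : forall y, exists x, res x = y.
Variable A : artAlg res.
Local Notation rA := (art_res A).

Lemma art_res_surj (y : k) : exists a : A, rA a = y.
Proof. by have [x xy] := res_surj y; exists (art_str A x); rewrite art_resE. Qed.

Lemma art_ker_maximal : maximal_ideal [set a : A | rA a = 0].
Proof.
split=> /=.
- split=> /= [|x y hx hy|x y hy]; first exact: rmorph0.
    by rewrite rmorphD hx hy addr0.
  by rewrite rmorphM hy mulr0.
- by rewrite rmorph1; apply/eqP; rewrite oner_eq0.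
- move=> J iJ J1 mJ; apply/seteqP; split=> // x Jx /=; apply: contrapT => /eqP x0.
  have [b bx] := art_res_surj (rA x)^-1; apply: J1.
  have [_ JD JM] := iJ; rewrite -(subrK (b * x) 1); apply: JD; last exact: JM.
  by apply: mJ; rewrite /= rmorphB rmorphM bx mulVf // rmorph1 subrr.
Qed.

(** A non-unit lies in some maximal ideal; a local ring has only one, and here it is the kernel of
    the residue map. *)
Lemma art_unit (a : A) : rA a <> 0 -> exists b, a * b = 1.
Proof.
move=> a0; apply: contrapT => nu.
have n1 : ~ [set b * a | b in [set: A]] 1.
  by move=> [b _ ba]; apply: nu; exists b; rewrite mulrC.
have [J [iJ aJ J1 Jmax]] := ideal_avoid (ideal_principal a) n1.
have Jm : maximal_ideal J by split=> // J' iJ' J'1 JJ'; exact: Jmax.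
have [I [_ Iu]] := art_local A.
have JI := Iu _ Jm; have mI := Iu _ art_ker_maximal.
have : J a by apply: aJ; exists 1; rewrite ?mul1r.
by rewrite -JI mI.
Qed.

Lemma art_unit_eq0 (a b : A) : rA a <> 0 -> b * a = 0 -> b = 0.
Proof.
move=> /art_unit[a' aa'] ba; rewrite -[b]mulr1 -aa' mulrA ba.
by rewrite mul0r.
Qed.

(** Otherwise choice gives a map to strictly smaller members of P, and its iterates contradict the
    Artinian condition. *)
Lemma art_min (P : set (set A)) : (forall I, P I -> ideal I) -> (exists I, P I) ->
  exists I, P I /\ forall J, P J -> J `<=` I -> J = I.
Proof.
move=> Pid [I0 PI0]; apply: contrapT => nomin.
have next (I : {I | P I}) : exists J : {I | P I},
    proj1_sig J `<=` proj1_sig I /\ proj1_sig J <> proj1_sig I.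
  case: I => I PI; apply: contrapT => h; apply: nomin; exists I; split=> // J PJ JI.
  apply: contrapT => ne; apply: h; exists (exist _ J PJ); split=> //.
have [f fP] := choice next.
pose s n := iter n f (exist _ I0 PI0).
have [N hN] := art_artinian (fun n => Pid _ (proj2_sig (s n)))
  (fun n => (fP (s n)).1).
exact: (fP (s N)).2 (hN _ (leqnSn N)).
Qed.

(* Nakayama: a minimal ideal acting nontrivially on I is principal, say (x), and
   x = x b t with t in the maximal ideal if I is equal to its multiple by it. *)
Lemma art_nakayama (I : set A) (x0 : A) : ideal I -> I x0 -> x0 <> 0 ->
  exists a, I a /\ ~ exists s : seq (A * A),
    (forall t, t \in s -> rA t.1 = 0 /\ I t.2) /\ a = \sum_(t <- s) t.1 * t.2.
Proof.
move=> iI Ix0 x00; apply: contrapT => h.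
have {}h a : I a -> exists s : seq (A * A),
    (forall t, t \in s -> rA t.1 = 0 /\ I t.2) /\ a = \sum_(t <- s) t.1 * t.2.
  by move=> Ia; apply: contrapT => hs; apply: h; exists a.
pose P := [set J : set A | ideal J /\ exists2 x, J x & exists2 y, I y & x * y <> 0].
have [||J [[iJ [x Jx [y Iy xy]]] Jmin]] := art_min (P := P); first by move=> J [].
  exists setT; split; first by split.
  by exists 1 => //; exists x0; rewrite ?mul1r.
have [s [sI yE]] := h _ Iy.
have [t ts xt] : exists2 t, t \in s & x * t.1 * t.2 <> 0.
  apply: contrapT => hn; apply: xy; rewrite yE mulr_sumr big_seq big1 // => t ts.
  by rewrite mulrA; apply: contrapT => ne; apply: hn; exists t.
have [t1 t2] := sI _ ts.
have [_ _ JM] := iJ.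
have JE : [set b * (x * t.1) | b in [set: A]] = J.
  apply: Jmin; last first.
    by move=> y' [b _ <-]; apply: (JM b); rewrite mulrC; exact: JM.
  split; first exact: ideal_principal.
  by exists (x * t.1); [exists 1; rewrite ?mul1r|exists t.2].
move: Jx; rewrite -JE => -[b _ bx]; apply: xy.
suff -> : x = 0 by rewrite mul0r.
apply: (@art_unit_eq0 (1 - b * t.1)).
  by rewrite rmorphB rmorph1 rmorphM t1 mulr0 subr0; apply/eqP; rewrite oner_eq0.
rewrite mulrBr mulr1 -{1}bx; ring.
Qed.

(** I/J is a line over k spanned by a. Before it is intersected with I, the ideal J is maximal among
    those that contain mI and avoid a: if x in I is not in J, then a is r x modulo J for some r, and
    r is a unit because m x lies in J. *)
Lemma art_step (I : set A) (x0 : A) : ideal I -> I x0 -> x0 <> 0 ->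
  exists J a, [/\ ideal J, J `<=` I, I a & ~ J a] /\
    (forall x, I x -> exists b, J (x - b * a)) /\
    (forall b, rA b = 0 -> J (b * a)).
Proof.
move=> iI Ix0 x00; have [a [Ia na]] := art_nakayama iI Ix0 x00.
pose mI := [set x | exists s : seq (A * A),
    (forall t, t \in s -> rA t.1 = 0 /\ I t.2) /\ x = \sum_(t <- s) t.1 * t.2].
have imI : ideal mI.
  split.
  - by exists [::]; rewrite big_nil.
  - move=> x y [s [sI ->]] [s' [sI' ->]]; exists (s ++ s'); rewrite big_cat; split=> //.
    by move=> t; rewrite mem_cat => /orP[/sI|/sI'].
  - move=> b x [s [sI ->]]; exists [seq (b * t.1, t.2) | t <- s]; split.
      by move=> _ /mapP[t /sI[h h'] ->] /=; rewrite rmorphM h mulr0.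
    by rewrite big_map mulr_sumr; apply: eq_bigr => t _ /=; rewrite mulrA.
have [J [iJ mJ Ja Jmax]] := ideal_avoid imI na.
have [I0 ID IM] := iI; have [J0 JD JM] := iJ.
have mM b x : rA b = 0 -> I x -> mI (b * x).
  move=> b0 Ix; exists [:: (b, x)]; rewrite big_seq1; split=> // t.
  by rewrite inE => /eqP->.
exists (J `&` I), a; split; first split=> //.
- split=> [//|x y [? ?] [? ?]|b x [? ?]]; first by split; [exact: JD|exact: ID].
  by split; [exact: JM|exact: IM].
- by move=> [].
- split=> [x Ix|b b0]; last by split; [apply: mJ; exact: mM|exact: IM].
  have [Jx|Jx] := pselect (J x); first by exists 0; rewrite mul0r subr0.
  have iJ' := ideal_add x iJ.
  have JJ' : J `<=` [set y | exists b, J (y - b * x)].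
    by move=> y Jy; exists 0; rewrite mul0r subr0.
  have J'a : [set y | exists b, J (y - b * x)] a.
    apply: contrapT => /(Jmax _ iJ' JJ') E; apply: Jx; rewrite -E.
    by exists 1; rewrite mul1r subrr.
  case: J'a => r Jr.
  have r0 : rA r <> 0.
    move=> r0; apply: Ja; rewrite -(subrK (r * x) a); apply: JD => //.
    by apply: mJ; exact: mM.
  have [r' rr'] := art_unit r0; exists r'; split; last first.
    by apply: idealB => //; exact: IM.
  rewrite (_ : _ - _ = - r' * (a - r * x)); first exact: JM.
  transitivity (r * r' * x - r' * a); first by rewrite rr' mul1r.
  by ring.
Qed.

(** The engine of all successive approximations. A minimal ideal with P must be 0, since [art_step]
    would otherwise produce a smaller one. *)
Lemma art_ind (P : set A -> Prop) (I0 : set A) : ideal I0 -> P I0 ->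
  (forall (I J : set A) a, ideal I -> ideal J -> I `<=` I0 -> J `<=` I -> I a ->
     ~ J a -> (forall x, I x -> exists b, J (x - b * a)) ->
     (forall b, rA b = 0 -> J (b * a)) -> P I -> P J) -> P [set 0].
Proof.
move=> iI0 PI0 step.
pose Q := [set I : set A | [/\ ideal I, I `<=` I0 & P I]].
have [||I [[iI II0 PI] Imin]] := art_min (P := Q); first by move=> I [].
  by exists I0; split.
have [[x Ix x0]|h] := pselect (exists2 x, I x & x <> 0); last first.
  rewrite -(_ : I = [set 0]) //; apply/seteqP; split=> x /=.
    by move=> Ix; apply: contrapT => x0; apply: h; exists x.
  by move=> ->; case: iI.
have [J [a [[iJ JI Ia Ja] [h1 h2]]]] := art_step iI Ix x0.
have JE : J = I.
  apply: Imin => //; split=> //; first exact: subset_trans II0.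
  exact: (step I J a).
by case: Ja; rewrite JE.
Qed.

End ArtTheory.

(** * Finitely supported coordinates in free modules *)

Section FreeCoord.
Variables (A : comNzRingType) (V : lmodType A) (I : choiceType) (e : I -> V).
Hypothesis span : forall v, exists s : seq (A * I), v = \sum_(t <- s) t.1 *: e t.2.
Hypothesis indep : forall (s : seq I) (a : I -> A),
  uniq s -> \sum_(i <- s) a i *: e i = 0 -> forall i, i \in s -> a i = 0.

Let coords (v : V) (a : I -> A) := exists2 s : seq I, uniq s &
  v = \sum_(i <- s) a i *: e i /\ forall i, i \notin s -> a i = 0.

Let extend (s s' : seq I) (a : I -> A) : uniq s -> uniq s' -> {subset s <= s'} ->
  (forall i, i \notin s -> a i = 0) ->
  \sum_(i <- s) a i *: e i = \sum_(i <- s') a i *: e i.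
Proof.
move=> us us' ss' a0.
rewrite [RHS](bigID [in s]) /= [X in _ + X]big1 ?addr0 => [|i /a0->]; last first.
  by rewrite scale0r.
rewrite -[RHS]big_filter; apply: perm_big; apply: uniq_perm; rewrite ?filter_uniq //.
by move=> i; rewrite mem_filter; case: (boolP (i \in s)) => // /ss' ->.
Qed.

Let coords_uniq v a b : coords v a -> coords v b -> a = b.
Proof.
move=> [s us [vs a0]] [s' us' [vs' b0]]; pose r := undup (s ++ s').
have ur : uniq r by exact: undup_uniq.
have sr : {subset s <= r} by move=> i si; rewrite mem_undup mem_cat si.
have sr' : {subset s' <= r} by move=> i si; rewrite mem_undup mem_cat si orbT.
have E : \sum_(i <- r) (a i - b i) *: e i = 0.
  under eq_bigr do rewrite scalerBl.
  by rewrite sumrB -(extend us ur sr a0) -(extend us' ur sr' b0) -vs -vs' subrr.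
apply/funext => i; have [ir|ir] := boolP (i \in r).
  by apply/eqP; rewrite -subr_eq0; apply/eqP; exact: (indep ur E).
by rewrite a0 ?b0 //; apply: contra ir; [exact: sr'|exact: sr].
Qed.

Let coordsD u v a b : coords u a -> coords v b -> coords (u + v) (fun i => a i + b i).
Proof.
move=> [s us [vs a0]] [s' us' [vs' b0]]; pose r := undup (s ++ s').
have ur : uniq r by exact: undup_uniq.
have sr : {subset s <= r} by move=> i si; rewrite mem_undup mem_cat si.
have sr' : {subset s' <= r} by move=> i si; rewrite mem_undup mem_cat si orbT.
exists r => //; split.
  under eq_bigr do rewrite scalerDl.
  by rewrite big_split /= -(extend us ur sr a0) -(extend us' ur sr' b0) -vs -vs'.
by move=> i ir; rewrite a0 ?b0 ?addr0 //; apply: contra ir; [exact: sr'|exact: sr].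
Qed.

Let coordsZ c v a : coords v a -> coords (c *: v) (fun i => c * a i).
Proof.
move=> [s us [-> a0]]; exists s => //; split.
  by rewrite scaler_sumr; apply: eq_bigr => i _; rewrite scalerA.
by move=> i /a0->; rewrite mulr0.
Qed.

Let coords_e j : coords (e j) (fun i => (j == i)%:R).
Proof.
exists [:: j] => //; rewrite big_seq1 eqxx scale1r; split=> // i.
by rewrite inE eq_sym => /negbTE->.
Qed.

Let coords_ex v : exists a, coords v a.
Proof.
have [s ->] := span v; elim: s => [|[x j] s [a ha]].
  by rewrite big_nil; exists (fun=> 0); exists [::]; rewrite ?big_nil.
rewrite big_cons; eexists; apply: coordsD ha.
exact: coordsZ (coords_e j).
Qed.

Lemma free_coord : exists co : V -> I -> A,
  [/\ forall u v i, co (u + v) i = co u i + co v i,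
      forall a v i, co (a *: v) i = a * co v i,
      forall i j, co (e j) i = (j == i)%:R &
      forall v, exists2 s : seq I, uniq s & v = \sum_(i <- s) co v i *: e i].
Proof.
have [co coP] := choice coords_ex; exists co; split.
- by move=> u v i; rewrite (coords_uniq (coP _) (coordsD (coP u) (coP v))).
- by move=> a v i; rewrite (coords_uniq (coP _) (coordsZ a (coP v))).
- by move=> i j; rewrite (coords_uniq (coP _) (coords_e j)).
- by move=> v; have [s us [vs _]] := coP v; exists s.
Qed.

End FreeCoord.

Section SumLemmas.
Variables (R : comNzRingType) (W : lmodType R).

Lemma span_collect (I : eqType) (e : I -> W) (s : seq (R * I)) :
  exists2 r : seq I, uniq r & exists a : I -> R,
    \sum_(t <- s) t.1 *: e t.2 = \sum_(i <- r) a i *: e i.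
Proof.
exists (undup (map snd s)); first exact: undup_uniq.
exists (fun i => \sum_(t <- s | t.2 == i) t.1).
under [RHS]eq_bigr do rewrite scaler_suml.
rewrite (exchange_big_dep xpredT) //= big_seq [RHS]big_seq; apply: eq_bigr => t ts.
rewrite (eq_bigl (fun j => j == t.2)); last by move=> j; rewrite eq_sym.
rewrite -big_filter filter_pred1_uniq ?undup_uniq ?big_seq1 //.
by rewrite mem_undup map_f.
Qed.

End SumLemmas.

Lemma srep_actB (G : groupTopType) (A : comNzRingType) (V : srep G A) g (u v : V) :
  srep_act g (u - v) = srep_act g u - srep_act g v.
Proof. by rewrite srep_actD -scaleN1r srep_actZ scaleN1r. Qed.

Lemma srep_act_sum (G : groupTopType) (A : comNzRingType) (V : srep G A) g
    (I : Type) (r : seq I) (F : I -> V) :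
  srep_act g (\sum_(i <- r) F i) = \sum_(i <- r) srep_act g (F i).
Proof. exact: (big_morph _ (srep_actD g) (srep_act0 _ g)). Qed.

(** * Lifts modulo ideals and Nakayama arguments *)

Section LiftTheory.
Variables (O : comNzRingType) (k : fieldType) (res : {rmorphism O -> k}).
Hypothesis res_surj : forall y, exists x, res x = y.
Variables (G : groupTopType) (pi0 : srep G k).
Variables (A : artAlg res) (V : srep G A) (phi : V -> pi0).
Hypothesis L : is_lift phi.
Local Notation rA := (art_res A).

Lemma lift_map0 : phi 0 = 0.
Proof. by have := lift_scale L 0 0; rewrite scaler0 rmorph0 scale0r. Qed.

Lemma liftB u v : phi (u - v) = phi u - phi v.
Proof. by rewrite (lift_add L) -scaleN1r (lift_scale L) rmorphN1 scaleN1r. Qed.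

Lemma lift_sum (I : Type) (s : seq I) (F : I -> V) :
  phi (\sum_(i <- s) F i) = \sum_(i <- s) phi (F i).
Proof. exact: (big_morph phi (lift_add L) lift_map0). Qed.

Lemma lift_balanced : balanced rA (fun x (v : V) => x *: phi v).
Proof.
split=> [x y v|x u v|x a v]; first by rewrite scalerDl.
  by rewrite (lift_add L) scalerDr.
by rewrite (lift_scale L) scalerA.
Qed.

(** The reduced basis stays independent because k (x) V -> pi0 is injective: each coordinate,
    reduced to k, is a functional on the tensor product. *)
Lemma lift_basis : exists (I : choiceType) (e : I -> V) (co : V -> I -> A),
  [/\ forall a v i, co (a *: v) i = a * co v i,
      forall v, exists2 s : seq I, uniq s & v = \sum_(i <- s) co v i *: e i,
      forall (s : seq (A * V)) i, co (\sum_(t <- s) t.1 *: t.2) i =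
        \sum_(t <- s) t.1 * co t.2 i &
      forall (s : seq I) (a : I -> k), uniq s -> \sum_(i <- s) a i *: phi (e i) = 0 ->
        forall i, i \in s -> a i = 0].
Proof.
have [I [e [span indep]]] := lift_free L.
have [co [coD coZ coe coP]] := free_coord span indep.
have co0 i : co 0 i = 0 by have := coZ 0 0 i; rewrite scaler0 mul0r.
exists I, e, co; split=> //.
  move=> s i; rewrite (big_morph (co^~ i) (fun u v => coD u v i) (co0 i)).
  by apply: eq_bigr => t _; rewrite coZ.
move=> s a us s0 i si.
have [g gK _] := lift_red L.
pose T := \sum_(j <- s) pure rA (a j) (e j).
have lD := fun x y => tens_liftD x y lift_balanced.
have l0 : tens_lift rA (fun x (v : V) => x *: phi v) 0 = 0.
  by apply: (addrI (tens_lift rA (fun x (v : V) => x *: phi v) 0)); rewrite -lD !addr0.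
have T0 : T = 0.
  apply: (can_inj gK); rewrite (big_morph _ lD l0) l0 -[RHS]s0.
  by apply: eq_bigr => j _; rewrite tens_lift_pure //; exact: lift_balanced.
have bP : balanced rA (fun x (v : V) => x * rA (co v i)).
  split=> [x y v|x u v|x b v]; first by rewrite mulrDl.
    by rewrite coD rmorphD mulrDr.
  by rewrite coZ rmorphM mulrA.
have mD := fun x y => tens_liftD x y bP.
have m0 : tens_lift rA (fun x (v : V) => x * rA (co v i)) 0 = 0.
  by apply: (addrI (tens_lift rA (fun x (v : V) => x * rA (co v i)) 0)); rewrite -mD !addr0.
have := congr1 (tens_lift rA (fun x (v : V) => x * rA (co v i))) T0.
rewrite (big_morph _ mD m0) m0 (bigD1_seq i) //= big1 => [|j ji].
  by rewrite addr0 tens_lift_pure // coe eqxx rmorph1 mulr1.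
by rewrite tens_lift_pure // coe (negbTE ji) rmorph0 mulr0.
Qed.

Definition idealmul (J : set A) (v : V) : Prop :=
  exists2 s : seq (A * V), (forall t, t \in s -> J t.1) & v = \sum_(t <- s) t.1 *: t.2.

Lemma idealmulD J u v : idealmul J u -> idealmul J v -> idealmul J (u + v).
Proof.
move=> [s sJ ->] [s' sJ' ->]; exists (s ++ s'); last by rewrite big_cat.
by move=> t; rewrite mem_cat => /orP[/sJ|/sJ'].
Qed.

Lemma idealmul_mem J a v : J a -> idealmul J (a *: v).
Proof.
move=> Ja; exists [:: (a, v)]; rewrite ?big_seq1 // => t.
by rewrite inE => /eqP->.
Qed.

Lemma idealmulZ J a v : ideal J -> idealmul J v -> idealmul J (a *: v).
Proof.
move=> [_ _ JM] [s sJ ->]; exists [seq (a * t.1, t.2) | t <- s].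
  by move=> _ /mapP[t /sJ h ->]; exact: JM.
by rewrite big_map scaler_sumr; apply: eq_bigr => t _; rewrite scalerA.
Qed.

Lemma idealmulB J u v : ideal J -> idealmul J u -> idealmul J v -> idealmul J (u - v).
Proof. by move=> iJ hu hv; rewrite -scaleN1r; apply/idealmulD/idealmulZ. Qed.

Lemma idealmul_sum J (I : Type) (s : seq I) (F : I -> V) : ideal J ->
  (forall i, idealmul J (F i)) -> idealmul J (\sum_(i <- s) F i).
Proof.
move=> iJ h; elim/big_rec: _ => [|i x _]; last exact: idealmulD.
by exists [::]; rewrite ?big_nil.
Qed.

Lemma idealmul_act J g v : idealmul J v -> idealmul J (srep_act g v).
Proof.
move=> [s sJ ->]; exists [seq (t.1, srep_act g t.2) | t <- s].
  by move=> _ /mapP[t /sJ h ->].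
rewrite big_map (big_morph _ (srep_actD g) (srep_act0 _ g)).
by apply: eq_bigr => t _; rewrite srep_actZ.
Qed.

Lemma idealmul_set0 v : idealmul [set 0] v -> v = 0.
Proof.
by move=> [s s0 ->]; rewrite big_seq big1 // => t /s0 /= ->; rewrite scale0r.
Qed.

Lemma idealmul_step (I J : set A) a v : (forall x, I x -> exists b, J (x - b * a)) ->
  idealmul I v -> exists y, idealmul J (v - a *: y).
Proof.
move=> IJ [s sI ->]; elim: s sI => [_|t s IHs sI].
  by exists 0; rewrite big_nil scaler0 subr0; exists [::]; rewrite ?big_nil.
have [|y hy] := IHs; first by move=> u us; apply: sI; rewrite inE us orbT.
have [b hb] := IJ _ (sI t (mem_head _ _)).
exists (b *: t.2 + y); rewrite big_cons scalerDr opprD addrACA.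
apply: idealmulD => //; rewrite scalerA -scalerBl mulrC.
exact: idealmul_mem.
Qed.

(** A coordinate of y with nonzero residue would be a unit and put a into J. With [idealmul_ker],
    multiplication by a identifies pi0 with IV/JV in the setting of [art_ind]. *)
Lemma idealmul_eq0 (J : set A) a y : ideal J -> ~ J a -> idealmul J (a *: y) ->
  phi y = 0.
Proof.
move=> iJ Ja [s sJ ays]; have [I [e [co [coZ coP coS _]]]] := lift_basis.
have [r _ ->] := coP y; rewrite lift_sum big1 // => i _; rewrite (lift_scale L).
suff -> : rA (co y i) = 0 by rewrite scale0r.
apply: contrapT => /(art_unit res_surj)[b yb]; apply: Ja.
have : J (a * co y i).
  rewrite -coZ ays coS; apply: ideal_sum => // t ts; rewrite mulrC.
  by case: iJ => _ _; apply; exact: sJ.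
by case: iJ => _ _ JM /(JM b); rewrite mulrCA (mulrC b) yb mulr1.
Qed.

Lemma idealmul_ker (J : set A) a y : ideal J -> (forall b, rA b = 0 -> J (b * a)) ->
  phi y = 0 -> idealmul J (a *: y).
Proof.
move=> iJ Ja y0; have [I [e [co [coZ coP coS ind]]]] := lift_basis.
have [r ur yr] := coP y; rewrite yr scaler_sumr big_seq.
elim/big_rec: _ => [|i x ir]; first by exists [::]; rewrite ?big_nil.
apply: idealmulD; rewrite scalerA; apply: idealmul_mem; rewrite mulrC; apply: Ja.
apply: (ind r (fun i => rA (co y i)) ur) => //.
by rewrite -[RHS]y0 yr lift_sum; apply: eq_bigr => j _; rewrite -yr (lift_scale L).
Qed.

Lemma idealmul_kerB (J : set A) a y z : ideal J -> (forall b, rA b = 0 -> J (b * a)) ->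
  phi y = phi z -> idealmul J (a *: y - a *: z).
Proof.
move=> iJ Ja yz; rewrite -scalerBr; apply: idealmul_ker => //.
by rewrite liftB yz subrr.
Qed.

Definition spanned (X : set V) (v : V) : Prop :=
  exists2 s : seq (A * V), (forall t, t \in s -> X t.2) & v = \sum_(t <- s) t.1 *: t.2.

Lemma spannedD X u v : spanned X u -> spanned X v -> spanned X (u + v).
Proof.
move=> [s sJ ->] [s' sJ' ->]; exists (s ++ s'); last by rewrite big_cat.
by move=> t; rewrite mem_cat => /orP[/sJ|/sJ'].
Qed.

Lemma spannedZ X a v : spanned X v -> spanned X (a *: v).
Proof.
move=> [s sJ ->]; exists [seq (a * t.1, t.2) | t <- s].
  by move=> _ /mapP[t /sJ h ->].
by rewrite big_map scaler_sumr; apply: eq_bigr => t _; rewrite scalerA.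
Qed.

Lemma spanned_mem (X : set V) v : X v -> spanned X v.
Proof.
move=> Xv; exists [:: (1, v)]; last by rewrite big_seq1 scale1r.
by move=> t; rewrite inE => /eqP->.
Qed.

(* Nakayama for the elements fixed by a set H of group elements. *)
Lemma lift_gen (H : set G) (X : set V) :
  (forall h x, H h -> X x -> srep_act h x = x) ->
  (forall y : pi0, (forall h, H h -> srep_act h y = y) ->
    exists2 s : seq (k * V), (forall t, t \in s -> X t.2) &
      y = \sum_(t <- s) t.1 *: phi t.2) ->
  forall v : V, (forall h, H h -> srep_act h v = v) -> spanned X v.
Proof.
move=> HX Xgen v Hv.
have fixS u : spanned X u -> forall h, H h -> srep_act h u = u.
  move=> [s sX ->] h Hh; rewrite (big_morph _ (srep_actD h) (srep_act0 _ h)) big_seq.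
  by rewrite [RHS]big_seq; apply: eq_bigr => t /sX ts; rewrite srep_actZ HX.
have iT : ideal [set: A] by split.
suff [u Xu] : exists2 u, spanned X u & idealmul [set 0] (v - u).
  by move=> /idealmul_set0/eqP; rewrite subr_eq0 => /eqP->.
apply: (@art_ind _ _ _ res_surj A (fun I => exists2 u, spanned X u & idealmul I (v - u))
  setT iT).
  exists 0; first by exists [::]; rewrite ?big_nil.
  by rewrite subr0 -[v]scale1r; exact: idealmul_mem.
move=> I J a iI iJ _ JI Ia Ja IJ mJ [u Xu hu].
have [y hy] := idealmul_step IJ hu.
(* The vector v - u is fixed by H and congruent to a y, and multiplication by a is injective from
   pi0 to V/JV; so phi y is fixed by H. *)
have [|s sX ys] := Xgen (phi y).
  move=> h Hh; apply/eqP; rewrite -subr_eq0 -(lift_equiv L) -liftB; apply/eqP.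
  apply: (idealmul_eq0 iJ Ja).
  have := idealmulB iJ hy (idealmul_act h hy).
  rewrite !srep_actB Hv // (fixS _ Xu) // srep_actZ scalerBr; move: (v - u) => x.
  by rewrite opprB addrC addrA subrK.
have [z Xz zy] : exists2 z, spanned X z & phi z = phi y.
  rewrite ys; elim: (s) sX => [_|t r IHr sX].
    by exists 0; [exists [::]; rewrite ?big_nil|rewrite big_nil lift_map0].
  have [|z Xz zr] := IHr; first by move=> i ir; apply: sX; rewrite inE ir orbT.
  have [b bt] := art_res_surj res_surj A t.1; exists (b *: t.2 + z).
    by apply: spannedD => //; apply/spannedZ/spanned_mem/sX; rewrite mem_head.
  by rewrite (lift_add L) (lift_scale L) big_cons zr bt.
exists (u + a *: z); first by apply: spannedD => //; exact: spannedZ.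
have := idealmulD hy (idealmul_kerB iJ mJ (esym zy)).
by rewrite addrA subrK opprD addrA.
Qed.

(** If all coefficients lie in the current ideal, they are d_i b modulo the next one. The relation
    then gives phi of the sum of the d_i x_i equal to 0, so the d_i have residue 0 and the d_i b lie
    in the next ideal. *)
Lemma lift_indep (I : eqType) (s : seq I) (x : I -> V) :
  (forall a : I -> k, \sum_(i <- s) a i *: phi (x i) = 0 ->
    forall i, i \in s -> a i = 0) ->
  forall a : I -> A, \sum_(i <- s) a i *: x i = 0 -> forall i, i \in s -> a i = 0.
Proof.
move=> ind a a0.
suff : forall i, i \in s -> [set (0 : A)] (a i) by [].
have iT : ideal [set: A] by split.
apply: (@art_ind _ _ _ res_surj A (fun J => forall i, i \in s -> J (a i)) setT iT) => //.
move=> J J' b iJ iJ' _ _ _ J'b JJ' mJ' h.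
have [d dP] : exists d : I -> A, forall i, i \in s -> J' (a i - d i * b).
  have hd i : exists d, i \in s -> J' (a i - d * b).
    have [si|si] := boolP (i \in s); last by exists 0.
    by have [d hd] := JJ' _ (h i si); exists d.
  by have [d dP] := choice hd; exists d.
have d0 i : i \in s -> rA (d i) = 0.
  apply: (ind (fun i => rA (d i))); rewrite -[LHS](_ : phi (\sum_(i <- s) d i *: x i) = _); last first.
    by rewrite lift_sum; apply: eq_bigr => j _; rewrite (lift_scale L).
  apply: (idealmul_eq0 iJ' J'b); rewrite scaler_sumr.
  rewrite (_ : \sum_(i <- s) b *: _ = - \sum_(i <- s) (a i - d i * b) *: x i).
    rewrite -scaleN1r; apply: idealmulZ => //; rewrite big_seq.
    elim/big_rec: _ => [|j y sj]; first by exists [::]; rewrite ?big_nil.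
    by apply/idealmulD/idealmul_mem/dP.
  rewrite -sumrN -[RHS]addr0 -[X in _ = _ + X]a0 -big_split; apply: eq_bigr => j _ /=.
  by rewrite scalerBl scalerA opprB subrK mulrC.
move=> i si; rewrite -(subrK (d i * b) (a i)).
by case: iJ' => _ D M; apply: D; [exact: dP|exact/mJ'/d0].
Qed.

End LiftTheory.

Lemma inj_surj_bij (T U : Type) (f : T -> U) : injective f ->
  (forall y, exists x, f x = y) -> bijective f.
Proof.
by move=> fi fs; have [g gP] := choice fs; exists g => [x|y //]; apply: fi.
Qed.

(** * Morphisms of lifts *)

Section LiftMorphisms.
Variables (O : comNzRingType) (k : fieldType) (res : {rmorphism O -> k}).
Hypothesis res_surj : forall y, exists x, res x = y.
Variables (G : groupTopType) (pi0 : srep G k) (A : artAlg res).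
Local Notation rA := (art_res A).

Lemma linear_sumZ (V V' : lmodType A) (psi : V -> V') : linear psi ->
  forall (I : Type) (s : seq I) (a : I -> A) (x : I -> V),
  psi (\sum_(i <- s) a i *: x i) = \sum_(i <- s) a i *: psi (x i).
Proof.
move=> pl I s a x; have p0 : psi 0 = 0.
  by have := pl (-1) 0 0; rewrite scaler0 addr0 scaleN1r addNr.
by elim: s => [|i s IHs]; rewrite ?big_nil // !big_cons pl IHs.
Qed.

Lemma linear_sub0 (V V' : lmodType A) (psi : V -> V') : linear psi ->
  (forall v, psi v = 0 -> v = 0) -> injective psi.
Proof.
move=> pl p0 u v uv; apply/eqP; rewrite -subr_eq0; apply/eqP/p0.
by have := pl (-1) v u; rewrite !scaleN1r [- v + u]addrC uv addNr.
Qed.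

(** Bijectivity is automatic over pi0: the image of a basis is independent by [lift_indep], and the
    range is everything by [lift_gen] with H empty. *)
Lemma lift_morph_iso (l l' : Defs.lift pi0 A) (psi : lift_rep l -> lift_rep l') :
  linear psi -> (forall g v, psi (srep_act g v) = srep_act g (psi v)) ->
  (forall v, lift_map (psi v) = lift_map v) -> lift_iso l l'.
Proof.
move=> pl pg pm; exists psi; split=> //; have L := liftP l; have L' := liftP l'.
apply: inj_surj_bij.
  apply: linear_sub0 => // v v0.
  have [I [e [co [coZ coP coS ind]]]] := lift_basis L.
  have [r ur vr] := coP v; rewrite vr big_seq big1 // => i ir.
  suff -> : co v i = 0 by rewrite scale0r.
  apply: (@lift_indep _ _ _ res_surj _ _ _ _ _ L' _ r (fun i => psi (e i)) _ (co v)) => //.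
    move=> a ha; apply: (ind r a ur); rewrite -[RHS]ha.
    by apply: eq_bigr => j _; rewrite pm.
  by rewrite -linear_sumZ // -vr.
move=> y.
have [|||s sX ->] := @lift_gen _ _ _ res_surj _ _ _ _ _ L' set0 (range psi) _ _ y _ => //.
  move=> z _; have [v vz] := lift_surj L z; exists [:: (1, psi v)].
    by move=> t; rewrite inE => /eqP-> /=; exists v.
  by rewrite big_seq1 /= pm scale1r.
have {}sX t : exists v, t \in s -> psi v = t.2.
  have [ts|] := boolP (t \in s); last by exists 0.
  by have [v _ vt] := sX _ ts; exists v.
have [f fP] := choice sX; exists (\sum_(t <- s) t.1 *: f t).
rewrite linear_sumZ // big_seq [RHS]big_seq; apply: eq_bigr => t ts.
by rewrite fP.
Qed.

(** For the injectivity of k (x) V -> pi0, an element of the kernel is rewritten on the symbols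
    [pure rA 1 (e i)]; independence of the [phi (e i)] then kills its coefficients. *)
Lemma is_lift_basis (V : srep G A) (phi : V -> pi0) (I : choiceType) (e : I -> V) :
  (forall u v, phi (u + v) = phi u + phi v) ->
  (forall a v, phi (a *: v) = rA a *: phi v) ->
  (forall g v, phi (srep_act g v) = srep_act g (phi v)) ->
  (forall v, exists s : seq (A * I), v = \sum_(t <- s) t.1 *: e t.2) ->
  (forall (s : seq I) (a : I -> A), uniq s -> \sum_(i <- s) a i *: e i = 0 ->
    forall i, i \in s -> a i = 0) ->
  (forall w, exists s : seq (k * I), w = \sum_(t <- s) t.1 *: phi (e t.2)) ->
  (forall (s : seq I) (a : I -> k), uniq s -> \sum_(i <- s) a i *: phi (e i) = 0 ->
    forall i, i \in s -> a i = 0) ->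
  is_lift phi.
Proof.
move=> pD pZ pg span indep spank indepk.
have p0 : phi 0 = 0 by have := pZ 0 0; rewrite scaler0 rmorph0 scale0r.
have ps w : exists v, phi v = w.
  have [s ->] := spank w; elim: s => [|t s [v IHs]].
    by exists 0; rewrite big_nil.
  have [b bt] := art_res_surj res_surj A t.1; exists (b *: e t.2 + v).
  by rewrite big_cons pD pZ IHs bt.
have bP : balanced rA (fun x (v : V) => x *: phi v).
  split=> [x y v|x u v|x a v]; first by rewrite scalerDl.
    by rewrite pD scalerDr.
  by rewrite pZ scalerA.
split=> //; first by exists I, e.
set K := tens_lift _ _.
have KD x y : K (x + y) = K x + K y by exact: tens_liftD.
have Kp x v : K (pure rA x v) = x *: phi v by exact: tens_lift_pure.
have K0 : K 0 = 0 by apply: (addrI (K 0)); rewrite -KD !addr0.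
have pb := pure_balanced rA V.
apply: inj_surj_bij => [x y xy|w]; last first.
  by have [v <-] := ps w; exists (pure rA 1 v); rewrite Kp scale1r.
apply/eqP; rewrite -subr_eq0; apply/eqP.
have : K (x - y) = 0 by apply: (addIr (K y)); rewrite -KD subrK add0r.
move: (x - y) => {xy} {}x Kx.
have [s xs] : exists s : seq (k * I), x = \sum_(t <- s) t.1 *: pure rA 1 (e t.2).
  elim/tensorW: (x) => [|b v|y' z [s ->] [s' ->]].
  - by exists [::]; rewrite big_nil.
  - have [s ->] := span v; exists [seq (b * rA t.1, t.2) | t <- s].
    rewrite (big_morph (pure rA b) (balancedDr pb b) (balanced0r b pb)) big_map.
    by apply: eq_bigr => t _; rewrite scale_pure mulr1 (balancedM pb).
  - by exists (s ++ s'); rewrite big_cat.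
have [r ur [a ra]] := span_collect (fun i => pure rA 1 (e i)) s.
rewrite xs ra big_seq big1 // => i ir; suff -> : a i = 0 by rewrite scale0r.
apply: (indepk r a) => //; rewrite -[RHS]Kx xs ra (big_morph K KD K0).
by apply: eq_bigr => j _; rewrite scale_pure Kp mulr1.
Qed.

End LiftMorphisms.

(** * Deformations of a character are characters *)

Section CharacterLifts.
Variables (O : comNzRingType) (k : fieldType) (res : {rmorphism O -> k}).
Hypothesis res_surj : forall y, exists x, res x = y.
Variables (G : groupTopType) (chi : schar G k).

Lemma schar_ext (R : comNzRingType) (s s' : schar G R) : s =1 s' -> s = s'.
Proof.
case: s s' => [f f1 fM fs] [g g1 gM gs] /= /funext fg; rewrite -fg in g1 gM gs *.
congr SChar; exact: Prop_irrelevance.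
Qed.

Lemma char_lift_ext (A : artAlg res) (s s' : char_lift chi A) :
  (forall g, s g = s' g) -> s = s'.
Proof.
case: s s' => [s hs] [s' hs'] /= /schar_ext ss'; rewrite -ss' in hs' *.
congr CharLift; exact: Prop_irrelevance.
Qed.

(** A preimage v of 1 is a basis by [lift_gen] and [lift_indep], and the action of G on v is the
    character. *)
Lemma lift_char_ex (A : artAlg res) (l : Defs.lift (char_rep chi) A) :
  exists s : char_lift chi A, lift_iso (lift_of_char res_surj s) l.
Proof.
have L := liftP l; have [v v1] := lift_surj L 1.
have gen x : exists a, x = a *: v.
  have [|||s sX ->] := @lift_gen _ _ _ res_surj _ _ _ _ _ L set0 [set v] _ _ x _ => //.
    move=> z _; exists [:: (z, v)]; first by move=> t; rewrite inE => /eqP->.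
    by rewrite big_seq1 /= v1 -[RHS]/(_ * _) mulr1.
  exists (\sum_(t <- s) t.1); rewrite scaler_suml big_seq [RHS]big_seq.
  by apply: eq_bigr => t /sX ->.
have ind a : a *: v = 0 -> a = 0.
  move=> av.
  apply: (@lift_indep _ _ _ res_surj _ _ _ _ _ L _ [:: tt] (fun=> v) _ (fun=> a) _ tt).
  - move=> b; rewrite big_seq1 v1 => b0 [] _.
    by move: b0; rewrite -[LHS]/(_ * _) mulr1.
  - by rewrite big_seq1.
  - by [].
have indB a b : a *: v = b *: v -> a = b.
  move=> ab; apply/eqP; rewrite -subr_eq0; apply/eqP/ind.
  by rewrite scalerBl ab subrr.
have [f fP] := choice (fun g => gen (srep_act g v)).
have f1 : f 1%g = 1 by apply: indB; rewrite -fP srep_act1 scale1r.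
have fM g h : f (g * h)%g = f g * f h.
  by apply: indB; rewrite -fP srep_actM fP srep_actZ fP scalerA mulrC.
have fs : exists2 K : set G, open_subgroup K & forall g, K g -> f g = 1.
  have [K oK Kv] := srep_smooth v; exists K => // g /Kv e.
  by apply: indB; rewrite -fP e scale1r.
pose s := SChar f1 fM fs.
have sr g : art_res A (s g) = chi g.
  have := lift_equiv L g v; rewrite fP (lift_scale L) v1 -[LHS]/(_ * _) mulr1 => ->.
  by rewrite /= mulr1.
exists (CharLift sr).
apply: (@lift_morph_iso _ _ _ res_surj _ _ _
  (lift_of_char res_surj (CharLift sr)) l (fun a : A^o => (a : A) *: v)).
- by move=> a x y; rewrite scalerDl -scalerA.
- by move=> g x; rewrite srep_actZ fP scalerA mulrC.
- move=> x; rewrite (lift_scale L) v1 -[LHS]/(_ * _) mulr1.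
  by [].
Qed.

(** The element psi 1 has residue 1, hence is a unit, and G acts on it through both characters. *)
Lemma lift_char_inj (A : artAlg res) (s s' : char_lift chi A) :
  lift_iso (lift_of_char res_surj s) (lift_of_char res_surj s') -> s = s'.
Proof.
case=> psi [pl _ pg pm]; apply: char_lift_ext => g.
have p1 : art_res A (psi (1 : A^o)) = 1.
  by have := pm (1 : A^o); rewrite /= /char_map => ->; rewrite rmorph1.
apply/eqP; rewrite -subr_eq0; apply/eqP.
apply: (@art_unit_eq0 _ _ _ res_surj _ (psi (1 : A^o))).
  by rewrite p1; apply/eqP; rewrite oner_eq0.
have := pg g (1 : A^o); rewrite /= mulr1 => e.
have pz : psi (s g *: (1 : A^o)) = s g *: psi (1 : A^o).
  have p0 : psi 0 = 0.
    by have := pl (-1) 0 0; rewrite scaler0 addr0 scaleN1r addNr.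
  by have := pl (s g) 1 0; rewrite p0 !addr0.
rewrite -[s g *: (1 : A^o)]/(s g * 1) mulr1 in pz.
by rewrite mulrBl -e pz subrr.
Qed.

Section Push.
Variables (A A' : artAlg res) (h : artHom A A') (s : char_lift chi A).

Fact push_char1 : h (s 1%g) = 1. Proof. by rewrite schar1 rmorph1. Qed.
Fact push_charM g g' : h (s (g * g')%g) = h (s g) * h (s g').
Proof. by rewrite scharM rmorphM. Qed.
Fact push_char_smooth : exists2 K : set G, open_subgroup K &
  forall g, K g -> h (s g) = 1.
Proof.
by have [K oK K1] := schar_smooth s; exists K => // g /K1 ->; rewrite rmorph1.
Qed.
Definition push_schar : schar G A' := SChar push_char1 push_charM push_char_smooth.
Fact push_char_res g : art_res A' (push_schar g) = chi g.
Proof. by rewrite /= art_hom_res // char_lift_res. Qed.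
Definition push_char : char_lift chi A' := CharLift push_char_res.

(** Naturality on the side of characters: base change along h is composition with h. *)
Lemma bc_char_iso : lift_iso (bc_lift res_surj h (lift_of_char res_surj s))
  (lift_of_char res_surj push_char).
Proof.
have bP : balanced h (fun (x : A') (v : char_rep s) => x * h v).
  split=> [x y v|x u v|x a v]; first by rewrite mulrDl.
    by rewrite rmorphD mulrDr.
  by rewrite -[a *: v]/(a * v) rmorphM mulrA.
pose F : tensor h (char_rep s) -> A'^o := 
  tens_lift h (fun (x : A') (v : char_rep s) => x * h v).
have FD : {morph F : x y / x + y} by move=> x y; exact: tens_liftD.
have Fp x v : F (pure h x v) = x * h v by exact: tens_lift_pure.
apply: (@lift_morph_iso _ _ _ res_surj _ _ _ (bc_lift res_surj h (lift_of_char res_surj s))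
  (lift_of_char res_surj push_char) F).
- move=> a x y; rewrite FD; congr (_ + _); move: x.
  apply: (tensor_ext (h := fun x => F (a *: x)) (h' := fun x => a *: F x)).
  + by move=> x z; rewrite scalerDr FD.
  + by move=> x z; rewrite FD scalerDr.
  + by move=> x v; rewrite scale_pure !Fp -mulrA.
- move=> g x; move: x.
  apply: (tensor_ext (h := fun x => F (bc_act g x)) (h' := fun x => h (s g) * F x)).
  + by move=> x z; rewrite bc_actD FD.
  + by move=> x z; rewrite FD mulrDr.
  + by move=> x v; rewrite bc_act_pure !Fp rmorphM mulrCA.
- suff H : (fun x => art_res A' (F x)) =1
      @bc_map _ _ _ _ _ _ _ h (lift_of_char res_surj s) by exact: H.
  apply: tensor_ext.
  + by move=> x z; rewrite FD rmorphD.
  + by move=> x z; exact: (@bc_mapD _ _ _ res_surj _ _ A A' h (lift_of_char res_surj s)).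
  + move=> x v; transitivity (art_res A' x * art_res A' (h v)).
      by rewrite Fp; exact: rmorphM.
    rewrite art_hom_res //; apply/esym.
    exact: (@bc_map_pure _ _ _ res_surj _ _ A A' h (lift_of_char res_surj s) x v).
Qed.
End Push.

End CharacterLifts.

(** * Locally constant functions of compact support on Q_p *)

Section PeriodicFunctions.
Variables (p : nat) (hp : prime p) (Qp : padicField p).
Local Notation q := (p ^ 2)%N.
Local Notation grid := (grid Qp).

(** One n bounds both the period and the support, so that [grid n] represents all the cosets that
    matter. *)
Definition bdper (R : nmodType) (n : nat) (h : Qp -> R) : Prop :=
  (forall a b, ball n%:Z b -> h (a + b) = h a) /\
  (forall a, ~~ ball (- n%:Z) a -> h a = 0).

Lemma bdper_le (R : nmodType) m n (h : Qp -> R) : (m <= n)%N -> bdper m h -> bdper n h.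
Proof.
move=> mn [h1 h2]; split=> [a b hb|a ha].
  by apply: h1; apply: ball_le hb; rewrite // lez_nat.
by apply: h2; apply: contra ha; apply: ball_le; rewrite // lerN2 lez_nat.
Qed.

Variable R : comNzRingType.
Implicit Types h : Qp -> R.

Lemma grid_out n (i : nat) a : ~~ ball (- n%:Z) a -> ball n%:Z (a - grid n i) = false.
Proof.
move=> ha; apply/negP => hn; case/negP: ha.
rewrite -(subrK (grid n i) a) ballD ?ball_grid //.
by apply: ball_le hn => //; lia.
Qed.

Lemma bdper_grid h n : bdper n h -> forall a,
  h a = \sum_(i < q ^ (n + n)) h (grid n i) * (ball n%:Z (a - grid n i))%:R.
Proof.
move=> [h1 h2] a; have [ha|ha] := boolP (ball (- n%:Z) a); last first.
  by rewrite h2 // big1 // => i _; rewrite grid_out // mulr0.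
have [i _ hi] := grid_ex hp ha.
rewrite (bigD1 i) //= hi mulr1 big1 ?addr0 => [|j ji].
  by rewrite -[a in LHS](subrKC (grid n i)) h1.
case: (boolP (ball _ _)) => [hj|]; last by rewrite mulr0.
case/eqP: ji; apply: val_inj.
apply: (@grid_uniq _ hp Qp _ _ _ (ltn_ord j) (ltn_ord i)).
by rewrite -(subrKA a) ballD // ballBC.
Qed.

Lemma bdper_ball n (r : Qp) : ball (- n%:Z) r ->
  bdper n (fun a => (ball n%:Z (a - r))%:R : R).
Proof.
move=> rn; split=> [a b hb|a ha]; first by rewrite addrAC (ballDr _ hb).
rewrite (_ : ball _ _ = false) //; apply/negP => hn; case/negP: ha.
by rewrite -(subrK r a) ballD //; apply: ball_le hn => //; lia.
Qed.

(* The indices (n, i) such that the ball of radius q^-n around grid n i is not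
   centred at a point of the previous grid: the corresponding characteristic
   functions form a basis (van der Put). *)
Definition newgrid (x : nat * nat) : bool :=
  (x.2 < q ^ (x.1 + x.1))%N &&
  ((x.1 == 0%N) || ~~ ((q %| x.2) && (x.2 %/ q < q ^ (x.1.-1 + x.1.-1))))%N.

Definition vdp := {x : nat * nat | newgrid x}.
HB.instance Definition _ := Choice.on vdp.

Definition vdpf (x : vdp) (a : Qp) : R :=
  (ball (val x).1%:Z (a - grid (val x).1 (val x).2))%:R.

Definition vdp_spanned (h : Qp -> R) : Prop :=
  exists s : seq (R * vdp), forall a, h a = \sum_(t <- s) t.1 * vdpf t.2 a.

Lemma vdp_spannedD h h' : vdp_spanned h -> vdp_spanned h' ->
  vdp_spanned (fun a => h a + h' a).
Proof.
by move=> [s hs] [s' hs']; exists (s ++ s') => a; rewrite big_cat hs hs'.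
Qed.

Lemma vdp_spannedZ r h : vdp_spanned h -> vdp_spanned (fun a => r * h a).
Proof.
move=> [s hs]; exists [seq (r * t.1, t.2) | t <- s] => a.
by rewrite big_map hs mulr_sumr; apply: eq_bigr => t _; rewrite mulrA.
Qed.

Lemma vdp_spanned_sum (I : Type) (s : seq I) (P : pred I) (F : I -> Qp -> R) :
  (forall i, P i -> vdp_spanned (F i)) ->
  vdp_spanned (fun a => \sum_(i <- s | P i) F i a).
Proof.
move=> hF; elim: s => [|i s IHs].
  by exists [::] => a; rewrite !big_nil.
have [Pi|Pi] := boolP (P i).
  have [r rE] := vdp_spannedD (hF i Pi) IHs.
  by exists r => a; rewrite big_cons Pi rE.
by have [r rE] := IHs; exists r => a; rewrite big_cons (negbTE Pi) rE.
Qed.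

(** If (n.+1, i) is not new, its ball is the larger ball with the same centre, given by induction,
    minus the other small balls inside it; these are all new, since the larger ball contains only
    one point of the previous grid. *)
Lemma vdp_spanned_ball n (i : nat) : (i < q ^ (n + n))%N ->
  vdp_spanned (fun a => (ball n%:Z (a - grid n i))%:R).
Proof.
have new m j : newgrid (m, j) -> vdp_spanned (fun a => (ball m%:Z (a - grid m j))%:R).
  by move=> H; exists [:: (1, exist _ (m, j) H)] => a; rewrite big_seq1 mul1r.
have q0 : (0 < q)%N by rewrite expn_gt0 prime_gt0.
elim: n i => [|n IHn] i hi; first by apply: new; rewrite /newgrid /= hi.
have [H|] := boolP (newgrid (n.+1, i)); first exact: new.
rewrite /newgrid /= hi /= negbK => /andP[/dvdnP[j ij]].
rewrite ij mulnK // mulnC => jn; rewrite -gridS //.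
have gp : bdper n.+1 (fun a => (ball n%:Z (a - grid n j))%:R : R).
  exact: bdper_le (leqnSn n) (bdper_ball (ball_grid hp Qp n j)).
have qjn : (q * j < q ^ (n.+1 + n.+1))%N by rewrite mulnC -ij.
pose i0 := Ordinal qjn.
pose rest a : R := \sum_(i' < q ^ (n.+1 + n.+1) | i' != i0)
   (ball n%:Z (grid n.+1 i' - grid n j))%:R * (ball n.+1%:Z (a - grid n.+1 i'))%:R.
have rest_sp : vdp_spanned rest.
  apply: vdp_spanned_sum => i' ne.
  have [close|far] := boolP (ball n%:Z (grid n.+1 i' - grid n j)); last first.
    by exists [::] => a; rewrite big_nil mul0r.
  apply: vdp_spannedZ; apply: new; rewrite /newgrid /= ltn_ord /=.
  apply/negP => /andP[/dvdnP[j' ij']]; rewrite ij' mulnK // => j'n.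
  case/eqP: ne; apply: val_inj; rewrite /= ij' mulnC; congr (_ * _)%N.
  apply: (@grid_uniq _ hp Qp n) => //.
  by rewrite gridS // mulnC -ij'.
have [s sE] := vdp_spannedD (IHn j jn) (vdp_spannedZ (-1) rest_sp).
exists s => a; rewrite -sE (bdper_grid gp a) (bigD1 i0) //= -/(rest a) -gridS //.
by rewrite subrr ball0 // mul1r mulN1r addrK.
Qed.

Lemma grid_shift n m i : grid n i = grid (n + m) (q ^ m * i).
Proof.
by elim: m => [|m IHm]; rewrite ?addn0 ?mul1n // addnS IHm gridS // mulnA -expnS.
Qed.

(** The centre of x also belongs to the finer grid of y, hence is the centre of y; as y is new, its
    centre cannot come from an earlier grid, so the levels agree. *)
Lemma vdpf_eq1 (x y : vdp) : ((val x).1 <= (val y).1)%N ->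
  ball (val y).1%:Z (grid (val x).1 (val x).2 - grid (val y).1 (val y).2) -> x = y.
Proof.
case: x y => [[n i] /= hx] [[m j] /= hy] nm /=.
have q0 : (0 < q)%N by rewrite expn_gt0 prime_gt0.
have qX d : (0 < q ^ d)%N by rewrite !expn_gt0 prime_gt0.
move: (m - n)%N (subnKC nm) => d md {nm}; subst m.
rewrite (grid_shift n d i) => hb.
have [/= hi _] := andP hx; have [/= hj hnew] := andP hy.
have hi' : (q ^ d * i < q ^ (n + d + (n + d)))%N.
  rewrite addnACA [X in (_ < X)%N]expnD mulnC.
  apply: (@leq_trans (q ^ (n + n) * q ^ d)%N); first by rewrite ltn_pmul2r.
  by rewrite leq_mul2l leq_exp2l ?leq_addr ?orbT // (ltn_exp2l 0) ?prime_gt1.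
have ij := grid_uniq hp hi' hj hb.
case: d => [|d] in ij hi' hj hnew hb hy *.
  apply: val_inj => /=; rewrite addn0 -ij mul1n; congr (_, _).
exfalso; move: hnew; rewrite addnS /= -ij (expnS q d) -mulnA dvdn_mulr // mulKn //= => /negP[].
rewrite addnACA [X in (_ < X)%N]expnD mulnC.
apply: (@leq_trans (q ^ (n + n) * q ^ d)%N); first by rewrite ltn_pmul2r.
by rewrite leq_mul2l leq_exp2l ?leq_addr ?orbT // (ltn_exp2l 0) ?prime_gt1.
Qed.

(** Triangularity: at the centre of x, the functions of level at least that of x vanish except
    [vdpf x] ([vdpf_eq1]), and the lower levels are removed by induction. *)
Lemma vdp_indep (s : seq vdp) (a : vdp -> R) : uniq s ->
  (forall b, \sum_(x <- s) a x * vdpf x b = 0) -> forall x, x \in s -> a x = 0.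
Proof.
move=> us s0 x; have [n] := ubnP (val x).1; elim: n x => // n IHn x.
rewrite ltnS => xn xs; have := s0 (grid (val x).1 (val x).2).
rewrite (bigD1_seq x) //= {1}/vdpf subrr ball0 // mulr1 big1_seq ?addr0 // => y.
case/andP=> yx ys; case: (ltnP (val y).1 (val x).1) => [yltx|xley].
  by rewrite IHn ?mul0r // (leq_trans yltx).
rewrite /vdpf; case: (boolP (ball _ _)) => [hb|]; last by rewrite mulr0.
by case/eqP: yx; apply/esym/vdpf_eq1.
Qed.

Section Basis.
Variables (V : lmodType R) (ev : V -> Qp -> R) (u u' : R) (X : vdp -> V).
Hypothesis evD : forall v v' a, ev (v + v') a = ev v a + ev v' a.
Hypothesis evZ : forall r v a, ev (r *: v) a = r * ev v a.
Hypothesis ev_inj : forall v v', ev v =1 ev v' -> v = v'.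
Hypothesis ev_bd : forall v, exists n, bdper n (ev v).
Hypothesis uu' : u * u' = 1.
Hypothesis evX : forall x a, ev (X x) a = u * vdpf x a.

Let ev_sum (I : Type) (s : seq I) (F : I -> V) a :
  ev (\sum_(i <- s) F i) a = \sum_(i <- s) ev (F i) a.
Proof.
have ev0 : ev 0 a = 0 by have := evZ 0 0 a; rewrite scaler0 mul0r.
exact: (big_morph (ev^~ a) (fun x y => evD x y a) ev0).
Qed.

(** The unit u makes room for the factor chi w of [ev_St_map] when the basis is reduced to k. *)
Lemma vdp_basis_span v : exists s : seq (R * vdp), v = \sum_(t <- s) t.1 *: X t.2.
Proof.
have [n bn] := ev_bd v.
have [s sE] : vdp_spanned (fun a => u' * ev v a).
  apply: vdp_spannedZ.
  have [s sE] : vdp_spanned (fun a => \sum_(i < q ^ (n + n))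
      ev v (grid n i) * (ball n%:Z (a - grid n i))%:R).
    by apply: vdp_spanned_sum => i _; apply/vdp_spannedZ/vdp_spanned_ball.
  by exists s => a; rewrite (bdper_grid bn) sE.
exists s; apply: ev_inj => a; rewrite ev_sum.
under eq_bigr do rewrite evZ evX mulrCA.
by rewrite -mulr_sumr -sE mulrA uu' mul1r.
Qed.

Lemma vdp_basis_indep (s : seq vdp) (a : vdp -> R) : uniq s ->
  \sum_(x <- s) a x *: X x = 0 -> forall x, x \in s -> a x = 0.
Proof.
move=> us s0; apply: (vdp_indep us) => b.
have ev0 : ev 0 b = 0 by have := evZ 0 0 b; rewrite scaler0 mul0r.
have := congr1 (fun v => u' * ev v b) s0; rewrite /= ev0 mulr0 ev_sum => s0'.
rewrite -[RHS]s0' mulr_sumr; apply: eq_bigr => x _.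
by rewrite evZ evX -[LHS]mul1r -uu'; ring.
Qed.

End Basis.

End PeriodicFunctions.

(** * The Steinberg representation as functions on Q_p *)

Section SteinbergModel.
Variables (p : nat) (hp : prime p) (Qp : padicField p) (L : fieldExtType Qp).
Variable c : {lrmorphism L -> L}.
Variables (e : L) (e0 : e != 0) (ce : c e = - e).
Hypothesis dec : forall y : L, exists a b : Qp, y = a%:A + b *: e.
Local Notation G := (U11 c).
Local Notation nrm := (nrm hp ce dec).
Local Notation up := (up c e).
Local Notation tor := (tor c).
Local Notation w := (w c).
Local Notation lo := (lo c e).
Local Notation q := (p ^ 2)%N.
Local Notation grid := (grid Qp).
Local Notation tor1 := (tor1 ce dec).
Local Notation torM := (torM ce dec).
Local Notation w_tor := (w_tor ce dec).
Local Notation tor_torus := (tor_torus ce dec).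
Local Notation up_unipotent := (up_unipotent ce).
Local Notation bigcell_dec := (bigcell_dec hp ce dec).
Local Notation borel_dec := (borel_dec hp ce dec).
Local Notation w_up := (w_up hp e0 ce dec).

Lemma p_neq0 : (p%:R : L) != 0.
Proof. by rewrite padic_natr_neq0 ?prime_gt0. Qed.

Lemma pX_neq0 n : (p%:R : L) ^+ n != 0.
Proof. by rewrite expf_neq0 ?p_neq0. Qed.

Lemma nrm_pX n : nrm (p%:R ^+ n) = q%:R ^+ n.
Proof. by elim: n => [|n IHn]; rewrite ?nrm1 // !exprS nrmM IHn nrm_p. Qed.

Lemma up_tor x b : x != 0 -> (up b * tor x = tor x * up ((nrm x)^-1 * b))%g.
Proof. by move=> x0; rewrite tor_up // mulVKf // nrm_neq0. Qed.

Lemma ball_inv (n : nat) (a : Qp) : ~~ ball (- n%:Z) a -> ball n%:Z a^-1.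
Proof.
rewrite /ball opprK -ltNge => ha.
have qn0 : 0 < (q%:R : rat) ^ n%:Z by rewrite exprz_gt0 ?qQ_gt0.
rewrite padic_normV -invr_expz lef_pV2 ?ltW ?qualifE //=.
exact: lt_trans ha.
Qed.

Lemma schar_up (R : comNzRingType) (s : schar G R) a : s (up a) = 1.
Proof. exact: (schar_unipotent hp s (up_unipotent a)). Qed.

Lemma schar_w2 (R : comNzRingType) (s : schar G R) : s w * s w = 1.
Proof. by rewrite -scharM w2 schar1. Qed.

Lemma schar_wtor (R : comNzRingType) (s : schar G R) x : x != 0 ->
  s (tor (c x)^-1) = s (tor x).
Proof.
move=> x0; have /(congr1 s) := w_tor x0; rewrite !scharM mulrC => E.
by rewrite -[LHS]mulr1 -(schar_w2 s) mulrA -E -mulrA schar_w2 mulr1.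
Qed.

Section Eval.
Variables (A : comNzRingType) (s : schar G A).
Local Notation St := (St_rep hp s).

Lemma ind_left (f : ind s) x b g : x != 0 ->
  f (tor x * up b * g)%g = s (tor x) * f g.
Proof.
move=> x0; have /ind_predP[fB _] := indP f; apply: fB.
  exact: tor_torus.
exact: up_unipotent.
Qed.

Lemma ind_borel (f : ind s) x b : x != 0 -> f (tor x * up b)%g = s (tor x) * f 1%g.
Proof. by move=> x0; rewrite -[(_ * up b)%g]mulg1 ind_left. Qed.

Lemma ind_up (f : ind s) b g : f (up b * g)%g = f g.
Proof.
by have := ind_left f b g (oner_neq0 L); rewrite tor1 // mul1g schar1 mul1r.
Qed.

Lemma ind_tor (f : ind s) x g : x != 0 -> f (tor x * g)%g = s (tor x) * f g.
Proof. by move=> x0; have := ind_left f 0 g x0; rewrite up0 // mulg1. Qed.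

Lemma ind_ext (f f' : ind s) : f 1%g = f' 1%g ->
  (forall a, f (w * up a)%g = f' (w * up a)%g) -> f = f'.
Proof.
move=> f1 fw; apply: val_inj; apply/funext => g /=.
have [g0|g0] := eqVneq (g10 g) 0.
  by have [x [b [x0 ->]]] := borel_dec g0; rewrite !ind_borel // f1.
have [b ->] := bigcell_dec g0.
have x0 : (c (g10 g))^-1 != 0 by rewrite invr_eq0 conj_eq0.
by rewrite -[(_ * w * _)%g]mulgA !ind_left // fw.
Qed.

(* Subtracting the multiple of s that agrees with f at 1 makes f vanish near the
   Borel subgroup; this identifies St(s) with the locally constant functions of
   compact support on Q_p. *)
Definition ev_ind (f : ind s) (a : Qp) : A := f (w * up a)%g - f 1%g * s w.

Definition ev (x : St) (a : Qp) : A := ev_ind (mrepr x) a.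

Lemma ev_indD f f' a : ev_ind (f + f') a = ev_ind f a + ev_ind f' a.
Proof.
rewrite /ev_ind -![(f + f') _]/(f _ + f' _) mulrDl opprD addrACA.
by [].
Qed.

Lemma ev_indB f f' a : ev_ind (f - f') a = ev_ind f a - ev_ind f' a.
Proof.
rewrite /ev_ind -![(f - f') _]/(f _ - f' _).
by ring.
Qed.

Lemma ev_class f a : ev (St_class hp f) a = ev_ind f a.
Proof.
rewrite /ev; have [r hr] := quotient_repr (char_line_sub hp s) f.
apply/eqP; rewrite -subr_eq0 -ev_indB /ev_ind !hr !scharM schar_up schar1.
by apply/eqP; ring.
Qed.

Lemma St_W (P : St -> Prop) : (forall f, P (St_class hp f)) -> forall x, P x.
Proof. exact: (mqW (M := quotient_pre (char_line_sub hp s))). Qed.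

Lemma St_classD (f f' : ind s) : St_class hp (f + f') = St_class hp f + St_class hp f'.
Proof. exact: (mqD (M := quotient_pre (char_line_sub hp s))). Qed.

Lemma St_classZ r (f : ind s) : St_class hp (r *: f) = r *: St_class hp f.
Proof. exact: (mqZ (M := quotient_pre (char_line_sub hp s))). Qed.

Lemma St_class_act g (f : ind s) :
  srep_act g (St_class hp f) = St_class hp (ind_act hp g f).
Proof. exact: (quot_act_class (char_line_sub hp s) (@char_line_act _ hp _ _ _ _ s)). Qed.

Lemma evD x y a : ev (x + y) a = ev x a + ev y a.
Proof.
elim/St_W: x => f; elim/St_W: y => f'.
by rewrite -St_classD !ev_class ev_indD.
Qed.

Lemma evZ r x a : ev (r *: x) a = r * ev x a.
Proof.
elim/St_W: x => f; rewrite -St_classZ !ev_class /ev_ind -![(r *: f) _]/(r * f _).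
by ring.
Qed.

Lemma ev_up b x a : ev (srep_act (up b) x) a = ev x (a + b).
Proof.
elim/St_W: x => f; rewrite St_class_act !ev_class /ev_ind /= mul1g -mulgA -upD //.
by rewrite -[up b]mulg1 ind_up.
Qed.

Lemma ev_tor y x a : y != 0 ->
  ev (srep_act (tor y) x) a = s (tor y) * ev x ((nrm y)^-1 * a).
Proof.
move=> y0; elim/St_W: x => f; rewrite St_class_act !ev_class /ev_ind /= mul1g.
rewrite -mulgA up_tor // !mulgA w_tor // -!mulgA ind_tor ?invr_eq0 ?conj_eq0 //.
have -> : f (tor y) = s (tor y) * f 1%g by have := ind_tor f 1%g y0; rewrite mulg1.
by rewrite schar_wtor //; ring.
Qed.

Lemma ev_inj x y : ev x =1 ev y -> x = y.
Proof.
elim/St_W: x => f; elim/St_W: y => f' E.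
apply/quotient_classP; exists (f 1%g - f' 1%g).
have cf := char_fun_ind hp s (f 1%g - f' 1%g).
suff -> : f - f' = Ind cf by [].
apply: ind_ext; rewrite /= ?schar1 ?mulr1 // => a.
rewrite -[LHS]/(f _ - f' _) scharM schar_up mulr1.
have := E a; rewrite !ev_class /ev_ind => /eqP; rewrite subr_eq => /eqP ->.
by ring.
Qed.

(** For a far from 0, [w_up] gives f (w u_a) = s(torus part) f(1), because the lower unipotent
    factor fixes f. The same relation evaluated by s shows that the torus part has value s w, so
    both terms of [ev_ind] cancel. *)
Lemma ind_bound (f : ind s) : exists n, bdper n (ev_ind f).
Proof.
have /ind_predP[_ [K oK fK]] := indP f; have [K' oK' sK] := schar_smooth s.
have [m mK] := open_subgroup_cong (open_subgroupI oK oK').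
have [n1 h1] := up_cong hp ce m; have [n2 h2] := lo_cong hp ce m.
have [n3 h3] := ball_ex hp (- (nrm e)^-1).
(* n1 controls the period and n2 + n3 the support; n3 absorbs the constant N(e) in [inv_up]. *)
exists (maxn n1 (n2 + n3)); split=> [a b hb|a ha].
  rewrite /ev_ind upD // (mulgA w) (fK _ (up b)) //.
  have [] // := mK (up b); apply: h1; apply: ball_le hb => //.
  by rewrite lez_nat leq_maxl.
have a0 : a != 0 by apply: contraNneq ha => ->.
have hb : ball n2%:Z (inv_up hp ce dec a).
  rewrite /inv_up invfM -mulrN (_ : n2%:Z = (n2 + n3)%N%:Z + - n3%:Z); last by lia.
  apply: ballM => //; apply: ball_le (ball_inv ha) => //.
  by rewrite lez_nat leq_maxr.
have [Kl K'l] := mK _ (h2 _ hb).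
have x0 : - (a *: e)^-1 != 0 by rewrite oppr_eq0 invr_eq0 scaler_eq0 negb_or a0.
rewrite /ev_ind; have := congr1 s (w_up a0).
rewrite scharM schar_up mulr1 scharM (sK _ K'l) mulr1 scharM schar_up mul1r => ->.
rewrite w_up // -mulgA ind_up ind_tor // -[lo _]mul1g fK //.
by rewrite mulrC subrr.
Qed.

Lemma ev_bd x : exists n, bdper n (ev x).
Proof.
elim/St_W: x => f; have [n [h1 h2]] := ind_bound f; exists n; split=> [a b|a] h.
  by rewrite !ev_class h1.
by rewrite ev_class h2.
Qed.

Let tau x := s (tor x).
Let tauM x y : x != 0 -> y != 0 -> tau (x * y) = tau x * tau y.
Proof. by move=> x0 y0; rewrite /tau torM // scharM. Qed.
Let tau1 : tau 1 = 1. Proof. by rewrite /tau tor1 // schar1. Qed.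

Lemma cell_ind : (cell e tau : G -> A) \in ind_pred s.
Proof.
apply/ind_predP; split=> [t u g /(torus_tor ce dec)[x x0 ->] /(unipotent_up hp ce dec)[b ->]|].
  by rewrite (cell_left hp e0 ce dec tauM) //; congr (_ * _); exact: schar_wtor.
apply: (cell_smooth hp e0 ce dec tauM).
have [K oK sK] := schar_smooth s; have [m mK] := open_subgroup_cong oK.
exists m.+1 => x xm; apply: sK; apply: mK.
by move=> i j; apply: pint_le (tor_cong hp ce dec xm i j).
Qed.

Definition stcell : ind s := Ind cell_ind.
Definition stbase : St := St_class hp stcell.

Lemma ev_base a : ev stbase a = (ball 0 a)%:R.
Proof.
have c1 : stcell 1%g = 0 by exact: cell1.
have cw : stcell (w * up a)%g = (ball 0 a)%:R by exact: (cell_w hp e0 ce dec tau1).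
by rewrite ev_class /ev_ind c1 cw mul0r subr0.
Qed.

(** The scalar cancels the value of s produced by the torus translation, so that evaluation gives a
    plain characteristic function. *)
Definition stball (n : nat) (r : Qp) : St :=
  s (tor (p%:R ^+ n))^-1%g *: srep_act (up (- r)) (srep_act (tor (p%:R ^+ n)) stbase).

Lemma ev_ball n r a : ev (stball n r) a = (ball n%:Z (a - r))%:R.
Proof.
rewrite evZ ev_up ev_tor ?pX_neq0 // ev_base mulrA [X in X * _]mulrC scharV mul1r.
by rewrite nrm_pX exprnN ballMq // sub0r opprK.
Qed.

Lemma ev_surj h n : bdper n h -> exists x, ev x =1 h.
Proof.
move=> hn; exists (\sum_(i < q ^ (n + n)) h (grid n i) *: stball n (grid n i)) => a.
have ev0 : ev 0 a = 0 by have := evZ 0 0 a; rewrite scaler0 mul0r.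
rewrite (big_morph (ev^~ a) (fun x y => evD x y a) ev0) (bdper_grid hp hn a).
by apply: eq_bigr => i _; rewrite evZ ev_ball.
Qed.

End Eval.

Section IsLift.
Variables (O : comNzRingType) (k : fieldType) (res : {rmorphism O -> k}).
Hypothesis res_surj : forall y, exists x, res x = y.
Variables (chi : schar G k) (A : artAlg res) (s : char_lift chi A).

(** [St_map] multiplies by the inverse of chi, whose value at w u_a is chi w because chi is trivial
    on U and chi(w)^2 = 1. *)
Lemma ev_St_map x a :
  ev (s := triv_char G k) (St_map hp s x) a = chi w * art_res A (ev x a).
Proof.
elim/(St_W (s := s)): x => f; rewrite St_map_class !ev_class /ev_ind /= invg1 schar1.
rewrite invgM wV // scharM upV // schar_up mul1r !rmorphB !rmorphM char_lift_res.
by rewrite !mulr1 mul1r mulrBr mulrCA schar_w2 mulr1.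
Qed.

(** The van der Put indices do not depend on the ring: the vectors [stball] they define are a basis
    over A, and by [ev_St_map] their images are a basis over k up to the unit chi w. *)
Lemma St_map_is_lift : is_lift (St_map hp s).
Proof.
pose X (x : vdp p) : St_rep hp s := stball s (val x).1 (grid (val x).1 (val x).2).
have pD u v : St_map hp s (u + v) = St_map hp s u + St_map hp s v.
  apply: ev_inj => a; rewrite evD !ev_St_map evD rmorphD mulrDr.
  by [].
have pZ a v : St_map hp s (a *: v) = art_res A a *: St_map hp s v.
  apply: ev_inj => b; rewrite evZ !ev_St_map evZ rmorphM mulrCA.
  by [].
apply: (is_lift_basis res_surj (e := X)) => //.
- exact: St_map_act.
- apply: (vdp_basis_span hp (ev := @ev A s) (u := 1) (u' := 1)) => //.
  + exact: evD.
  + exact: evZ.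
  + exact: ev_inj.
  + exact: ev_bd.
  + by rewrite mulr1.
  + by move=> x a; rewrite ev_ball mul1r.
- apply: (vdp_basis_indep hp (ev := @ev A s) (u := 1) (u' := 1)) => //.
  + exact: evD.
  + exact: evZ.
  + by rewrite mulr1.
  + by move=> x a; rewrite ev_ball mul1r.
- apply: (@vdp_basis_span _ hp Qp k (steinberg hp c k) (@ev k (triv_char G k))
    (chi w) (chi w) (fun x => St_map hp s (X x))) => //.
  + exact: evD.
  + exact: evZ.
  + exact: ev_inj.
  + exact: ev_bd.
  + exact: schar_w2.
  + by move=> x a; rewrite ev_St_map ev_ball rmorph_nat.
- apply: (@vdp_basis_indep _ hp Qp k (steinberg hp c k) (@ev k (triv_char G k))
    (chi w) (chi w) (fun x => St_map hp s (X x))) => //.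
  + exact: evD.
  + exact: evZ.
  + exact: schar_w2.
  + by move=> x a; rewrite ev_St_map ev_ball rmorph_nat.
Qed.

End IsLift.

End SteinbergModel.

(** * Base change of Steinberg representations *)

Section PushSteinberg.
Variables (p : nat) (hp : prime p) (Qp : padicField p) (L : fieldExtType Qp).
Variable c : {lrmorphism L -> L}.
Variables (e : L) (e0 : e != 0) (ce : c e = - e).
Hypothesis dec : forall y : L, exists a b : Qp, y = a%:A + b *: e.
Local Notation G := (U11 c).
Variables (O : comNzRingType) (k : fieldType) (res : {rmorphism O -> k}).
Hypothesis res_surj : forall y, exists x, res x = y.
Variables (chi : schar G k) (A A' : artAlg res) (h : artHom A A') (s : char_lift chi A).
Local Notation s' := (push_char res_surj h s).
Local Notation ev := (ev e).

Fact ind_push_subproof (f : ind s) : (fun g => h (f g)) \in ind_pred s'.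
Proof.
case: f => f /= /ind_predP[fB [K oK fK]]; apply/ind_predP; split.
  by move=> t u g tt uu; rewrite fB // rmorphM.
by exists K => // g g' /fK ->.
Qed.
Definition ind_push (f : ind s) : ind s' := Ind (ind_push_subproof f).

Definition St_push (x : St_rep hp s) : St_rep hp s' := St_class hp (ind_push (mrepr x)).

Lemma ev_St_push x a : ev (St_push x) a = h (ev x a).
Proof. by rewrite ev_class // /ev_ind /= -rmorphM -rmorphB. Qed.

Lemma St_push_class f : St_push (St_class hp f) = St_class hp (ind_push f).
Proof.
apply: (ev_inj ce dec) => a; rewrite ev_St_push !ev_class // /ev_ind /=.
by rewrite rmorphB rmorphM.
Qed.

Lemma St_push_act g x : St_push (srep_act g x) = srep_act g (St_push x).
Proof.
elim/St_W: x => f; rewrite St_class_act !St_push_class St_class_act.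
by congr St_class; apply: val_inj.
Qed.

(** Naturality on the Steinberg side. By [lift_morph_iso] it is enough to build the map F, with no
    inverse. *)
Lemma bc_St_iso (H : is_lift (St_map hp s)) (H' : is_lift (St_map hp s')) :
  lift_iso (bc_lift res_surj h (Lift H)) (Lift H').
Proof.
have StD u v : St_push (u + v) = St_push u + St_push v.
  apply: (ev_inj ce dec) => a; rewrite evD // !ev_St_push evD // rmorphD.
  by [].
have StZ r v : St_push (r *: v) = h r *: St_push v.
  apply: (ev_inj ce dec) => a; rewrite evZ // !ev_St_push evZ // rmorphM.
  by [].
have bP : balanced h (fun (x : A') (v : St_rep hp s) => x *: St_push v).
  split=> [x y v|x u v|x r v]; first by rewrite scalerDl.
    by rewrite StD scalerDr.
  by rewrite StZ scalerA.
pose F : tensor h (St_rep hp s) -> St_rep hp s' :=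
  tens_lift h (fun (x : A') (v : St_rep hp s) => x *: St_push v).
have FD : {morph F : x y / x + y} by move=> x y; exact: tens_liftD.
have Fp x v : F (pure h x v) = x *: St_push v by exact: tens_lift_pure.
have FZ r x : F (r *: x) = r *: F x.
  move: x; apply: (tensor_ext (h := fun x => F (r *: x)) (h' := fun x => r *: F x)).
  + by move=> x z; rewrite scalerDr FD.
  + by move=> x z; rewrite FD scalerDr.
  + by move=> x v; rewrite scale_pure !Fp scalerA.
apply: (@lift_morph_iso _ _ _ res_surj _ _ _ (bc_lift res_surj h (Lift H)) (Lift H') F).
- by move=> r x y; rewrite FD FZ.
- move=> g x; move: x.
  apply: (tensor_ext (h := fun x => F (bc_act g x)) (h' := fun x => srep_act g (F x))).
  + by move=> x z; rewrite bc_actD FD.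
  + by move=> x z; rewrite FD srep_actD.
  + by move=> x v; rewrite bc_act_pure !Fp St_push_act srep_actZ.
- suff E : (fun x => St_map hp s' (F x)) =1 @bc_map _ _ _ _ _ _ _ h (Lift H) by exact: E.
  apply: tensor_ext.
  + by move=> x z; rewrite FD (lift_add H').
  + by move=> x z; exact: (@bc_mapD _ _ _ res_surj _ _ A A' h (Lift H)).
  + move=> x v.
    transitivity (art_res A' x *: (St_map hp s v : twist_rep chi (steinberg hp c k))).
      rewrite Fp (lift_scale H'); congr (_ *: _); apply: (ev_inj ce dec) => a.
      by rewrite !(ev_St_map ce) ev_St_push art_hom_res.
    apply/esym; exact: (@bc_map_pure _ _ _ res_surj _ _ A A' h (Lift H) x v).
Qed.

End PushSteinberg.

(** * The operator attached to t on U_0-fixed vectors *)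

Section Hecke.
Variables (p : nat) (hp : prime p) (Qp : padicField p) (L : fieldExtType Qp).
Variable c : {lrmorphism L -> L}.
Variables (e : L) (e0 : e != 0) (ce : c e = - e).
Hypothesis dec : forall y : L, exists a b : Qp, y = a%:A + b *: e.
Local Notation G := (U11 c).
Local Notation nrm := (nrm hp ce dec).
Local Notation up := (up c e).
Local Notation tor := (tor c).
Local Notation q := (p ^ 2)%N.
Local Notation t := (tor p%:R).
Local Notation p_neq0 := (p_neq0 hp L).
Local Notation torM := (torM ce dec).

Lemma ball_hecke (R : nzRingType) (a : Qp) :
  \sum_(i < q ^ 1) (ball 0 (q%:R^-1 * (a + i%:R)))%:R = (ball 0 a)%:R :> R.
Proof.
have bq i : ball 0 (q%:R^-1 * (a + i)) = ball 1 (a + i).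
  by rewrite -[X in X^-1]expr1z invr_expz ballMq // opprK.
under eq_bigr do rewrite bq.
have [b0|b0] := boolP (ball 0 a); last first.
  rewrite big1 // => i _; case: (boolP (ball 1 _)) => // /(ball_le hp (ler01)).
  by rewrite ballDr ?(negbTE b0) // ball_natr.
have [i _ hi] := rep_ex hp 1 (etrans (ballN 0 a) b0).
have hi' : ball 1 (a + i%:R) by rewrite -ballN opprD.
rewrite (bigD1 i) //= hi' big1 ?addr0 // => j ji.
case: (boolP (ball 1 _)) => // hj; case/eqP: ji; apply: val_inj.
apply: (@rep_uniq _ hp Qp 1 _ _ (ltn_ord j) (ltn_ord i)).
by have := ballB hj hi'; rewrite opprD addrACA subrr add0r.
Qed.

Section Operator.
Variables (R : comNzRingType) (V : srep G R).

Definition ufixed (x : V) : Prop := forall b, ball 0 b -> srep_act (up b) x = x.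

(** The u_i with i < q represent U_0 / t U_0 t^-1, so this is the U_p operator of ordinary theory.
    The form [q ^ 1] matches [rep_ex] and [sum_reps]. *)
Definition hecke (x : V) : V := \sum_(i < q ^ 1) srep_act (up i%:R) (srep_act t x).

Lemma heckeD x y : hecke (x + y) = hecke x + hecke y.
Proof. by rewrite -big_split; apply: eq_bigr => i _; rewrite !srep_actD. Qed.

Lemma heckeZ r x : hecke (r *: x) = r *: hecke x.
Proof. by rewrite scaler_sumr; apply: eq_bigr => i _; rewrite !srep_actZ. Qed.

Lemma hecke_iterD n x y : iter n hecke (x + y) = iter n hecke x + iter n hecke y.
Proof. by elim: n => [|n IHn] //=; rewrite IHn heckeD. Qed.

Lemma hecke_iterZ n r x : iter n hecke (r *: x) = r *: iter n hecke x.
Proof. by elim: n => [|n IHn] //=; rewrite IHn heckeZ. Qed.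

Lemma act_upD a b (x : V) : srep_act (up (a + b)) x = srep_act (up a) (srep_act (up b) x).
Proof. by rewrite upD // srep_actM. Qed.

Lemma act_tor_up y a (x : V) : y != 0 ->
  srep_act (tor y) (srep_act (up a) x) = srep_act (up (nrm y * a)) (srep_act (tor y) x).
Proof. by move=> y0; rewrite -!srep_actM (tor_up hp ce dec). Qed.

Lemma act_torM y z (x : V) : y != 0 -> z != 0 ->
  srep_act (tor y) (srep_act (tor z) x) = srep_act (tor (y * z)) x.
Proof. by move=> y0 z0; rewrite -srep_actM torM. Qed.

Lemma hecke_up r x : hecke (srep_act (up r) x) = srep_act (up (q%:R * r)) (hecke x).
Proof.
rewrite srep_act_sum; apply: eq_bigr => i _.
by rewrite act_tor_up ?p_neq0 // -!act_upD addrC nrm_p.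
Qed.

Lemma hecke_iter_up n r x :
  iter n hecke (srep_act (up r) x) = srep_act (up (q%:R ^+ n * r)) (iter n hecke x).
Proof.
elim: n => [|n IHn]; first by rewrite mul1r.
by rewrite /= IHn hecke_up mulrA -exprS.
Qed.

Let per x : ufixed x -> forall a b, ball 0 a -> ball 1%N%:Z b ->
  srep_act (up (a + b)) (srep_act t x) = srep_act (up a) (srep_act t x).
Proof.
move=> fx a b _ hb; rewrite act_upD; congr srep_act.
have -> : b = nrm p%:R * (q%:R^-1 * b).
  by rewrite nrm_p mulVKf // qQp_neq0.
by rewrite -act_tor_up ?p_neq0 // fx // -[X in X^-1]expr1z invr_expz ballMq.
Qed.

(** Translation by an element of Z_p permutes the residues modulo q, and t x is fixed by U_1. *)
Lemma hecke_fixed x : ufixed x -> ufixed (hecke x).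
Proof.
move=> fx b hb; rewrite srep_act_sum.
transitivity (\sum_(i < q ^ 1) srep_act (up (b + i%:R)) (srep_act t x)).
  by apply: eq_bigr => i _; rewrite act_upD.
apply: (sum_reps hp (per fx) (psi := fun i : 'I_(q ^ 1) => b + i%:R)).
- by rewrite card_ord.
- by move=> i; rewrite ballD ?ball_natr.
- move=> i j h; apply: val_inj; apply: (@rep_uniq _ hp Qp 1 _ _ (ltn_ord i) (ltn_ord j)).
  by move: h; rewrite opprD addrACA subrr add0r.
Qed.

Lemma hecke_iter_fixed n x : ufixed x -> ufixed (iter n hecke x).
Proof. by move=> fx; elim: n => [|n IHn] //=; exact: hecke_fixed. Qed.

Lemma ufixed_tor y x : y != 0 -> padic_norm (nrm y) = 1 -> ufixed x ->
  ufixed (srep_act (tor y) x).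
Proof.
move=> y0 ny fx b hb; have n0 := nrm_neq0 hp ce dec y0.
rewrite -(mulVKf n0 b) -act_tor_up // fx // ballMnorm1 // padic_normV ny invr1.
by [].
Qed.

(** Conjugation by [tor y] multiplies the representatives by the unit N(y), which permutes the
    residues modulo q. *)
Lemma hecke_tor y x : y != 0 -> padic_norm (nrm y) = 1 -> ufixed x ->
  hecke (srep_act (tor y) x) = srep_act (tor y) (hecke x).
Proof.
move=> y0 ny fx; have n0 := nrm_neq0 hp ce dec y0; rewrite srep_act_sum.
have nb a : ball 0 (nrm y * a) = ball 0 a by rewrite ballMnorm1.
have -> : \sum_(i < q ^ 1) srep_act (tor y) (srep_act (up i%:R) (srep_act t x)) =
    \sum_(i < q ^ 1) srep_act (up (nrm y * i%:R)) (srep_act t (srep_act (tor y) x)).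
  apply: eq_bigr => i _; rewrite act_tor_up // !act_torM ?p_neq0 //.
  by rewrite (mulrC y p%:R).
apply/esym.
apply: (sum_reps hp (per (ufixed_tor y0 ny fx)) (psi := fun i : 'I_(q ^ 1) => nrm y * i%:R)).
- by rewrite card_ord.
- by move=> i; rewrite nb ball_natr.
- move=> i j h; apply: val_inj; apply: (@rep_uniq _ hp Qp 1 _ _ (ltn_ord i) (ltn_ord j)).
  by move: h; rewrite -mulrBr ballMnorm1.
Qed.

Lemma hecke_iter_eig n lam x : hecke x = lam *: x -> iter n hecke x = lam ^+ n *: x.
Proof.
move=> hx; elim: n => [|n IHn] /=; first by rewrite scale1r.
by rewrite IHn heckeZ hx scalerA -exprSr.
Qed.

Definition uspan (v x : V) : Prop :=
  exists s : seq (R * Qp), x = \sum_(u <- s) u.1 *: srep_act (up u.2) v.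

(** Each application multiplies translation parameters by q ([hecke_up]), so after n of them all
    translations in x belong to U_0, which fixes v. *)
Lemma hecke_uspan v lam x : ufixed v -> hecke v = lam *: v -> uspan v x ->
  exists d n, iter n hecke x = d *: v.
Proof.
move=> fv hv [s ->].
have [n hn] : exists n : nat, forall u, u \in s -> ball 0 (q%:R ^+ n * u.2).
  elim: s => [|u s [n IHs]]; first by exists 0%N.
  have [m hm] := ball_ex hp u.2; exists (maxn n m) => z.
  have mono k (a : Qp) (h : (k <= maxn n m)%N) : ball 0 (q%:R ^+ k * a) ->
      ball 0 (q%:R ^+ maxn n m * a).
    by rewrite !exprnP !ballMq // !sub0r; apply: ball_le => //; lia.
  rewrite inE => /orP[/eqP->|/IHs]; last by apply: mono; exact: leq_maxl.
  by apply: (mono m); [exact: leq_maxr|rewrite exprnP ballMq // sub0r].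
exists (\sum_(u <- s) u.1 * lam ^+ n), n.
have h0 : iter n hecke 0 = 0.
  by have := hecke_iterZ n 0 0; rewrite scaler0 scale0r.
rewrite (big_morph (iter n hecke) (hecke_iterD n) h0) scaler_suml big_seq [RHS]big_seq.
apply: eq_bigr => u us; rewrite hecke_iterZ hecke_iter_up (hecke_iter_eig n hv).
by rewrite srep_actZ fv ?hn // scalerA.
Qed.

(** Since mu is invertible, x is recovered from any iterate of the operator on x, and [hecke_uspan]
    puts some iterate on the line of v. *)
Lemma ord_line v lam mu mu' x : mu * mu' = 1 ->
  ufixed v -> hecke v = lam *: v -> uspan v x -> hecke x = mu *: x ->
  exists d, x = d *: v.
Proof.
move=> mm fv hv xs hx; have [d [n E]] := hecke_uspan fv hv xs.
exists (mu' ^+ n * d); rewrite -scalerA -E (hecke_iter_eig n hx) scalerA.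
by rewrite -exprMn mulrC mm expr1n scale1r.
Qed.

End Operator.

End Hecke.

Arguments hecke {p Qp L c} e {R V} x.
Arguments ufixed {p Qp L c} e {R V} x.
Arguments uspan {p Qp L c} e {R V} v x.

(** * Existence and uniqueness of ordinary vectors in a lift *)

Section OrdinaryVector.
Variables (p : nat) (hp : prime p) (Qp : padicField p) (L : fieldExtType Qp).
Variable c : {lrmorphism L -> L}.
Variables (e : L) (e0 : e != 0) (ce : c e = - e).
Hypothesis dec : forall y : L, exists a b : Qp, y = a%:A + b *: e.
Local Notation G := (U11 c).
Local Notation nrm := (nrm hp ce dec).
Local Notation up := (up c e).
Local Notation tor := (tor c).
Local Notation w := (w c).
Local Notation q := (p ^ 2)%N.
Local Notation grid := (grid Qp).
Local Notation t := (tor p%:R).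
Local Notation p_neq0 := (p_neq0 hp L).
Variables (O : comNzRingType) (k : fieldType) (res : {rmorphism O -> k}).
Hypothesis res_surj : forall y, exists x, res x = y.
Variable chi : schar G k.
Local Notation pi0 := (twist_rep chi (steinberg hp c k)).

Definition ev0 (x : pi0) (a : Qp) : k := ev e (s := triv_char G k) x a.

Lemma ev0D x y a : ev0 (x + y) a = ev0 x a + ev0 y a.
Proof. exact: (evD ce). Qed.

Lemma ev0Z r x a : ev0 (r *: x) a = r * ev0 x a.
Proof. exact: (evZ ce). Qed.

Lemma ev0_0 a : ev0 0 a = 0.
Proof. by have := ev0Z 0 0 a; rewrite scaler0 mul0r. Qed.

Lemma ev0B x y a : ev0 (x - y) a = ev0 x a - ev0 y a.
Proof. by rewrite ev0D -scaleN1r ev0Z mulN1r. Qed.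

Lemma ev0_sum (I : Type) (s : seq I) (F : I -> pi0) a :
  ev0 (\sum_(i <- s) F i) a = \sum_(i <- s) ev0 (F i) a.
Proof. exact: (big_morph (ev0^~ a) (fun x y => ev0D x y a) (ev0_0 a)). Qed.

Lemma ev0_inj x y : ev0 x =1 ev0 y -> x = y.
Proof. exact: (ev_inj ce dec). Qed.

Lemma ev0_up b x a : ev0 (srep_act (up b) x) a = ev0 x (a + b).
Proof.
rewrite -[srep_act _ _]/(chi (up b) *: srep_act (up b) (x : steinberg hp c k)).
by rewrite schar_up // scale1r; exact: ev_up.
Qed.

Lemma ev0_tor y x a : y != 0 ->
  ev0 (srep_act (tor y) x) a = chi (tor y) * ev0 x ((nrm y)^-1 * a).
Proof.
move=> y0; rewrite -[srep_act _ _]/(chi (tor y) *: srep_act (tor y) (x : steinberg hp c k)).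
by rewrite ev0Z; congr (_ * _); rewrite /ev0 ev_tor // mul1r.
Qed.

Lemma ev0_bd x : exists n, bdper n (ev0 x).
Proof. exact: (ev_bd e0 ce dec). Qed.

Lemma ev0_surj h n : bdper n h -> exists x, ev0 x =1 h.
Proof. exact: (ev_surj hp e0 ce dec (triv_char G k)). Qed.

(** The factor chi w makes this the reduction of [stbase] for every lift of chi ([St_map_base]). *)
Definition ebar : pi0 := chi w *: (stbase hp e0 ce dec (triv_char G k) : pi0).

Lemma ev0_ebar a : ev0 ebar a = chi w * (ball 0 a)%:R.
Proof. by rewrite ev0Z /ev0 ev_base. Qed.

Lemma chi_w_neq0 : chi w != 0.
Proof.
by apply/eqP => h; have := schar_w2 chi; rewrite h mul0r => /eqP; rewrite eq_sym oner_eq0.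
Qed.

Lemma ebar_fixed : ufixed e ebar.
Proof.
by move=> b hb; apply: ev0_inj => a; rewrite ev0_up !ev0_ebar ballDr.
Qed.

Lemma ev0_hecke x a : ev0 (hecke e x) a =
  \sum_(i < q ^ 1) chi t * ev0 x (q%:R^-1 * (a + i%:R)).
Proof.
rewrite ev0_sum; apply: eq_bigr => i _.
by rewrite ev0_up ev0_tor ?p_neq0 // nrm_p.
Qed.

Lemma ebar_hecke : hecke e ebar = chi t *: ebar.
Proof.
apply: ev0_inj => a; rewrite ev0_hecke -mulr_sumr ev0Z; congr (_ * _).
by under eq_bigr do rewrite ev0_ebar; rewrite -mulr_sumr ball_hecke // ev0_ebar.
Qed.

Lemma ev0_tpow n a : ev0 (srep_act (tor (p%:R ^+ n)) ebar) a =
  chi (tor (p%:R ^+ n)) * chi w * (ball n%:Z a)%:R.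
Proof.
rewrite ev0_tor ?pX_neq0 // ev0_ebar mulrA; congr (_ * _%:R).
by rewrite nrm_pX exprnN ballMq // sub0r opprK.
Qed.

Lemma per0_grid (h : Qp -> k) (n : nat) :
  (forall a b, ball 0 b -> h (a + b) = h a) ->
  (forall a, ~~ ball (- n%:Z) a -> h a = 0) ->
  forall a, h a = \sum_(i < q ^ n) h (grid n i) * (ball 0 (a - grid n i))%:R.
Proof.
move=> h1 h2 a; have [ha|ha] := boolP (ball (- n%:Z) a); last first.
  rewrite h2 // big1 // => i _; case: (boolP (ball 0 _)) => [hb|_]; last by rewrite mulr0.
  case/negP: ha; rewrite -(subrK (grid n i) a) ballD ?ball_grid //.
  by apply: ball_le hb => //; lia.
have key b i : ball 0 (b - grid n i) = ball n%:Z (q%:R ^ n%:Z * b - i%:R).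
  have -> : b - grid n i = q%:R ^ (- n%:Z) * (q%:R ^ n%:Z * b - i%:R).
    by rewrite mulrBr mulrA -expfzDr ?qQp_neq0 // addNr expr0z mul1r.
  by rewrite ballMq // sub0r opprK.
have [i _ hi] : exists2 i : 'I_(q ^ n), true & ball 0 (a - grid n i).
  have [|i _ hi] := @rep_ex _ hp Qp n (q%:R ^ n%:Z * a); first by rewrite ballMq // sub0r.
  by exists i => //; rewrite key.
rewrite (bigD1 i) //= hi mulr1 big1 ?addr0 => [|j ji].
  by rewrite -[a in LHS](subrKC (grid n i)) h1.
case: (boolP (ball _ _)) => [hj|]; last by rewrite mulr0.
case/eqP: ji; apply: val_inj.
apply: (@rep_uniq _ hp Qp n _ _ (ltn_ord j) (ltn_ord i)).
have := ballB hi hj; rewrite opprB addrC addrA subrK -mulrBr ballMq // sub0r opprK.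
by [].
Qed.

Lemma ebar_uspan (y : pi0) : ufixed e y -> uspan e ebar y.
Proof.
move=> fy; have [n [_ h2]] := ev0_bd y.
exists [seq (chi w * ev0 y (grid n i), - grid n i) | i : 'I_(q ^ n)].
apply: ev0_inj => a; rewrite big_image /= ev0_sum.
rewrite (@per0_grid (ev0 y) n) // => [|b b' hb]; last by rewrite -{2}(fy _ hb) ev0_up.
apply: eq_bigr => i _; rewrite ev0Z ev0_up ev0_ebar.
by rewrite -[LHS]mul1r -(schar_w2 chi); ring.
Qed.

Section Cocycle.
Variable z : Qp -> pi0.
Hypothesis zD : forall b b', ball 0 b -> ball 0 b' ->
  z (b + b') = z b + srep_act (up b) (z b').
Variable n : nat.
Hypothesis z0 : forall b, ball n%:Z b -> z b = 0.

(** Points of one coset of Z_p define the same set, so [xget] returns the same representative for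
    all of them ([repD]). *)
Let rep (a : Qp) : Qp := xget 0 [set b | ball 0 (a - b)].
Let repP a : ball 0 (a - rep a).
Proof.
by apply: (@xgetPex _ 0 [set b | ball 0 (a - b)]); exists a; rewrite /= subrr.
Qed.
Let repD a b : ball 0 b -> rep (a + b) = rep a.
Proof.
move=> hb; congr xget; apply/seteqP.
by split=> x /=; rewrite addrAC (ballDr _ hb).
Qed.
Let ballW (b : Qp) : ball n%:Z b -> ball 0 b.
Proof. by apply: ball_le. Qed.

(* On the coset rep a + U_0 the primitive of the cocycle is x |-> z_x (rep a). *)
Lemma cocycle_split : exists y : pi0, forall b, ball 0 b ->
  srep_act (up b) y - y = z b.
Proof.
pose h a := ev0 (z (a - rep a)) (rep a).
have hD a b : ball 0 b -> h (a + b) = h a + ev0 (z b) a.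
  move=> hb; rewrite /h repD // (addrAC a) (zD (repP a) hb) [LHS]ev0D ev0_up subrKC.
  by [].
(* By [z0] the cocycle is determined by its values at the residues modulo q ^ n, so one N bounds the
   supports of all its values. *)
have [N hN] : exists N : nat, forall i, (i < q ^ n)%N -> forall a,
    ~~ ball (- N%:Z) a -> ev0 (z i%:R) a = 0.
  elim: (q ^ n)%N => [|m [N IHm]]; first by exists 0%N.
  have [M [_ hM]] := ev0_bd (z m%:R); exists (maxn N M) => i.
  have mono K (a : Qp) : (K <= maxn N M)%N -> ~~ ball (- (maxn N M)%:Z) a ->
      ~~ ball (- K%:Z) a :> Prop.
    by move=> KN; apply: contra; apply: ball_le => //; lia.
  rewrite ltnS leq_eqVlt => /orP[/eqP->|im] a ha.
    by apply: hM; apply: mono ha; exact: leq_maxr.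
  by apply: IHm => //; apply: mono ha; exact: leq_maxl.
have hb : bdper (maxn n N) h.
  split=> [a b hb|a ha].
    have hb' : ball n%:Z b by apply: ball_le hb => //; rewrite lez_nat leq_maxl.
    by rewrite hD ?ballW // z0 // ev0_0 addr0.
  have [i _ hi] := rep_ex hp n (repP a).
  have -> : h a = ev0 (z i%:R) (rep a).
    rewrite /h -[in z _](subrKC i%:R (a - rep a)) zD ?ball_natr ?ballW //.
    rewrite (z0 hi) srep_act0 addr0.
    by [].
  apply: hN => //; apply: contra ha => ha.
  rewrite -(subrK (rep a) a) ballD //; last by apply: ball_le ha => //; lia.
  by apply: ball_le (repP a) => //; lia.
have [y yh] := ev0_surj hb; exists y => b bb; apply: ev0_inj => a.
by rewrite ev0B ev0_up !yh hD // addrC addKr.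
Qed.

End Cocycle.

Section Lifting.
Variables (A : artAlg res) (V : srep G A) (phi : V -> pi0).
Hypothesis Lf : is_lift phi.
Local Notation rA := (art_res A).
Local Notation mA := [set a : A | rA a = 0].

Lemma mA_ideal : ideal mA.
Proof. by case: (art_ker_maximal res_surj A). Qed.

Lemma idealmul_mA x : phi x = 0 -> idealmul mA x.
Proof.
move=> x0; rewrite -[x]scale1r; apply: (idealmul_ker Lf mA_ideal) => // b /= b0.
by rewrite mulr1.
Qed.

(** If u_b x - x is a y_b modulo J, then b |-> phi (y_b) is a cocycle of U_0, trivial near 0 by
    smoothness of x; [cocycle_split] gives the correction of x. Starting from the maximal ideal
    makes a have residue 0, so corrections do not change phi x. *)
Lemma fixed_lift : exists2 x : V, phi x = ebar & ufixed e x.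
Proof.
suff [x [xe hx]] : exists x : V, phi x = ebar /\
    forall b, ball 0 b -> idealmul [set 0] (srep_act (up b) x - x).
  exists x => // b /hx /idealmul_set0/eqP; rewrite subr_eq0 => /eqP.
  by [].
apply: (@art_ind _ _ _ res_surj A (fun I => exists x : V, phi x = ebar /\
    forall b, ball 0 b -> idealmul I (srep_act (up b) x - x)) mA mA_ideal).
  have [x xe] := lift_surj Lf ebar; exists x; split=> // b hb; apply: idealmul_mA.
  by rewrite (liftB Lf) (lift_equiv Lf) xe ebar_fixed // subrr.
move=> I J a iI iJ Im JI Ia Ja IJ mJ [x [xe hx]].
have [y hy] : exists y : Qp -> V, forall b, ball 0 b ->
    idealmul J (srep_act (up b) x - x - a *: y b).
  have ex b : exists y, ball 0 b -> idealmul J (srep_act (up b) x - x - a *: y).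
    have [hb|hb] := boolP (ball 0 b); last by exists 0.
    by have [y hy] := idealmul_step IJ (hx b hb); exists y.
  by have [y hy] := choice ex; exists y.
have a0 : rA a = 0 by exact: Im.
have [m mK] : exists m : nat, forall b, ball m%:Z b -> srep_act (up b) x = x.
  have [K oK Kx] := srep_smooth x; have [m mK] := open_subgroup_cong oK.
  by have [n hn] := up_cong hp ce m; exists n => b /hn /mK /Kx.
have eqJ u v : idealmul J (a *: u - a *: v) -> phi u = phi v.
  rewrite -scalerBr => /(idealmul_eq0 res_surj Lf iJ Ja); rewrite (liftB Lf) => /eqP.
  by rewrite subr_eq0 => /eqP.
have [||yb ybP] := @cocycle_split (fun b => phi (y b)) _ m.
- move=> b b' hb hb'; rewrite -(lift_equiv Lf) -(lift_add Lf); apply: eqJ.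
  have h1 := hy _ (ballD hb hb').
  have h2 := hy _ hb; have h3 := idealmul_act (up b) (hy _ hb').
  have := idealmulB iJ (idealmulD h2 h3) h1.
  rewrite !srep_actB srep_actZ (act_upD ce).
  have -> : a *: (y b + srep_act (up b) (y b')) = a *: y b + a *: srep_act (up b) (y b').
    exact: scalerDr.
  move: (srep_act (up b) (srep_act _ x)) (srep_act (up b) x) => u v.
  rewrite addrACA [v - x + _]addrC subrKA -opprD opprB [_ + (_ - _)]addrC addrA subrK.
  by [].
- move=> b hb; rewrite -(lift_map0 Lf); apply: eqJ.
  have hb0 : ball 0 b by apply: ball_le hb.
  have := idealmulZ (-1) iJ (hy _ hb0); rewrite mK // subrr sub0r scaleN1r opprK.
  by rewrite scaler0 subr0.
have [y' y'b] := lift_surj Lf yb; exists (x - a *: y'); split.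
  by rewrite (liftB Lf) (lift_scale Lf) a0 scale0r subr0.
move=> b hb; rewrite srep_actB srep_actZ.
have h1 := hy _ hb.
have h2 : idealmul J (a *: y b - a *: (srep_act (up b) y' - y')).
  apply: (idealmul_kerB Lf) => //; rewrite (liftB Lf) (lift_equiv Lf) y'b.
  exact: (esym (ybP _ hb)).
have := idealmulD h1 h2; rewrite scalerBr addrA subrK.
by rewrite !opprD !opprK addrACA.
Qed.

Lemma phi_hecke x : phi (hecke e x) = hecke e (phi x).
Proof.
by rewrite (lift_sum Lf); apply: eq_bigr => i _; rewrite !(lift_equiv Lf).
Qed.

Lemma phi_hecke_iter n x : phi (iter n (hecke e) x) = iter n (hecke e) (phi x).
Proof. by elim: n => [|n IHn] //=; rewrite phi_hecke IHn. Qed.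

Lemma idealmul_hecke (J : set A) (x : V) : ideal J -> idealmul J x -> idealmul J (hecke e x).
Proof. by move=> iJ h; apply: idealmul_sum => // i; do 2!apply: idealmul_act. Qed.

Lemma idealmul_hecke_iter (J : set A) n (x : V) : ideal J -> idealmul J x ->
  idealmul J (iter n (hecke e) x).
Proof. by move=> iJ h; elim: n => [|n IHn] //=; exact: idealmul_hecke. Qed.

Lemma chi_neq0 g : chi g != 0.
Proof.
apply/eqP => h; have := scharV chi g; rewrite h mul0r => /eqP.
by rewrite eq_sym oner_eq0.
Qed.

(** The error of the eigenvector equation is a y with phi y fixed by U_0 but in general not on the
    line of [ebar]. Iterating the operator n times brings it there, after which a change of
    eigenvalue absorbs it. *)
Lemma ordinary_lift : exists (v : V) (lam : A),
  [/\ phi v = ebar, ufixed e v, hecke e v = lam *: v & rA lam = chi t].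
Proof.
suff [v [lam [ve fv hv lt]]] : exists (v : V) (lam : A), [/\ phi v = ebar, ufixed e v,
    idealmul [set 0] (hecke e v - lam *: v) & rA lam = chi t].
  exists v, lam; split=> //; apply/eqP; rewrite -subr_eq0; apply/eqP.
  exact: idealmul_set0.
apply: (@art_ind _ _ _ res_surj A (fun I => exists (v : V) (lam : A),
    [/\ phi v = ebar, ufixed e v, idealmul I (hecke e v - lam *: v) & rA lam = chi t])
    mA mA_ideal).
  have [v ve fv] := fixed_lift; have [lam lt] := art_res_surj res_surj A (chi t).
  exists v, lam; split=> //; apply: idealmul_mA.
  by rewrite (liftB Lf) (lift_scale Lf) phi_hecke ve ebar_hecke lt subrr.
move=> I J a iI iJ Im JI Ia Ja IJ mJ [v [lam [ve fv hv lt]]].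
have a0 : rA a = 0 by exact: Im.
have [y hy] := idealmul_step IJ hv.
have fy : ufixed e (phi y).
  move=> b hb; apply/eqP; rewrite -subr_eq0 -(lift_equiv Lf) -(liftB Lf); apply/eqP.
  apply: (idealmul_eq0 res_surj Lf iJ Ja).
  have := idealmulB iJ hy (idealmul_act (up b) hy).
  rewrite !srep_actB !srep_actZ (hecke_fixed hp ce dec fv) // fv // scalerBr.
  move: (hecke e v - lam *: v) => x.
  by rewrite opprB addrC addrA subrK.
have [mu [n En]] := hecke_uspan hp e0 ce dec ebar_fixed ebar_hecke (ebar_uspan fy).
have [lam' ll] : exists lam', lam * lam' = 1.
  by apply: (art_unit res_surj); rewrite lt; apply/eqP; exact: chi_neq0.
have lt' : chi t * rA lam' = 1 by rewrite -lt -rmorphM ll rmorph1.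
(* The factor lam'^n restores the reduction [ebar], which the iteration multiplies by the n-th power
   of chi t. *)
pose v' := lam' ^+ n *: iter n (hecke e) v.
have v'e : phi v' = ebar.
  rewrite (lift_scale Lf) phi_hecke_iter ve (hecke_iter_eig n ebar_hecke).
  by rewrite scalerA rmorphXn -exprMn mulrC lt' expr1n scale1r.
have [m0 m0E] := art_res_surj res_surj A mu.
(* Modulo J the new error lam'^n a hecke^n y is lam'^n a m0 v', as hecke^n y and m0 v' have the same
   reduction. *)
exists v', (lam + lam' ^+ n * a * m0); split=> //.
- move=> b hb; rewrite srep_actZ (hecke_iter_fixed hp ce dec n fv) //.
- have h1 : idealmul J (hecke e v' - lam *: v' - (lam' ^+ n * a) *: iter n (hecke e) y).
    have := idealmulZ (lam' ^+ n) iJ (idealmul_hecke_iter n iJ hy).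
    rewrite -!(scaleN1r (_ *: _)) !hecke_iterD !hecke_iterZ -iterSr iterS.
    rewrite !scalerDr /v' heckeZ !scalerA.
    congr (idealmul J (_ + _ + _)); congr (_ *: _); ring.
  have h2 : idealmul J (lam' ^+ n *: (a *: iter n (hecke e) y - a *: (m0 *: v'))).
    apply: idealmulZ => //; apply: (idealmul_kerB Lf) => //.
    by rewrite (lift_scale Lf) phi_hecke_iter En v'e m0E.
  clearbody v'.
  have := idealmulD h1 h2; rewrite scalerBr !scalerA addrA subrK scalerDl opprD addrA.
  by rewrite mulrA.
- by rewrite rmorphD !rmorphM a0 mulr0 mul0r addr0.
Qed.

Section Consequences.
Variables (v : V) (lam : A).
Hypotheses (ve : phi v = ebar) (fv : ufixed e v) (hv : hecke e v = lam *: v).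
Hypothesis lt : rA lam = chi t.

Lemma lam_unit : exists lam', lam * lam' = 1.
Proof. by apply: (art_unit res_surj); rewrite lt; apply/eqP; exact: chi_neq0. Qed.

Definition tv (n : nat) : V := srep_act (tor (p%:R ^+ n)) v.

Lemma ev0_tv r n a : ev0 (phi (srep_act (up r) (tv n))) a =
  chi (tor (p%:R ^+ n)) * chi w * (ball n%:Z (a + r))%:R.
Proof. by rewrite (lift_equiv Lf) ev0_up (lift_equiv Lf) ve ev0_tpow. Qed.

Lemma tv_span x : spanned [set y | exists r n, y = srep_act (up r) (tv n)] x.
Proof.
apply: (lift_gen res_surj Lf (H := set0)) => // y _.
have [n hn] := ev0_bd y.
pose u := (chi (tor (p%:R ^+ n)) * chi w)^-1.
exists [seq (u * ev0 y (grid n i), srep_act (up (- grid n i)) (tv n)) | i : 'I_(q ^ (n + n))].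
  by move=> _ /mapP[i _ ->] /=; exists (- grid n i), n.
apply: ev0_inj => a; rewrite big_image /= ev0_sum (bdper_grid hp hn).
apply: eq_bigr => i _; rewrite ev0Z ev0_tv.
have u0 : chi (tor (p%:R ^+ n)) * chi w != 0 by rewrite mulf_neq0 ?chi_neq0.
by rewrite /u; move: (chi _ * chi w) u0 => d d0; field.
Qed.

(** The reductions are, up to a nonzero scalar, characteristic functions of disjoint balls;
    [lift_indep] does the rest. *)
Lemma tv_indep n (a : 'I_(q ^ (n + n)) -> A) :
  \sum_i a i *: srep_act (up (- grid n i)) (tv n) = 0 -> forall i, a i = 0.
Proof.
move=> a0 i.
apply: (@lift_indep _ _ _ res_surj _ _ _ _ _ Lf _ (index_enum 'I_(q ^ (n + n)))
  (fun i => srep_act (up (- grid n i)) (tv n)) _ a a0); last exact: mem_index_enum.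
move=> b b0 j _.
have := congr1 (ev0^~ (grid n j)) b0; rewrite /= ev0_sum ev0_0 (bigD1 j) //=.
rewrite big1 => [|i' ne].
  rewrite ev0Z ev0_tv subrr ball0 // mulr1 addr0 => /eqP.
  by rewrite !mulf_eq0 !(negbTE (chi_neq0 _)) !orbF => /eqP.
rewrite ev0Z ev0_tv; case: (boolP (ball _ _)) => [hb|]; last by rewrite !mulr0.
case/eqP: ne; apply: val_inj; apply/esym.
exact: (@grid_uniq _ hp Qp _ _ _ (ltn_ord j) (ltn_ord i')).
Qed.

Lemma v_torsionfree d : d *: v = 0 -> d = 0.
Proof.
move=> d0.
apply: (@lift_indep _ _ _ res_surj _ _ _ _ _ Lf _ [:: tt] (fun=> v) _ (fun=> d) _ tt) => //.
  move=> b; rewrite big_seq1 => b0 [] _.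
  have := congr1 (ev0^~ 0) b0; rewrite /= ev0Z ve ev0_ebar ev0_0 ball0 // mulr1 => /eqP.
  by rewrite mulf_eq0 (negbTE chi_w_neq0) orbF => /eqP.
by rewrite big_seq1.
Qed.

Lemma v_inj d d' : d *: v = d' *: v -> d = d'.
Proof.
move=> E; apply/eqP; rewrite -subr_eq0; apply/eqP/v_torsionfree.
by rewrite scalerBl E subrr.
Qed.

(** This is [lift_gen] with H = U_0: over k the fixed functions are the combinations of translates
    of [ebar]. *)
Lemma fixed_uspan x : ufixed e x -> uspan e v x.
Proof.
move=> fx; have [|||s sX ->] := @lift_gen _ _ _ res_surj _ _ _ _ _ Lf
  [set up b | b in [set b | ball 0 b]] [set y | exists r, y = srep_act (up r) v] _ _ x.
- move=> _ _ [b hb <-] [r ->]; rewrite -(act_upD ce) addrC (act_upD ce) (fv hb).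
  by [].
- move=> y fy; have [|s ->] := @ebar_uspan y.
    by move=> b hb; apply: fy; exists b.
  exists [seq (u.1, srep_act (up u.2) v) | u <- s].
    by move=> _ /mapP[u _ ->]; exists u.2.
  by rewrite big_map; apply: eq_bigr => u _; rewrite (lift_equiv Lf) ve.
- by move=> _ [b hb <-]; exact: fx.
have {}sX u : exists r, u \in s -> u.2 = srep_act (up r) v.
  have [us|] := boolP (u \in s); last by exists 0.
  by have [r hr] := sX _ us; exists r.
have [r rP] := choice sX; exists [seq (u.1, r u) | u <- s].
by rewrite big_map big_seq [RHS]big_seq; apply: eq_bigr => u us; rewrite -rP.
Qed.

Lemma ordinary_uniq x mu : ufixed e x -> hecke e x = mu *: x -> rA mu != 0 ->
  exists d, x = d *: v.
Proof.
move=> fx hx /eqP/(art_unit res_surj)[mu' mm].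
exact: (ord_line hp e0 ce dec mm fv hv (fixed_uspan fx) hx).
Qed.

Lemma tor_unit_v y : y != 0 -> padic_norm (nrm y) = 1 ->
  exists d, srep_act (tor y) v = d *: v.
Proof.
move=> y0 ny; apply: (@ordinary_uniq _ lam).
- exact: (ufixed_tor y0 ny fv).
- by rewrite (hecke_tor y0 ny fv) hv srep_actZ.
- by rewrite lt chi_neq0.
Qed.

End Consequences.

End Lifting.

End OrdinaryVector.

(** * Normal forms in the module generated by an ordinary vector *)

Section NormalForm.
Variables (p : nat) (hp : prime p) (Qp : padicField p) (L : fieldExtType Qp).
Variable c : {lrmorphism L -> L}.
Variables (e : L) (e0 : e != 0) (ce : c e = - e).
Hypothesis dec : forall y : L, exists a b : Qp, y = a%:A + b *: e.
Local Notation G := (U11 c).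
Local Notation nrm := (nrm hp ce dec).
Local Notation up := (up c e).
Local Notation tor := (tor c).
Local Notation w := (w c).
Local Notation lo := (lo c e).
Local Notation q := (p ^ 2)%N.
Local Notation grid := (grid Qp).
Local Notation t := (tor p%:R).
Local Notation p_neq0 := (p_neq0 hp L).
Local Notation tor1 := (tor1 ce dec).
Local Notation torM := (torM ce dec).
Local Notation w_tor := (w_tor ce dec).
Hypothesis unr : unramified L.
Variables (R : comNzRingType) (W : lmodType R) (act : G -> W -> W).
Hypothesis act_lin : forall g, linear (act g).
Hypothesis act1 : forall x, act 1%g x = x.
Hypothesis actM : forall g h x, act (g * h)%g x = act g (act h x).
Variables (E : W) (lam lam' : R).
Hypothesis ll' : lam * lam' = 1.
Hypothesis E_up : forall a, ball 0 a -> act (up a) E = E.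
Hypothesis E_hecke : \sum_(i < q ^ 1) act (up i%:R) (act t E) = lam *: E.
Hypothesis E_tor : forall y, y != 0 -> padic_norm (nrm y) = 1 ->
  exists d, act (tor y) E = d *: E.
Hypothesis E_lo : exists m : nat, forall a, ball m%:Z a -> act (lo a) E = E.

Let actD g x y : act g (x + y) = act g x + act g y.
Proof. by have := act_lin g 1 x y; rewrite !scale1r. Qed.
Let act0 g : act g 0 = 0.
Proof. by apply: (addrI (act g 0)); rewrite -actD !addr0. Qed.
Let actZ g r x : act g (r *: x) = r *: act g x.
Proof. by have := act_lin g r x 0; rewrite act0 !addr0. Qed.
Let act_sum g (I : Type) (s : seq I) (P : pred I) (F : I -> W) :
  act g (\sum_(i <- s | P i) F i) = \sum_(i <- s | P i) act g (F i).
Proof. exact: (big_morph _ (actD g) (act0 g)). Qed.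
Let actB g x y : act g (x - y) = act g x - act g y.
Proof. by rewrite actD -scaleN1r actZ scaleN1r. Qed.

(** A[B]E, as [g10] vanishes exactly on the Borel subgroup. W is only a module with a linear action
    because it will contain arbitrary functions on G, on which the action is not smooth. *)
Definition bspan (x : W) : Prop := exists2 s : seq (R * G),
  (forall u, u \in s -> g10 u.2 = 0) & x = \sum_(u <- s) u.1 *: act u.2 E.

Lemma bspanD x y : bspan x -> bspan y -> bspan (x + y).
Proof.
move=> [s sJ ->] [s' sJ' ->]; exists (s ++ s'); last by rewrite big_cat.
by move=> u; rewrite mem_cat => /orP[/sJ|/sJ'].
Qed.

Lemma bspanZ r x : bspan x -> bspan (r *: x).
Proof.
move=> [s sJ ->]; exists [seq (r * u.1, u.2) | u <- s].
  by move=> _ /mapP[u /sJ h ->].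
by rewrite big_map scaler_sumr; apply: eq_bigr => u _; rewrite scalerA.
Qed.

Lemma bspanB x y : bspan x -> bspan y -> bspan (x - y).
Proof. by move=> hx hy; rewrite -scaleN1r; apply/bspanD/bspanZ. Qed.

Lemma bspan_sum (I : Type) (s : seq I) (P : pred I) (F : I -> W) :
  (forall i, P i -> bspan (F i)) -> bspan (\sum_(i <- s | P i) F i).
Proof.
move=> h; elim/big_rec: _ => [|i x Pi]; last exact/bspanD/h.
by exists [::]; rewrite ?big_nil.
Qed.

Lemma bspan_mem g : g10 g = 0 -> bspan (act g E).
Proof.
move=> g0; exists [:: (1, g)]; last by rewrite big_seq1 scale1r.
by move=> u; rewrite inE => /eqP->.
Qed.

Lemma g10_borelM (g h : G) : g10 g = 0 -> g10 h = 0 -> g10 (g * h)%g = 0.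
Proof. by move=> g0 h0; rewrite g10M g0 mul0r -/(g10 h) h0 mulr0 addr0. Qed.

Lemma bspan_act g x : g10 g = 0 -> bspan x -> bspan (act g x).
Proof.
move=> g0 [s sJ ->]; exists [seq (u.1, (g * u.2)%g) | u <- s].
  by move=> _ /mapP[u /sJ h ->]; exact: g10_borelM.
by rewrite big_map act_sum; apply: eq_bigr => u _; rewrite actZ actM.
Qed.

Lemma g10_of_up a : g10 (up a) = 0.
Proof. by rewrite /g10 val_up // !mxE. Qed.
Lemma g10_of_tor y : y != 0 -> g10 (tor y) = 0.
Proof. by move=> y0; rewrite /g10 (val_tor ce dec) // !mxE. Qed.

Local Notation tp n := (tor (p%:R ^+ n)).
Lemma tpS n : tp n.+1 = (tp n * t)%g.
Proof. by rewrite exprSr torM ?pX_neq0 ?p_neq0. Qed.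

(** The eigenvector equation solved for E, which is possible as lam is a unit: one translate is
    replaced by q translates one level deeper. *)
Lemma tor_refine y : y != 0 -> act (tor y) E =
  lam' *: \sum_(j < q ^ 1) act (up (nrm y * j%:R)) (act (tor (y * p%:R)) E).
Proof.
move=> y0; have -> : act (tor y) E = lam' *: act (tor y) (lam *: E).
  by rewrite actZ scalerA mulrC ll' scale1r.
rewrite -E_hecke act_sum; congr (_ *: _); apply: eq_bigr => j _.
by rewrite -!actM (tor_up hp ce dec) // torM ?p_neq0 // mulgA.
Qed.

Lemma E_refine n : act (tp n) E =
  lam' *: \sum_(j < q ^ 1) act (up (q%:R ^+ n * j%:R)) (act (tp n.+1) E).
Proof.
by rewrite tor_refine ?pX_neq0 // -exprSr; under eq_bigr do rewrite nrm_pX.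
Qed.

Lemma unif_dec y : y != 0 -> exists (a b : nat) (z : L),
  [/\ z != 0, padic_norm (nrm z) = 1 & y * p%:R ^+ b = p%:R ^+ a * z].
Proof.
move=> y0; have [i hi] := val_ex hp e0 ce dec unr y0.
have [a [b ab]] : exists a b : nat, i = a%:Z - b%:Z.
  by case: i {hi} => n; [exists n, 0%N; rewrite subr0|exists 0%N, n.+1; rewrite NegzE sub0r].
exists a, b, (y * p%:R^-1 ^+ a * p%:R ^+ b).
have pv0 k : (p%:R^-1 : L) ^+ k != 0 by rewrite expf_neq0 // invr_eq0 p_neq0.
split; first by rewrite !mulf_neq0 ?pX_neq0.
  rewrite !nrmM exprVn nrmV !nrm_pX !padic_normM padic_normV hi !padic_normX.
  rewrite padic_normq // exprVn invrK ab opprB exprVn !exprnP -expfzDr ?qQ_neq0 //.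
  by rewrite invr_expz -expfzDr ?qQ_neq0 // subrK subrr expr0z.
by rewrite !mulrA exprVn [_ * y]mulrC mulfK ?pX_neq0.
Qed.

Lemma lo_tor y a : y != 0 -> (lo a * tor y = tor y * lo (nrm y * a))%g.
Proof.
move=> y0; have cy0 : (c y)^-1 != 0 by rewrite invr_eq0 conj_eq0.
rewrite -[lo a]/(w * up a * w)%g -[lo (_ * a)]/(w * up (_ * a) * w)%g -!mulgA w_tor // (mulgA (up a)) (up_tor hp ce dec) // nrmV nrm_conj invrK.
by rewrite !mulgA w_tor // conjV (conjK ce dec) invrK.
Qed.

(* The points close to r stay away from 0, so that w moves them into a bounded
   region where the lower unipotent part acts trivially on a small ball. *)
Lemma w_up_bspan n r : ~~ ball n%:Z r -> bspan (act (w * up r)%g (act (tp n) E)).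
Proof.
move=> rn; have [m hm] := E_lo.
have r0 : r != 0 by apply: contraNneq rn => ->; exact: ball0.
have [n3 h3] := ball_ex hp (inv_up hp ce dec r).
have base N r' : (m + n3 <= N)%N -> ball n%:Z (r' - r) ->
    bspan (act (w * up r')%g (act (tp N) E)).
  move=> mN hr.
  have Nr : padic_norm r' = padic_norm r.
    rewrite -(subrKC r r') padic_normD_eq //.
    by move: rn; rewrite /ball -ltNge; exact: le_lt_trans hr.
  have r'0 : r' != 0 by rewrite -padic_norm_eq0 Nr padic_norm_eq0.
  have h3' : ball (- n3%:Z) (inv_up hp ce dec r').
    by move: h3; rewrite /ball /inv_up !padic_normN !padic_normV !padic_normM Nr.
  have x0 : - (r' *: e)^-1 != 0 by rewrite oppr_eq0 invr_eq0 scaler_eq0 negb_or r'0.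
  rewrite (w_up hp e0 ce dec r'0) (actM _ (lo _)) -(actM (lo _)) lo_tor ?pX_neq0 //.
  rewrite (actM (tp N)) hm.
    apply: bspan_act; first by rewrite g10_borelM ?g10_of_up ?g10_of_tor.
    by apply: bspan_mem; rewrite g10_of_tor ?pX_neq0.
  rewrite nrm_pX exprnP ballMq //; apply: ball_le h3' => //; lia.
(* d counts the refinements still needed to reach the level m + n3, where [base] applies. *)
suff H d N r' : (m + n3 <= N + d)%N -> (n <= N)%N -> ball n%:Z (r' - r) ->
    bspan (act (w * up r')%g (act (tp N) E)).
  by apply: (H (m + n3)%N) => //; rewrite ?leq_addl // subrr ball0.
elim: d N r' => [|d IHd] N r' mN nN hr; first by apply: base hr; rewrite addn0 in mN.
rewrite E_refine actZ act_sum; apply: bspanZ; apply: bspan_sum => j _.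
rewrite -actM -mulgA -upD //; apply: IHd; first by rewrite addSnnS.
  exact: leq_trans nN (leqnSn N).
rewrite addrAC ballDr // exprnP ballMq //; apply: ball_le (ball_natr hp Qp j) => //; lia.
Qed.

(** In the refinement of level n only the term j = 0 meets 0; the other points q^n j are outside
    q^(n+1) Z_p, where [w_up_bspan] applies. *)
Lemma w_tp_step n : bspan (act (w * tp n)%g E - lam' *: act (w * tp n.+1)%g E).
Proof.
have q0 : (0 < q ^ 1)%N by rewrite !expn_gt0 prime_gt0.
rewrite actM E_refine actZ act_sum (bigD1 (Ordinal q0)) //= mulr0 up0 // act1.
rewrite -actM scalerDr addrC addKr; apply: bspanZ; apply: bspan_sum => j j0.
rewrite -actM; apply: w_up_bspan; rewrite exprnP ballMq //.
have -> : n.+1%:Z - n%:Z = 1%N%:Z by lia.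
apply/negP => hj; case/eqP: j0; apply: val_inj => /=.
by apply: (@rep_uniq _ hp Qp 1 _ _ (ltn_ord j)) => //; rewrite subr0.
Qed.

(* The elements of A wE + A[B]E; stability under G (gspan_act) says that this is
   all of A[G]E. *)
Definition gspan (x : W) : Prop := exists d, bspan (x - d *: act w E).

Lemma gspanD x y : gspan x -> gspan y -> gspan (x + y).
Proof.
move=> [d hx] [d' hy]; exists (d + d'); rewrite scalerDl opprD addrACA.
exact: bspanD.
Qed.

Lemma gspanZ r x : gspan x -> gspan (r *: x).
Proof. by move=> [d hx]; exists (r * d); rewrite -scalerA -scalerBr; exact: bspanZ. Qed.

Lemma bspan_gspan x : bspan x -> gspan x.
Proof. by exists 0; rewrite scale0r subr0. Qed.

Lemma gspan_sum (I : eqType) (s : seq I) (F : I -> W) :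
  (forall i, i \in s -> gspan (F i)) -> gspan (\sum_(i <- s) F i).
Proof.
move=> h; rewrite big_seq; elim/big_rec: _ => [|i x Pi]; last exact/gspanD/h.
by apply: bspan_gspan; exists [::]; rewrite ?big_nil.
Qed.

Lemma w_tp n : bspan (act w E - lam' ^+ n *: act (w * tp n)%g E).
Proof.
elim: n => [|n IHn].
  rewrite !expr0 tor1 mulg1 scale1r subrr.
  by exists [::]; rewrite ?big_nil.
have := bspanD IHn (bspanZ (lam' ^+ n) (w_tp_step n)).
by rewrite scalerBr scalerA -exprSr addrA subrK.
Qed.

Lemma gspan_act_w g : gspan (act g (act w E)) -> g10 g = 0 ->
  forall x, gspan x -> gspan (act g x).
Proof.
move=> hw g0 x [d hx]; rewrite -(subrK (d *: act w E) x) actD actZ.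
by apply: gspanD; [apply/bspan_gspan/bspan_act|exact: gspanZ].
Qed.

Lemma gspan_w : gspan (act w E).
Proof.
by exists 1; rewrite scale1r subrr; exists [::]; rewrite ?big_nil.
Qed.

(** Modulo A[B]E, w E may be replaced by a multiple of w t^n E ([w_tp]). For n large, u_b moves
    across w t^n to a lower unipotent element so small that it fixes E. *)
Lemma gspan_up b x : gspan x -> gspan (act (up b) x).
Proof.
apply: gspan_act_w; last exact: g10_of_up.
have [m hm] := E_lo; have [n hn] := ball_ex hp b.
have hb : ball m%:Z (q%:R ^+ (m + n) * b).
  by rewrite exprnP ballMq //; apply: ball_le hn => //; lia.
have E1 : act (up b) (act (w * tp (m + n))%g E) = act (w * tp (m + n))%g E.
  have key : (up b * (w * tp (m + n)) = w * tp (m + n) * lo (nrm (p%:R ^+ (m + n)) * b))%g.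
    rewrite -(mulgA w) -lo_tor ?pX_neq0 // -[lo b]/(w * up b * w)%g.
    by rewrite !mulgA w2 mul1g.
  by rewrite -actM key actM nrm_pX hm.
exists 1; rewrite scale1r.
have h1 := w_tp (m + n); have := bspanB (bspan_act (g10_of_up b) h1) h1.
by rewrite actB actZ E1 opprB addrA subrK.
Qed.

(** It is enough to treat t, its inverse and units. For t and its inverse the relation w E = lam' w
    t E modulo A[B]E, with t w t = w, computes the action on w E; units act on w E by a scalar. *)
Lemma gspan_tor y x : y != 0 -> gspan x -> gspan (act (tor y) x).
Proof.
move=> y0.
have T x' : gspan x' -> gspan (act t x').
  apply: gspan_act_w; last by rewrite g10_of_tor ?p_neq0.
  exists lam'; have h0 := w_tp_step 0; rewrite expr0 tor1 mulg1 expr1 in h0.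
  have := bspan_act (g10_of_tor p_neq0) h0; rewrite actB actZ -(actM t (w * t)%g).
  have -> : (t * (w * t))%g = w.
    rewrite w_tor ?p_neq0 // mulgA -torM ?invr_eq0 ?conj_eq0 ?p_neq0 //.
    by rewrite conj_nat mulfV ?p_neq0 // tor1 mul1g.
  by [].
have T' x' : gspan x' -> gspan (act (tor p%:R^-1) x').
  have pv0 : (p%:R^-1 : L) != 0 by rewrite invr_eq0 p_neq0.
  apply: gspan_act_w; last by rewrite g10_of_tor.
  exists lam; have h0 := w_tp_step 0; rewrite expr0 tor1 mulg1 expr1 in h0.
  have := bspanZ (- lam) h0; rewrite scalerBr scalerA mulNr ll' !scaleNr scale1r opprK.
  rewrite addrC -[act _ (act w E)]actM.
  have -> : (tor p%:R^-1 * w)%g = (w * t)%g by rewrite w_tor ?p_neq0 // conj_nat.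
  by [].
have U z x' : z != 0 -> padic_norm (nrm z) = 1 -> gspan x' -> gspan (act (tor z) x').
  move=> z0 nz; apply: gspan_act_w; last by rewrite g10_of_tor.
  have cz0 : (c z)^-1 != 0 by rewrite invr_eq0 conj_eq0.
  have [|d hd] := E_tor cz0; first by rewrite nrmV nrm_conj padic_normV nz invr1.
  have wz : (tor z * w = w * tor (c z)^-1)%g.
    by rewrite w_tor // conjV (conjK ce dec) invrK.
  by rewrite -actM wz actM hd actZ; exact/gspanZ/gspan_w.
have [a [b [z [z0 nz yz]]]] := unif_dec y0.
have {}yz : y = p%:R ^+ a * p%:R^-1 ^+ b * z.
  by rewrite mulrAC -yz exprVn mulfK ?pX_neq0.
have pv0 k : (p%:R^-1 : L) ^+ k != 0 by rewrite expf_neq0 // invr_eq0 p_neq0.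
move=> hx; rewrite yz !torM ?mulf_neq0 ?pX_neq0 // !actM.
have Ta k x' : gspan x' -> gspan (act (tp k) x').
  elim: k x' => [|k IHk] x' h; first by rewrite expr0 tor1 act1.
  by rewrite tpS actM; apply/IHk/T.
have Ta' k x' : gspan x' -> gspan (act (tor (p%:R^-1 ^+ k)) x').
  elim: k x' => [|k IHk] x' h; first by rewrite expr0 tor1 act1.
  by rewrite exprSr torM ?invr_eq0 ?p_neq0 // actM; apply/IHk/T'.
by apply: Ta; apply: Ta'; apply: U.
Qed.

(** On A[B]E the torus part moves across w, and what remains is w u_a E: this is w E if a is in Z_p,
    and lies in A[B]E by [w_up_bspan] otherwise. *)
Lemma gspan_act_weyl x : gspan x -> gspan (act w x).
Proof.
case=> d hx; rewrite -(subrK (d *: act w E) x) actD actZ.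
apply: gspanD; last first.
  rewrite -actM w2 act1; apply/gspanZ/bspan_gspan; rewrite -[E]act1.
  by apply: bspan_mem; exact: g10_1.
have [s sJ ->] := hx; rewrite act_sum; apply: gspan_sum => u us.
rewrite actZ; apply: gspanZ.
have [y [a [y0 ->]]] := borel_dec hp ce dec (sJ u us).
have cy0 : (c y)^-1 != 0 by rewrite invr_eq0 conj_eq0.
rewrite -actM mulgA w_tor // -mulgA actM; apply: gspan_tor => //.
have [ha|ha] := boolP (ball 0 a); first by rewrite actM E_up //; exact: gspan_w.
apply: bspan_gspan; have := w_up_bspan (n := 0) ha.
by rewrite expr0 tor1 act1.
Qed.

Lemma gspan_act g x : gspan x -> gspan (act g x).
Proof.
move=> hx; have [g0|g0] := eqVneq (g10 g) 0.
  have [y [a [y0 ->]]] := borel_dec hp ce dec g0.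
  by rewrite actM; apply: gspan_tor => //; exact: gspan_up.
have [b ->] := bigcell_dec hp ce dec g0; rewrite !actM.
apply: gspan_tor; first by rewrite invr_eq0 conj_eq0.
by apply/gspan_up/gspan_act_weyl/gspan_up.
Qed.

Lemma gspan_E g : gspan (act g E).
Proof.
by apply: gspan_act; rewrite -[E]act1; apply/bspan_gspan/bspan_mem; exact: g10_1.
Qed.

Lemma gspan_ind (P : W -> Prop) : P 0 ->
  (forall x r g, P x -> P (x + r *: act g E)) -> forall x, gspan x -> P x.
Proof.
move=> P0 PD x [d [s _ /eqP]]; rewrite subr_eq => /eqP->; apply: (PD).
elim: s => [|u s IHs]; first by rewrite big_nil.
by rewrite big_cons addrC; exact: PD.
Qed.

(** All translates have the same level n and range over one grid; independence is available for such
    families, both in V and for functions. *)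
Definition filled n (x : W) : Prop := exists a : 'I_(q ^ (n + n)) -> R,
  x = \sum_i a i *: act (up (- grid n i)) (act (tp n) E).

Lemma filledD n x y : filled n x -> filled n y -> filled n (x + y).
Proof.
move=> [a ->] [b ->]; exists (fun i => a i + b i); rewrite -big_split.
by apply: eq_bigr => i _; rewrite scalerDl.
Qed.

Lemma filledZ n r x : filled n x -> filled n (r *: x).
Proof.
move=> [a ->]; exists (fun i => r * a i); rewrite scaler_sumr.
by apply: eq_bigr => i _; rewrite scalerA.
Qed.

Lemma filled_sum n (I : eqType) (s : seq I) (F : I -> W) :
  (forall i, i \in s -> filled n (F i)) -> filled n (\sum_(i <- s) F i).
Proof.
move=> h; rewrite big_seq; elim/big_rec: _ => [|i x Pi]; last exact/filledD/h.
by exists (fun=> 0); rewrite big1 // => i _; rewrite scale0r.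
Qed.

Lemma act_tp_up n a : ball n%:Z a -> act (up a) (act (tp n) E) = act (tp n) E.
Proof.
move=> ha; rewrite -actM (up_tor hp ce dec) ?pX_neq0 // actM E_up //.
by rewrite nrm_pX exprnN ballMq // sub0r opprK.
Qed.

Lemma filled_tp n r : ball (- n%:Z) r -> filled n (act (up r) (act (tp n) E)).
Proof.
move=> hr; have [i _ hi] := grid_ex hp (etrans (ballN _ r) hr).
exists (fun j => (j == i)%:R); rewrite (bigD1 i) //= eqxx scale1r.
rewrite big1 ?addr0 => [|j /negbTE->]; last by rewrite scale0r.
rewrite -[in LHS](subrK (- grid n i) (r)) opprK addrC upD // actM act_tp_up //.
by rewrite -ballN opprD.
Qed.

(** d is the number of refinements from the level of y down to n. The bound d <= n + n keeps the
    translations created on the way inside q^-n Z_p. *)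
Lemma filled_tor n d y r : y != 0 -> (d <= n + n)%N ->
  padic_norm (nrm y) = q%:R ^ (- (n%:Z - d%:Z)) -> ball (- n%:Z) r ->
  filled n (act (up r) (act (tor y) E)).
Proof.
elim: d y r => [|d IHd] y r y0 dn ny hr.
  have z0 : y / p%:R ^+ n != 0 by rewrite mulf_neq0 ?invr_eq0 ?pX_neq0.
  have [|d hd] := E_tor z0.
    rewrite nrmM nrmV nrm_pX padic_normM padic_normV ny padic_normX padic_normq //.
    by rewrite exprVn invrK subr0 exprnP -expfzDr ?qQ_neq0 // addNr expr0z.
  have -> : tor y = (tp n * tor (y / p%:R ^+ n))%g.
    by rewrite -torM ?pX_neq0 // mulrC divfK ?pX_neq0.
  by rewrite actM hd !actZ; apply/filledZ/filled_tp.
rewrite tor_refine // actZ act_sum; apply/filledZ/filled_sum => j _.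
rewrite -actM -upD //; apply: IHd; rewrite ?mulf_neq0 ?p_neq0 //.
- exact: ltnW.
- rewrite nrmM nrm_p padic_normM ny padic_normq // -[X in X^-1]expr1z invr_expz -expfzDr ?qQ_neq0 //.
  by congr (_ ^ _); lia.
- rewrite ballD //; have : ball (n%:Z - d.+1%:Z) (nrm y) by rewrite /ball ny.
  by move=> hb; have := ballM hp hb (ball_natr hp Qp j); apply: ball_le => //; lia.
Qed.

Lemma filled_borel g : g10 g = 0 -> exists N, forall n, (N <= n)%N -> filled n (act g E).
Proof.
move=> g0; have [y [a [y0 ->]]] := borel_dec hp ce dec g0.
have [i hi] := val_ex hp e0 ce dec unr y0.
have [m hm] := ball_ex hp (nrm y * a).
exists (`|i| + m)%N => n hn; rewrite (tor_up hp ce dec) // actM.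
apply: (@filled_tor n (absz (n%:Z - i))) => //; first by lia.
  by rewrite hi; congr (_ ^ _); lia.
by apply: ball_le hm => //; lia.
Qed.

Lemma bspan_filled x : bspan x -> exists n, filled n x.
Proof.
case=> s sJ ->; suff [N hN] : exists N, forall n, (N <= n)%N ->
    forall u, u \in s -> filled n (act u.2 E).
  by exists N; apply: filled_sum => u us; apply/filledZ/hN.
elim: s sJ => [|u s IHs] sJ; first by exists 0%N.
have [|N hN] := IHs; first by move=> u' us; apply: sJ; rewrite inE us orbT.
have [|M hM] := @filled_borel u.2; first by apply: sJ; rewrite inE eqxx.
exists (maxn N M) => n; rewrite geq_max => /andP[h1 h2] u'.
by rewrite inE => /orP[/eqP->|]; [exact: hM|exact: hN].
Qed.

End NormalForm.

(** * The character of the torus defined by an ordinary vector *)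

Section TorusCharacter.
Variables (p : nat) (hp : prime p) (Qp : padicField p) (L : fieldExtType Qp).
Variable c : {lrmorphism L -> L}.
Variables (e : L) (e0 : e != 0) (ce : c e = - e).
Hypothesis dec : forall y : L, exists a b : Qp, y = a%:A + b *: e.
Local Notation G := (U11 c).
Local Notation nrm := (nrm hp ce dec).
Local Notation tor := (tor c).
Local Notation q := (p ^ 2)%N.
Local Notation t := (tor p%:R).
Local Notation p_neq0 := (p_neq0 hp L).
Local Notation tor1 := (tor1 ce dec).
Local Notation torM := (torM ce dec).
Hypothesis unr : unramified L.
Variables (O : comNzRingType) (k : fieldType) (res : {rmorphism O -> k}).
Hypothesis res_surj : forall y, exists x, res x = y.
Variable chi : schar G k.
Local Notation pi0 := (twist_rep chi (steinberg hp c k)).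
Local Notation ebar := (ebar hp e0 ce dec chi).
Variables (A : artAlg res) (V : srep G A) (phi : V -> pi0).
Hypothesis Lf : is_lift phi.
Local Notation rA := (art_res A).
Variables (v : V) (lam : A).
Hypotheses (ve : phi v = ebar) (fv : ufixed e v) (hv : hecke e v = lam *: v).
Hypothesis lt : rA lam = chi t.

(* y = p ^ (a - b) z with z a unit, and d = lam ^ (a - b) d'; both relations are
   cleared of negative powers as A carries no inverse operation. *)
Definition tor_scalar (y : L) (d : A) : Prop :=
  exists (a b : nat) (z : L) (d' : A), [/\ z != 0, padic_norm (nrm z) = 1,
    y * p%:R ^+ b = p%:R ^+ a * z, srep_act (tor z) v = d' *: v &
    d * lam ^+ b = lam ^+ a * d'].

Lemma lamX_inj n d d' : d * lam ^+ n = d' * lam ^+ n -> d = d'.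
Proof.
have [lam' ll] := lam_unit res_surj lt.
move=> /(congr1 (fun x => x * lam' ^+ n)).
by rewrite /= -!mulrA -exprMn ll expr1n !mulr1.
Qed.

Lemma tor_scalar_ex y : y != 0 -> exists d, tor_scalar y d.
Proof.
move=> y0; have [a [b [z [z0 nz yz]]]] := unif_dec hp e0 ce dec unr y0.
have [d' hd] := tor_unit_v res_surj Lf ve fv hv lt z0 nz.
have [lam' ll] := lam_unit res_surj lt.
exists (lam ^+ a * d' * lam' ^+ b), a, b, z, d'; split=> //.
by rewrite -mulrA -exprMn [lam' * _]mulrC ll expr1n mulr1.
Qed.

(** Norms give a - b = a' - b', hence z = z', and the unit scalars agree because v is torsion
    free. *)
Lemma tor_scalar_uniq y d d' : tor_scalar y d -> tor_scalar y d' -> d = d'.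
Proof.
move=> [a [b [z [s [z0 nz yz sz dE]]]]] [a' [b' [z' [s' [z0' nz' yz' sz' dE']]]]].
have E : p%:R ^+ (a + b') * z = p%:R ^+ (a' + b) * z'.
  rewrite !exprD -[LHS]mulrA [_ ^+ b' * z]mulrC mulrA -yz.
  by rewrite -[RHS]mulrA [_ ^+ b * z']mulrC [RHS]mulrA -yz' mulrAC.
have En : (a + b' = a' + b)%N.
  have := congr1 (fun x => padic_norm (nrm x)) E.
  rewrite !nrmM !nrm_pX !padic_normM nz nz' !mulr1 !exprnP !padic_normqz //.
  have q1 : (1 : rat) < q%:R by exact: qQ_gt1.
  by move=> /(ieexprIz (lt_trans ltr01 q1) (negbT (gt_eqF q1))) /eqP; lia.
have {}E : z = z' by apply: (mulfI (pX_neq0 hp L (a + b'))); rewrite E En.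
have sE : s = s' by apply: (v_inj res_surj Lf ve); rewrite -sz -sz' E.
apply: (@lamX_inj (b + b')); rewrite exprD mulrA dE -mulrA [s * _]mulrC mulrA.
rewrite mulrA -exprD En exprD sE [RHS]mulrAC dE' mulrAC.
by [].
Qed.

(** The default 0 is reached only at y = 0. *)
Definition tau (y : L) : A := xget 0 [set d | tor_scalar y d].

Lemma tauP y : y != 0 -> tor_scalar y (tau y).
Proof.
by move=> /tor_scalar_ex y0; apply: (@xgetPex _ 0 [set d | tor_scalar y d]).
Qed.

Lemma tauE y d : tor_scalar y d -> tau y = d.
Proof.
move=> h; apply: tor_scalar_uniq (h).
by apply: (@xgetPex _ 0 [set d | tor_scalar y d]); exists d.
Qed.

Lemma tau_unit y d : y != 0 -> padic_norm (nrm y) = 1 ->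
  srep_act (tor y) v = d *: v -> tau y = d.
Proof.
move=> y0 ny hd; apply: tauE; exists 0%N, 0%N, y, d.
by rewrite !expr0 !mulr1 !mul1r.
Qed.

Lemma tau_unit_act y : y != 0 -> padic_norm (nrm y) = 1 ->
  srep_act (tor y) v = tau y *: v.
Proof.
move=> y0 ny; have [d hd] := tor_unit_v res_surj Lf ve fv hv lt y0 ny.
by rewrite (tau_unit y0 ny hd).
Qed.

Lemma tau1 : tau 1 = 1.
Proof.
apply: tau_unit; rewrite ?oner_neq0 ?nrm1 ?padic_norm1 // tor1 srep_act1 scale1r.
by [].
Qed.

Lemma tauM x y : x != 0 -> y != 0 -> tau (x * y) = tau x * tau y.
Proof.
move=> /tauP[a [b [z [s [z0 nz xz sz dE]]]]] /tauP[a' [b' [z' [s' [z0' nz' yz sz' dE']]]]].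
apply: tauE; exists (a + a')%N, (b + b')%N, (z * z'), (s * s'); split.
- by rewrite mulf_neq0.
- by rewrite nrmM padic_normM nz nz' mulr1.
- by rewrite !exprD mulrACA xz yz mulrACA.
- by rewrite torM // srep_actM sz' srep_actZ sz scalerA mulrC.
- by rewrite !exprD mulrACA dE dE' mulrACA.
Qed.

Lemma tau_p : tau p%:R = lam.
Proof.
apply: tauE; exists 1%N, 0%N, 1, 1; split; rewrite ?oner_neq0 ?nrm1 ?padic_norm1 //.
by rewrite tor1 srep_act1 scale1r.
Qed.

Lemma tau_near1 : exists m, forall x : L, pint m (x - 1) -> tau x = 1.
Proof.
have [K oK Kv] := srep_smooth v; have [m mK] := open_subgroup_cong oK.
exists m.+1 => x xm; have [x0 _ nx] := pint1_unit hp ce dec xm.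
apply: tau_unit => //; rewrite scale1r; apply/Kv/mK.
by move=> i j; apply: pint_le (tor_cong hp ce dec xm i j).
Qed.

Lemma tau_res y : y != 0 -> rA (tau y) = chi (tor y).
Proof.
move=> y0; have [a [b [z [s [z0 nz yz sz dE]]]]] := tauP y0.
have chiX n : chi (tor (p%:R ^+ n)) = chi t ^+ n.
  elim: n => [|n IHn]; first by rewrite expr0 tor1 schar1.
  by rewrite !exprS torM ?p_neq0 ?pX_neq0 // scharM IHn.
(* Evaluation at 0 suffices: [ebar] takes there the nonzero value chi w. *)
have sE : rA s = chi (tor z).
  have := congr1 (fun x => ev0 e (phi x) 0) sz.
  rewrite /= (lift_equiv Lf) (lift_scale Lf) ve ev0_tor // mulr0 [ev0 e (rA s *: _) _]ev0Z //.
  rewrite ev0_ebar ball0 // mulr1 => /(mulIf (chi_w_neq0 chi)).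
  by [].
have := congr1 rA dE; rewrite !rmorphM !rmorphXn lt sE -!chiX => E.
have := congr1 (fun x => chi (tor x)) yz.
rewrite /= !torM ?pX_neq0 // !scharM -E => /(mulIf (chi_neq0 chi _))/esym.
by [].
Qed.

End TorusCharacter.

(** * The graph of the map from functions to V *)

Section Graph.
Variables (p : nat) (hp : prime p) (Qp : padicField p) (L : fieldExtType Qp).
Variable c : {lrmorphism L -> L}.
Variables (e : L) (e0 : e != 0) (ce : c e = - e).
Hypothesis dec : forall y : L, exists a b : Qp, y = a%:A + b *: e.
Local Notation G := (U11 c).
Local Notation nrm := (nrm hp ce dec).
Local Notation up := (up c e).
Local Notation tor := (tor c).
Local Notation w := (w c).
Local Notation lo := (lo c e).
Local Notation q := (p ^ 2)%N.
Local Notation grid := (grid Qp).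
Local Notation t := (tor p%:R).
Hypothesis unr : unramified L.
Variables (O : comNzRingType) (k : fieldType) (res : {rmorphism O -> k}).
Hypothesis res_surj : forall y, exists x, res x = y.
Variable chi : schar G k.
Local Notation pi0 := (twist_rep chi (steinberg hp c k)).
Local Notation ebar := (ebar hp e0 ce dec chi).
Variables (A : artAlg res) (V : srep G A) (phi : V -> pi0).
Hypothesis Lf : is_lift phi.
Local Notation rA := (art_res A).
Variables (v : V) (lam : A).
Hypotheses (ve : phi v = ebar) (fv : ufixed e v) (hv : hecke e v = lam *: v).
Hypothesis lt : rA lam = chi t.
Local Notation tau := (tau hp ce dec v lam).
Local Notation tau1 := (tau1 res_surj Lf ve lt).
Local Notation tauM := (tauM unr res_surj Lf ve fv hv lt).
Local Notation W := ((G -> A^o) * V)%type.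

Definition graph_act (g : G) (x : W) : W := (fun h => x.1 (h * g)%g, srep_act g x.2).
Definition graph_base : W := (cell e tau : G -> A^o, v).
Local Notation act := graph_act.
Local Notation E := graph_base.
Local Notation tp n := (tor (p%:R ^+ n)).

Lemma graph_act_linear g : linear (act g).
Proof. by move=> a x y; congr pair; rewrite /= srep_linear. Qed.

Lemma graph_act1 x : act 1%g x = x.
Proof.
case: x => f x; congr pair; last exact: srep_act1.
by apply/funext => h; rewrite mulg1.
Qed.

Lemma graph_actM g h x : act (g * h)%g x = act g (act h x).
Proof.
congr pair; last exact: srep_actM.
by apply/funext => h'; rewrite mulgA.
Qed.

Lemma graph_fst_sum (I : Type) (r : seq I) (F : I -> W) g :
  (\sum_(i <- r) F i).1 g = \sum_(i <- r) (F i).1 g.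
Proof. exact: (big_morph (fun x : W => x.1 g)). Qed.

Lemma graph_snd_sum (I : Type) (r : seq I) (F : I -> W) :
  (\sum_(i <- r) F i).2 = \sum_(i <- r) (F i).2.
Proof. exact: (big_morph (fun x : W => x.2)). Qed.

Lemma graph_up a : ball 0 a -> act (up a) E = E.
Proof.
move=> ha; congr pair; last exact: fv.
by apply/funext => h; exact: cell_up.
Qed.

Lemma graph_ext (x y : W) : x.1 =1 y.1 -> x.2 = y.2 -> x = y.
Proof. by case: x y => [f x] [f' y] /= /funext-> ->. Qed.

Lemma graph_hecke : \sum_(i < q ^ 1) act (up i%:R) (act t E) = lam *: E.
Proof.
apply: graph_ext => [h|]; last by rewrite graph_snd_sum; exact: hv.
rewrite graph_fst_sum -[RHS]/(lam * cell e tau h) -[X in X * _](tau_p res_surj Lf ve lt).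
exact: (cell_hecke hp e0 ce dec tauM).
Qed.

Lemma graph_tor y : y != 0 -> padic_norm (nrm y) = 1 -> exists d, act (tor y) E = d *: E.
Proof.
move=> y0 ny; exists (tau y); apply: graph_ext => [h|].
  exact: (cell_tor e0 tauM).
exact: (tau_unit_act res_surj Lf ve fv hv lt).
Qed.

Lemma graph_lo : exists m : nat, forall a, ball m%:Z a -> act (lo a) E = E.
Proof.
have [K oK Kc] := cell_smooth hp e0 ce dec tauM (tau_near1 res_surj Lf ve lt).
have [K' oK' Kv] := srep_smooth v.
have [m mK] := open_subgroup_cong (open_subgroupI oK oK').
have [n hn] := lo_cong hp ce m; exists n => a /hn/mK[Ka Ka'].
by congr pair; [apply/funext => h; exact: Kc|exact: Kv].
Qed.

Local Notation Gam := (gspan act E).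

Lemma graphB x y : Gam x -> Gam y -> Gam (x - y).
Proof. by move=> hx hy; rewrite -scaleN1r; exact/gspanD/gspanZ. Qed.

Lemma graph_actP g x : Gam x -> Gam (act g x).
Proof.
have [lam' ll] := lam_unit res_surj lt.
exact: (gspan_act e0 unr graph_act_linear graph_act1 graph_actM ll graph_up
  graph_hecke graph_tor graph_lo).
Qed.

Lemma graph_baseP g : Gam (act g E).
Proof.
have [lam' ll] := lam_unit res_surj lt.
exact: (gspan_E e0 unr graph_act_linear graph_act1 graph_actM ll graph_up
  graph_hecke graph_tor graph_lo).
Qed.

Lemma graph_filled x : bspan act E x -> exists n, filled e act E n x.
Proof.
have [lam' ll] := lam_unit res_surj lt.
exact: (bspan_filled e0 unr graph_act_linear graph_actM ll graph_up
  graph_hecke graph_tor).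
Qed.

Lemma graph_cell n r a : (act (up (- r)) (act (tp n) E)).1 (w * up a)%g =
  tau (p%:R ^+ n) * (ball n%:Z (a - r))%:R.
Proof.
rewrite /= -(mulgA w) -upD // (cell_torE hp e0 ce dec tauM) ?pX_neq0 //.
rewrite g10_up // g10_w oner_neq0 /= pos_up ?g10_w ?oner_neq0 // pos_w // add0r.
rewrite nrm_pX exprnN ballMq // sub0r opprK tau1.
by case: ifP.
Qed.

Lemma tau_pX_unit n : exists d, tau (p%:R ^+ n) * d = 1.
Proof.
exists (tau (p%:R ^+ n)^-1); rewrite -tauM ?invr_eq0 ?pX_neq0 // mulfV ?pX_neq0 //.
exact: tau1.
Qed.

Lemma filled_fst n (a : 'I_(q ^ (n + n)) -> A) b :
  (\sum_i a i *: act (up (- grid n i)) (act (tp n) E)).1 (w * up b)%g =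
  \sum_i a i * tau (p%:R ^+ n) * (ball n%:Z (b - grid n i))%:R.
Proof.
rewrite graph_fst_sum; apply: eq_bigr => i _; rewrite -mulrA -graph_cell.
by [].
Qed.

Lemma bspan_fst1 x : bspan act E x -> x.1 1%g = 0.
Proof.
case=> s sJ ->; rewrite graph_fst_sum big_seq big1 // => u /sJ u0.
rewrite -[LHS]/(u.1 * cell e tau (1 * u.2)%g) mul1g /cell u0 eqxx.
by rewrite mulr0.
Qed.

(** At a common level the V-components of the translates are independent by [tv_indep]. In
    [bspan_fst_eq0], evaluation at the points w u_b with b in the grid plays the same role. *)
Lemma bspan_snd_eq0 x : bspan act E x -> x.2 = 0 -> x = 0.
Proof.
move=> /graph_filled[n [a ->]] x0; apply: big1 => i _.
suff -> : a i = 0 by rewrite scale0r.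
apply: (tv_indep res_surj Lf ve (a := a)); rewrite -[RHS]x0 graph_snd_sum.
by [].
Qed.

Lemma bspan_fst_eq0 x : bspan act E x -> (forall a, x.1 (w * up a)%g = 0) -> x = 0.
Proof.
move=> /graph_filled[n [a ->]] x0; apply: big1 => i _.
suff -> : a i = 0 by rewrite scale0r.
have := x0 (grid n i); rewrite filled_fst (bigD1 i) //= subrr ball0 // mulr1.
rewrite big1 => [|j ji]; last first.
  case: (boolP (ball _ _)) => [hb|]; last by rewrite mulr0.
  case/eqP: ji; apply: val_inj; apply/esym.
  exact: (@grid_uniq _ hp Qp _ _ _ (ltn_ord i) (ltn_ord j)).
rewrite addr0; have [d hd] := tau_pX_unit n.
by move=> /(congr1 ( *%R^~ d)); rewrite /= -mulrA hd mulr1 mul0r.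
Qed.

(** The functions of A[B]E vanish at 1 while that of w E is 1 there, so the value at 1 is the
    coefficient of w E. *)
Lemma graph_bspan x : Gam x -> x.1 1%g = 0 -> bspan act E x.
Proof.
case=> d hx x1; have := bspan_fst1 hx.
rewrite -[LHS]/(x.1 1%g - d * cell e tau (1 * w)%g) x1 mul1g.
have -> : cell e tau w = 1.
  by have := cell_w hp e0 ce dec tau1 0; rewrite up0 // mulg1 ball0.
rewrite mulr1 sub0r => /eqP; rewrite oppr_eq0 => /eqP d0.
by move: hx; rewrite d0 scale0r subr0.
Qed.

Lemma graph_fst_eq0 x : Gam (0, x) -> x = 0.
Proof.
move=> hx; have /bspan_fst_eq0 := graph_bspan hx erefl.
by move=> /(_ (fun=> erefl))/(congr1 snd).
Qed.

Lemma graph_snd_eq0 f : Gam (f, 0) -> f 1%g = 0 -> f =1 fun=> 0.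
Proof.
move=> hf f1 g; have /bspan_snd_eq0 := graph_bspan hf f1.
by move=> /(_ erefl)/(congr1 (fun x => x.1 g)).
Qed.

(** By [tv_span], w v is a combination of Borel translates of v. Subtracting the same combination of
    translates of E from w E kills the V-component and leaves the value 1 at 1. *)
Lemma graph_kernel : exists f0 : G -> A^o, Gam (f0, 0) /\ f0 1%g = 1.
Proof.
have [y hy y2] : exists2 y, bspan act E y & y.2 = srep_act w v.
  have [s sX ->] := tv_span res_surj Lf ve (srep_act w v).
  elim: s sX => [|u s IHs] sX.
    by exists 0; rewrite ?big_nil //; exists [::]; rewrite ?big_nil.
  have [|y hy y2] := IHs; first by move=> u' us; apply: sX; rewrite inE us orbT.
  have [r [n hu]] := sX u (mem_head _ _).
  exists (u.1 *: act (up r * tp n)%g E + y); last first.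
    by rewrite big_cons -y2 hu /= srep_actM.
  apply: bspanD => //; apply/bspanZ/bspan_mem.
  by rewrite g10_borelM ?g10_of_up ?(g10_of_tor ce dec) ?pX_neq0.
exists (act w E - y).1; split.
  have -> : ((act w E - y).1, 0) = act w E - y.
    by apply: graph_ext => //=; rewrite y2 subrr.
  by apply: graphB; [exact: graph_baseP|exact: bspan_gspan].
rewrite -[LHS]/(cell e tau (1 * w)%g - y.1 1%g) (bspan_fst1 hy) mul1g subr0.
by have := cell_w hp e0 ce dec tau1 0; rewrite up0 // mulg1 ball0.
Qed.

Lemma graph_left x y b g : Gam x -> y != 0 ->
  x.1 (tor y * up b * g)%g = tau (c y)^-1 * x.1 g.
Proof.
move=> hx y0; move: x hx; apply: gspan_ind => [|x r h IHx]; first by rewrite mulr0.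
rewrite -[LHS]/(x.1 _ + r * cell e tau (_ * h)%g) IHx -mulgA.
rewrite (cell_left hp e0 ce dec tauM) // mulrCA -mulrDr.
by [].
Qed.

Lemma graph_smooth x : Gam x -> exists2 K : set G, open_subgroup K &
  forall g h, K h -> x.1 (g * h)%g = x.1 g.
Proof.
move: x; apply: gspan_ind => [|x r h [K oK IHx]].
  by exists setT => //; exact: open_subgroupT.
have [K' oK' Kc] := cell_smooth hp e0 ce dec tauM (tau_near1 res_surj Lf ve lt).
exists (K `&` [set g | K' (h^-1 * g * h)%g]).
  by apply: open_subgroupI => //; exact: open_subgroup_conj.
move=> g g' [/IHx K1 /(Kc (g * h)%g)]; rewrite !mulgA mulgK => K2.
rewrite -[LHS]/(x.1 _ + r * cell e tau (g * g' * h)%g) K1 K2.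
by [].
Qed.

(** Both sides are equivariant, so E decides: as tau reduces to chi on the torus, the inverse of chi
    times the reduction of 1_tau is chi w times the characteristic function of B w U_0. *)
Lemma graph_red x : Gam x -> exists2 f : ind (triv_char G k),
  forall h, f h = chi (h^-1)%g * rA (x.1 h) & St_class hp f = phi x.2.
Proof.
pose fE : ind (triv_char G k) := chi w *: stcell hp e0 ce dec (triv_char G k).
have fEE h : fE h = chi (h^-1)%g * rA (cell e tau h).
  rewrite -[LHS]/(chi w * cell e _ h) /cell.
  case: ifP => [/andP[h0 _]|_]; last by rewrite rmorph0 !mulr0.
  rewrite (tau_res unr res_surj Lf ve fv hv lt h0) mulr1.
  have [b hE] := bigcell_dec hp ce dec h0.
  have x0 : (c (g10 h))^-1 != 0 by rewrite invr_eq0 conj_eq0.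
  have : chi h = chi (tor (g10 h)) * chi w.
    by rewrite hE !scharM !schar_up // !mulr1 (schar_wtor ce dec) -?hE.
  move=> E1; have := scharV chi h; rewrite E1 => E2.
  transitivity (chi w * (chi (tor (g10 h)) * chi w * chi (h^-1)%g)).
    by rewrite E2 mulr1.
  transitivity (chi w * chi w * (chi (h^-1)%g * chi (tor (g10 h)))); first by ring.
  by rewrite schar_w2 mul1r.
move: x; apply: gspan_ind => [|x r g [f fh fx]].
  exists 0; first by move=> h; rewrite rmorph0 mulr0.
  rewrite (lift_map0 Lf).
  by have := St_classZ hp 0 (0 : ind (triv_char G k)); rewrite !scale0r.
exists (f + rA r *: (chi g *: ind_act hp g fE)).
  move=> h; rewrite -[LHS]/(f h + rA r * (chi g * fE (h * g)%g)) fh fEE.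
  rewrite -[x.1 h]/(x.1 h) -[(x + _).1 h]/(x.1 h + r * cell e tau (h * g)%g).
  rewrite rmorphD rmorphM mulrDr; congr (_ + _).
  rewrite invgM scharM; have := scharV chi g => E1.
  transitivity (chi g * chi (g^-1)%g * (chi (h^-1)%g * (rA r * rA (cell e tau (h * g)%g)))).
    by ring.
  by rewrite E1 mul1r.
rewrite St_classD !St_classZ fx -St_class_act St_classZ (lift_add Lf) (lift_scale Lf).
congr (_ + _ *: _); rewrite (lift_equiv Lf) ve.
by [].
Qed.

Section Kernel.
Variable f0 : G -> A.
Hypotheses (Gf0 : Gam (f0 : G -> A^o, 0)) (f01 : f0 1%g = 1).

(** The translate of f0 by g minus f0 g times f0 lies in the kernel and vanishes at 1, hence is 0 by
    [graph_snd_eq0]. *)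
Lemma kernelM h g : f0 (h * g)%g = f0 h * f0 g.
Proof.
have hG : Gam (act g (f0 : G -> A^o, 0) - f0 g *: ((f0 : G -> A^o, 0) : W)).
  by apply: graphB; [exact: graph_actP|exact: gspanZ].
have E1 : act g (f0 : G -> A^o, 0) - f0 g *: ((f0 : G -> A^o, 0) : W) = (fun h => f0 (h * g)%g - f0 g * f0 h : A^o, 0).
  by apply: graph_ext => //=; rewrite srep_act0 scaler0 subr0.
rewrite E1 in hG; apply/eqP; rewrite mulrC -subr_eq0; apply/eqP.
by apply: (graph_snd_eq0 hG); rewrite mul1g f01 mulr1 subrr.
Qed.

Lemma kernel_smooth : exists2 K : set G, open_subgroup K & forall g, K g -> f0 g = 1.
Proof.
have [K oK hK] := graph_smooth Gf0; exists K => // g /(hK 1%g).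
by rewrite mul1g /= f01.
Qed.

Definition kernel_char : schar G A := SChar f01 kernelM kernel_smooth.

(** By [graph_red] the inverse of chi times the reduction of f0 has class phi 0 = 0 in the Steinberg
    representation, so it is constant, equal to its value 1 at 1. *)
Lemma kernel_res g : rA (kernel_char g) = chi g.
Proof.
have [f fh] := graph_red Gf0; rewrite /= (lift_map0 Lf) => f_0.
have [a ha] : exists a, forall h, f h = a.
  have : St_class hp f = St_class hp 0.
    by rewrite f_0; have := St_classZ hp 0 (0 : ind (triv_char G k)); rewrite !scale0r.
  move=> /(quotient_classP (char_line_sub hp (triv_char G k)))[a ha].
  by exists a => h; have := ha h; rewrite -[LHS]/(f h - 0) subr0 mulr1.
have : f g = f 1%g by rewrite !ha.
rewrite !fh /= f01 rmorph1 invg1 schar1 !mulr1 => E1.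
by rewrite -[RHS]mulr1 -E1 mulrA scharV mul1r.
Qed.

Definition kernel_lift : char_lift chi A := CharLift kernel_res.
Local Notation s := kernel_lift.

Lemma kernel_tor y : y != 0 -> s (tor y) = tau (c y)^-1.
Proof.
move=> y0; have := graph_left 0 1%g Gf0 y0; rewrite /= up0 // !mulg1 f01 mulr1.
by [].
Qed.

Lemma graph_ind x : Gam x -> x.1 \in ind_pred s.
Proof.
move=> hx; apply/ind_predP; split; last exact: graph_smooth.
move=> g u h /(torus_tor ce dec)[y y0 ->] /(unipotent_up hp ce dec)[b ->].
by rewrite graph_left // kernel_tor.
Qed.

(** f minus f(1) f0 vanishes at 1 and has compact support on the big cell, where it is a combination
    of translates of 1_tau. *)
Lemma graph_total (f : ind s) : exists x, Gam (f : G -> A^o, x).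
Proof.
have [n hn] := ind_bound hp e0 ce dec f; have [d hd] := tau_pX_unit n.
(* f0 carries the value at 1; the factor d undoes the factor tau (p^n) of [graph_cell]. *)
pose y : W := f 1%g *: ((f0 : G -> A^o, 0) : W) + \sum_(i < q ^ (n + n))
  (ev_ind e f (grid n i) * d) *: act (up (- grid n i)) (act (tp n) E).
have hy : Gam y.
  apply: gspanD; first exact: gspanZ.
  by apply: gspan_sum => i _; apply: gspanZ; rewrite -graph_actM; exact: graph_baseP.
have y1 : y.1 1%g = f 1%g.
  rewrite -[LHS]/(f 1%g * f0 1%g + (\sum_i _ *: _).1 1%g) f01 mulr1 graph_fst_sum.
  rewrite big1 ?addr0 // => i _; set b := _ * d.
  rewrite -[LHS]/(b * cell e tau (1 * up (- grid n i) * tp n)%g) mul1g /cell.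
  by rewrite g10_borelM ?g10_of_up ?(g10_of_tor ce dec) ?pX_neq0 // eqxx mulr0.
have yw a : y.1 (w * up a)%g = f (w * up a)%g.
  rewrite -[LHS]/(f 1%g * f0 (w * up a)%g + (\sum_i _ *: _).1 (w * up a)%g) filled_fst.
  have -> : f0 (w * up a)%g = s w.
    by rewrite kernelM; have := schar_up hp ce s a => /= ->; rewrite mulr1.
  under eq_bigr do rewrite -(mulrA _ d) (mulrC d) hd mulr1.
  by rewrite -(bdper_grid hp hn) addrC subrK.
have -> : (f : G -> A^o) = y.1.
  have := @ind_ext _ hp _ _ _ _ ce dec _ s f (Ind (graph_ind hy)) (esym y1) _.
  by move=> /(_ (fun a => esym (yw a))) ->.
by exists y.2; case: y hy {y1 yw}.
Qed.

(** Functions that differ by a multiple of f0 have the same partner, so the map factors through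
    St(s). *)
Lemma graph_map_uniq (f f' : ind s) x x' a :
  Gam (f : G -> A^o, x) -> Gam (f' : G -> A^o, x') ->
  (forall g, f g - f' g = a * s g) -> x = x'.
Proof.
move=> hx hx' ff; apply/eqP; rewrite -subr_eq0; apply/eqP/graph_fst_eq0.
have := graphB (graphB hx hx') (gspanZ a Gf0).
congr gspan; apply: graph_ext => [g|] /=; last by rewrite scaler0 subr0.
rewrite -[LHS]/(f g - f' g - a * f0 g) ff.
by rewrite subrr.
Qed.

Lemma steinberg_iso_kernel :
  lift_iso (Lift (St_map_is_lift hp e0 ce dec res_surj s)) (Lift Lf).
Proof.
have [psi hpsi] := choice graph_total.
pose Psi (x : St_rep hp s) : V := psi (mrepr x).
have PsiE (f : ind s) x : Gam (f : G -> A^o, x) -> Psi (St_class hp f) = x.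
  move=> hx; have [a ha] := quotient_repr (char_line_sub hp s) f.
  by apply: (graph_map_uniq (hpsi _) hx (a := a)) => g; rewrite -ha.
apply: (lift_morph_iso res_surj (l := Lift _) (l' := Lift Lf) (psi := Psi)).
- move=> a; elim/St_W=> f; elim/St_W=> f'.
  rewrite -St_classZ -St_classD (PsiE f _ (hpsi f)) (PsiE f' _ (hpsi f')).
  apply: PsiE; have := gspanD (gspanZ a (hpsi f)) (hpsi f').
  by congr gspan; apply: graph_ext.
- move=> g; elim/St_W=> f; rewrite St_class_act (PsiE f _ (hpsi f)); apply: PsiE.
  exact: (graph_actP g (hpsi f)).
- elim/St_W=> f; rewrite (PsiE f _ (hpsi f)) /= St_map_class.
  have [f' fh <-] := graph_red (hpsi f); congr St_class.
  by apply: val_inj; apply/funext => h; rewrite /= fh.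
Qed.

End Kernel.

End Graph.

(** * Every lift of the Steinberg representation comes from a character *)

Section Surjectivity.
Variables (p : nat) (hp : prime p) (Qp : padicField p) (L : fieldExtType Qp).
Variable c : {lrmorphism L -> L}.
Variables (e : L) (e0 : e != 0) (ce : c e = - e).
Hypothesis dec : forall y : L, exists a b : Qp, y = a%:A + b *: e.
Local Notation G := (U11 c).
Hypothesis unr : unramified L.
Variables (O : comNzRingType) (k : fieldType) (res : {rmorphism O -> k}).
Hypothesis res_surj : forall y, exists x, res x = y.
Variables (chi : schar G k) (A : artAlg res).

Lemma lift_steinberg_ex (l : Defs.lift (twist_rep chi (steinberg hp c k)) A) :
  exists s : char_lift chi A, lift_iso (Lift (St_map_is_lift hp e0 ce dec res_surj s)) l.
Proof.
case: l => V phi Lf; have [v [lam [ve fv hv lt]]] := ordinary_lift e0 ce dec res_surj Lf.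
have [f0 [Gf0 f01]] := graph_kernel unr res_surj Lf ve fv hv lt.
exists (kernel_lift unr res_surj Lf ve fv hv lt Gf0 f01).
exact: steinberg_iso_kernel.
Qed.

End Surjectivity.

(** * The character is determined by its Steinberg lift *)

Section Injectivity.
Variables (p : nat) (hp : prime p) (Qp : padicField p) (L : fieldExtType Qp).
Variable c : {lrmorphism L -> L}.
Variables (e : L) (e0 : e != 0) (ce : c e = - e).
Hypothesis dec : forall y : L, exists a b : Qp, y = a%:A + b *: e.
Local Notation G := (U11 c).
Local Notation nrm := (nrm hp ce dec).
Local Notation up := (up c e).
Local Notation tor := (tor c).
Local Notation w := (w c).
Local Notation lo := (lo c e).
Local Notation q := (p ^ 2)%N.
Local Notation t := (tor p%:R).
Local Notation p_neq0 := (p_neq0 hp L).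
Local Notation tor1 := (tor1 ce dec).
Local Notation torM := (torM ce dec).
Hypothesis unr : unramified L.

(** Characters are trivial on upper and lower unipotent elements, so [w_up] at a = 1 expresses the
    value at w by one on the torus. *)
Lemma schar_ext_tor (R : comNzRingType) (s s' : schar G R) : s t = s' t ->
  (forall y, y != 0 -> padic_norm (nrm y) = 1 -> s (tor y) = s' (tor y)) -> s =1 s'.
Proof.
move=> st su.
have mulI g h : s (g * h)%g = s' (g * h)%g -> s h = s' h -> s g = s' g.
  rewrite !scharM => E1 E2; have := congr1 ( *%R^~ (s (h^-1)%g)) E1.
  by rewrite /= E2 -!mulrA -[in X in _ = X -> _]E2 !scharV !mulr1 -E2 scharV mulr1.
have sM g h : s g = s' g -> s h = s' h -> s (g * h)%g = s' (g * h)%g.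
  by rewrite !scharM => -> ->.
have sX n : s (tor (p%:R ^+ n)) = s' (tor (p%:R ^+ n)).
  elim: n => [|n IHn]; first by rewrite expr0 tor1 !schar1.
  by rewrite exprS torM ?p_neq0 ?pX_neq0 //; exact: sM.
have sT y : y != 0 -> s (tor y) = s' (tor y).
  move=> y0; have [a [b [z [z0 nz yz]]]] := unif_dec hp e0 ce dec unr y0.
  apply: mulI (sX b); rewrite -torM ?pX_neq0 // yz torM ?pX_neq0 //.
  by apply: sM => //; exact: su.
have sU a : s (up a) = s' (up a) by rewrite !schar_up.
have sw : s w = s' w.
  have lo1 (s1 : schar G R) a : s1 (lo a) = 1.
    by rewrite !scharM schar_up // mulr1 schar_w2.
  apply: mulI (sU 1); rewrite (w_up hp e0 ce dec (oner_neq0 _)).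
  apply: (sM); last by rewrite !lo1.
  apply: (sM) => //; apply: sT.
  by rewrite oppr_eq0 invr_eq0 scale1r.
move=> g; have [g0|g0] := eqVneq (g10 g) 0.
  have [y [a [y0 ->]]] := borel_dec hp ce dec g0.
  by apply: sM => //; exact: sT.
have [b ->] := bigcell_dec hp ce dec g0.
by do 3!(apply: (sM) => //); apply: sT; rewrite invr_eq0 conj_eq0.
Qed.

Section BaseVector.
Variables (R : comNzRingType) (s : schar G R).
Local Notation stbase := (stbase hp e0 ce dec s).

Lemma stbase_fixed : ufixed e stbase.
Proof.
by move=> b hb; apply: (ev_inj ce dec) => a; rewrite ev_up // !ev_base ballDr.
Qed.

Lemma stbase_hecke : hecke e stbase = s t *: stbase.
Proof.
apply: (ev_inj ce dec) => a; rewrite evZ //.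
have ev_0 : ev e (0 : St_rep hp s) a = 0.
  by have := evZ ce 0 (0 : St_rep hp s) a; rewrite scaler0 mul0r.
rewrite (big_morph (fun x : St_rep hp s => ev e x a) (fun x y => evD ce x y a) ev_0).
rewrite ev_base -(ball_hecke hp) mulr_sumr; apply: eq_bigr => i _.
by rewrite ev_up // ev_tor ?p_neq0 // nrm_p ev_base.
Qed.

Lemma stbase_tor y : y != 0 -> padic_norm (nrm y) = 1 ->
  srep_act (tor y) stbase = s (tor y) *: stbase.
Proof.
move=> y0 ny; apply: (ev_inj ce dec) => a; rewrite ev_tor // evZ // !ev_base.
by rewrite ballMnorm1 // padic_normV ny invr1.
Qed.

End BaseVector.

Variables (O : comNzRingType) (k : fieldType) (res : {rmorphism O -> k}).
Hypothesis res_surj : forall y, exists x, res x = y.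
Variables (chi : schar G k) (A : artAlg res).

Lemma St_map_base (s : char_lift chi A) :
  St_map hp s (stbase hp e0 ce dec s) = ebar hp e0 ce dec chi.
Proof.
apply: (ev0_inj ce dec) => a; rewrite ev0_ebar /ev0 ev_St_map // ev_base.
by rewrite rmorph_nat.
Qed.

(** The isomorphism sends one base vector to a multiple of the other by [ordinary_uniq], with a
    factor d of residue 1 since both reduce to [ebar]. Cancelling d identifies the eigenvalues,
    hence the characters on the torus. *)
Lemma St_lift_inj (s s' : char_lift chi A)
  (H : is_lift (St_map hp s)) (H' : is_lift (St_map hp s')) :
  lift_iso (Lift H) (Lift H') -> s = s'.
Proof.
case=> psi [pl _ pg pm]; pose v := stbase hp e0 ce dec s; pose v' := stbase hp e0 ce dec s'.
have pZ a u : psi (a *: u) = a *: psi u.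
  have p0 : psi 0 = 0.
    by have := pl (-1) 0 0; rewrite scaler0 addr0 scaleN1r addNr.
  by have := pl a u 0; rewrite p0 !addr0.
have ph : hecke e (psi v : St_rep hp s') = psi (hecke e v).
  have := linear_sumZ pl (index_enum 'I_(q ^ 1)) (fun=> 1)
    (fun i => srep_act (up i%:R) (srep_act t v)).
  rewrite /hecke; under eq_bigr do rewrite scale1r.
  by under [in RHS]eq_bigr do rewrite scale1r !pg; move=> ->.
have [|||d vd] := @ordinary_uniq _ _ _ _ _ _ _ _ _ _ _ _ res_surj _ _ _ _ H' v' _
  (St_map_base s') (stbase_fixed s') (stbase_hecke s') (psi v) (s t).
- by move=> b hb; rewrite -pg stbase_fixed.
- by rewrite ph stbase_hecke pZ.
- by rewrite char_lift_res chi_neq0.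
have rd : art_res A d = 1.
  have := pm v; rewrite /= vd (lift_scale H') !St_map_base.
  move=> /(congr1 (fun x => ev0 e x 0)); rewrite ev0Z // ev0_ebar ball0 // mulr1.
  by rewrite -[RHS]mul1r => /(mulIf (chi_w_neq0 chi)).
have [d' dd] : exists d', d * d' = 1.
  by apply: (art_unit res_surj); rewrite rd; apply/eqP; exact: oner_neq0.
have cancel a b : a *: (d *: v') = d *: (b *: v') -> a = b.
  rewrite !scalerA => /(v_inj res_surj H' (St_map_base s')).
  rewrite [d * b]mulrC => /(congr1 ( *%R^~ d')).
  by rewrite /= -!mulrA dd !mulr1.
apply: char_lift_ext; apply: schar_ext_tor => [|y y0 ny]; apply: cancel.
  by rewrite -(stbase_hecke s') -heckeZ -vd -pZ -stbase_hecke ph.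
by rewrite -(stbase_tor s' y0 ny) -srep_actZ -vd -pZ -stbase_tor // pg.
Qed.

End Injectivity.

Theorem mainTheorem4
  (p : nat) (hp : prime p) (Qp : padicField p)
  (Qp2 : fieldExtType Qp) (Qp2_quadratic : \dim {: Qp2} = 2%N)
  (Qp2_unramified : unramified Qp2)
  (c : {lrmorphism Qp2 -> Qp2}) (c_nontrivial : exists x, c x <> x)
  (E : fieldExtType Qp)
  (k : fieldType) (res : {rmorphism intRing E -> k})
  (res_surj : forall y : k, exists x : intRing E, res x = y)
  (chi : schar (U11 c) k) :
  exists eta : forall A : artAlg res,
      Def res_surj (char_rep chi) A ->
      Def res_surj (twist_rep chi (steinberg hp c k)) A,
    (forall (A : artAlg res) (sigma : char_lift chi A),
       exists St_is_lift : is_lift (St_map hp sigma),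
         eta A (lift_class (lift_of_char res_surj sigma)) =
         lift_class (Lift St_is_lift)) /\
    natural_iso eta.
Proof.
have [e [e0 ce dec]] := quadratic_basis hp Qp2_quadratic c_nontrivial.
have ex A (X : Def res_surj (char_rep chi) A) :
    exists s : char_lift chi A, lift_class (lift_of_char res_surj s) = X.
  have [s hs] := lift_char_ex res_surj (class_rep X); exists s.
  by rewrite -(class_repK X); apply/lift_classP.
(* Each class contains exactly one character, by [ex] and [lift_char_inj]; eta is defined through
   it. *)
pose sg A X := projT1 (cid (ex A X)).
have sgP A X : lift_class (lift_of_char res_surj (sg A X)) = X.
  by rewrite /sg; case: cid.
have sgK A s : sg A (lift_class (lift_of_char res_surj s)) = s.
  by apply/lift_char_inj/lift_classP; exact: sgP.
pose StL A (s : char_lift chi A) := St_map_is_lift hp e0 ce dec res_surj s.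
exists (fun A X => lift_class (Lift (StL A (sg A X)))); split=> [A s|].
  by exists (StL A s); rewrite sgK.
split=> [A A' h X|A].
  rewrite -(sgP A X); set s := sg A X.
  rewrite /= !def_map_class.
  have -> : lift_class (bc_lift res_surj h (lift_of_char res_surj s)) =
      lift_class (lift_of_char res_surj (push_char res_surj h s)).
    by apply/lift_classP; exact: bc_char_iso.
  rewrite !sgK; apply/lift_classP/lift_iso_sym.
  exact: (bc_St_iso ce dec).
apply: inj_surj_bij => [X Y /lift_classP E1|Y].
  by rewrite -(sgP A X) -(sgP A Y) (St_lift_inj e0 ce dec Qp2_unramified res_surj E1).
have [s hs] := lift_steinberg_ex e0 ce dec Qp2_unramified res_surj (class_rep Y).
exists (lift_class (lift_of_char res_surj s)); rewrite sgK -(class_repK Y).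
by apply/lift_classP.
Qed.
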